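(* Let $1<q\le p<\infty$, $0<r\le\infty$, $K\in\mathbb{N}_0$, and $f\in\mathcal{M}^p_{q,r}(\mathbb{R}^n)$. Then there exists a triplet $\{\lambda_j\}_{j=1}^\infty\subset[0,\infty)$, $\{Q_j\}_{j=1}^\infty\subset\mathcal{Q}(\mathbb{R}^n)$ and $\{a_j\}_{j=1}^\infty\subset L^\infty(\mathbb{R}^n)\cap\mathcal{P}_K(\mathbb{R}^n)^\perp$ such that $f=\sum_{j=1}^\infty\lambda_ja_j$ in $\mathcal{S}'(\mathbb{R}^n)$ and that $|a_j|\le\chi_{Q_j}$ for all $j$ and, for all $v>0$, $$\left\|\left(\sum_{j=1}^\infty(\lambda_j\chi_{Q_j})^v\right)^{\frac1v}\right\|_{\mathcal{M}^p_{q,r}}\le C_v\|f\|_{\mathcal{M}^p_{q,r}},$$ where the constant $C_v>0$ depends on $v$ (and on the fixed parameters $n,p,q,r,K$) but not on $f$.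
   Context: $\mathbb{N}_0=\mathbb{N}\cup\{0\}$. $L^0(\mathbb{R}^n)$ is the set of all measurable functions on $\mathbb{R}^n$, $\mathcal{Q}(\mathbb{R}^n)$ is the family of all cubes in $\mathbb{R}^n$ with sides parallel to the coordinate axes, $|E|$ is Lebesgue measure, $\chi_E$ is the indicator function of $E$, and $\mathcal{S}'(\mathbb{R}^n)$ is the space of tempered distributions. For measurable $f$ put $\lambda_f(\alpha)=|\{x:|f(x)|>\alpha\}|$ ($\alpha>0$) and $f^\ast(t)=\inf\{\alpha>0:\lambda_f(\alpha)\le t\}$ ($t>0$). The Lorentz quasi-norm is $\|f\|_{L^{q,r}}=\left(\int_0^\infty(t^{1/q}f^\ast(t))^r\frac{dt}{t}\right)^{1/r}$ for $0<q,r<\infty$ and $\|f\|_{L^{q,\infty}}=\sup_{t>0}t^{1/q}f^\ast(t)$. For $0<q\le p<\infty$, $0<r\le\infty$, the Morrey-Lorentz space $\mathcal{M}^p_{q,r}(\mathbb{R}^n)$ is the set of $f\in L^0(\mathbb{R}^n)$ with $\|f\|_{\mathcal{M}^p_{q,r}}=\sup_{Q\in\mathcal{Q}(\mathbb{R}^n)}|Q|^{\frac1p-\frac1q}\|f\chi_Q\|_{L^{q,r}}<\infty$. $\mathcal{P}_K(\mathbb{R}^n)^\perp$ denotes the set of all $f\in L^0(\mathbb{R}^n)$ for which $\langle\cdot\rangle^Kf\in L^1(\mathbb{R}^n)$ and $\int_{\mathbb{R}^n}x^\alpha f(x)\,dx=0$ for every $\alpha\in\mathbb{N}_0^n$ with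 $|\alpha|\le K$, where $\langle x\rangle=(1+|x|^2)^{1/2}$. *)

(* Defs.v *)
From HB Require Import structures.
From mathcomp Require Import all_boot all_order all_algebra.
From mathcomp Require Import all_classical all_reals all_analysis.
From mathcomp Require Import complex.

Set Implicit Arguments.
Unset Strict Implicit.
Unset Printing Implicit Defensive.

Import Order.TTheory GRing.Theory Num.Theory.
Import numFieldNormedType.Exports.

Local Open Scope classical_set_scope.
Local Open Scope ring_scope.
Local Open Scope complex_scope.

(* The ambient space is the Euclidean space of dimension n.+1, so that the
   dimension ranges over the positive integers. *)

Section lebesgue_outer_measure.
Context {R : realType} {n : nat}.
Local Notation E := 'rV[R]_n.+1.
Implicit Types (X : set E) (a b : E) (B : nat -> E * E).

Definition box a b : set E := [set x | forall i, a 0 i <= x 0 i <= b 0 i].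

(* [Num.max 0] makes the volume of an empty box zero. *)
Definition box_volume a b : R := \prod_(i < n.+1) Num.max 0 (b 0 i - a 0 i).

Definition box_cover X : set (nat -> E * E) :=
  [set B | X `<=` \bigcup_k box (B k).1 (B k).2].

Definition leb_outer X : \bar R :=
  ereal_inf [set (\sum_(k <oo) (box_volume (B k).1 (B k).2)%:E)%E
            | B in box_cover X].

Lemma box_volume_ge0 a b : 0 <= box_volume a b.
Proof. by apply: prodr_ge0 => i _; rewrite le_max lexx. Qed.

Let vol (c : E * E) : \bar R := (box_volume c.1 c.2)%:E.

Let vol_ge0 c : (0 <= vol c)%E.
Proof. by rewrite lee_fin box_volume_ge0. Qed.

Lemma leb_outer_ge0 X : (0 <= leb_outer X)%E.
Proof.
apply: le_ereal_inf_tmp => _ [B _ <-]; apply: nneseries_ge0 => k _ _.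
exact: (vol_ge0 (B k)).
Qed.

Lemma leb_outer0 : leb_outer set0 = 0%E.
Proof.
apply/eqP; rewrite eq_le leb_outer_ge0 andbT; apply: ereal_inf_lbound.
exists (fun=> (0, 0)) => //; rewrite eseries0// => k _ _ /=.
by rewrite /box_volume big_ord_recl subrr maxxx mul0r.
Qed.

Lemma le_leb_outer : {homo leb_outer : A B / A `<=` B >-> (A <= B)%E}.
Proof.
move=> A B AB; apply/ereal_inf_le_tmp => _ [F BF <-].
by exists F => //; exact: subset_trans BF.
Qed.

Lemma leb_outer_sigma_subadditive : sigma_subadditive leb_outer.
Proof.
move=> A; have [[i ioo]|] := pselect (exists i, leb_outer (A i) = +oo%E).
  rewrite (eseries_pinfty _ _ ioo) ?leey// => k _.
  by rewrite -ltNye (lt_le_trans _ (leb_outer_ge0 _)).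
rewrite -forallNE => Aoo.
suff add2e (e : {posnum R}) :
    (leb_outer (\bigcup_k A k) <=
     \sum_(i <oo) leb_outer (A i) + e%:num%:E)%E.
  by apply/lee_addgt0Pr => _/posnumP[].
rewrite (le_trans _ (epsilon_trick _ _ _))//; last first.
  by move=> k; exact: leb_outer_ge0.
pose P k B := box_cover (A k) B /\
  (\sum_(j <oo) vol (B j) <= leb_outer (A k) + (e%:num / (2 ^ k.+1)%:R)%:E)%E.
have [G PG] : {G : nat -> nat -> E * E & forall k, P k (G k)}.
  apply: (@choice _ _ P) => k; rewrite /P /leb_outer.
  set S := (X in ereal_inf X); move infS : (ereal_inf S) => iS.
  case: iS infS => [r Sr|Soo|Soo].
  - have en1 : (0 < e%:num / (2 ^ k.+1)%:R :> R)%R by [].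
    have /(lb_ereal_inf_adherent en1) : ereal_inf S \is a fin_num by rewrite Sr.
    move=> [x [B AB muBx] xS].
    by exists B; split => //; rewrite muBx -Sr; exact/ltW.
  - by have := Aoo k; rewrite /leb_outer Soo.
  - suff : lbound S 0%E by move/le_ereal_inf_tmp; rewrite Soo.
    move=> _ [B _ <-]; apply: nneseries_ge0 => j _ _; exact: (vol_ge0 (B j)).
have volG_ge0 x : (0 <= (vol \o uncurry G) x)%E by exact: vol_ge0.
apply: (@le_trans _ _ (\esum_(i in setT) (vol \o uncurry G) i)%E).
  apply: ereal_inf_lbound.
  have /card_esym/ppcard_eqP[f] := card_nat2.
  exists (uncurry G \o f).
    move=> t [i _ Ait]; have [j _ Gt] := (PG i).1 t Ait.
    by exists (f^-1%FUN (i, j)) => //=; rewrite invK ?inE.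
  rewrite -(esum_pred_image (vol \o uncurry G) _ xpredT) ?[fun=> _]set_true//.
  by rewrite image_eq.
rewrite (_ : esum _ _ = \sum_(i <oo) \sum_(j <oo) vol (G i j))%E; last first.
  pose J : nat -> set (nat * nat) := fun i => [set (i, j) | j in setT].
  rewrite (_ : setT = \bigcup_k J k); last first.
    by rewrite predeqE => -[a b]; split => // _; exists a => //; exists b.
  rewrite esum_bigcupT /=; last 2 first.
    - apply/trivIsetP => i j _ _ ij.
      rewrite predeqE => -[k m] /=; split => //= -[] [_] _ [<-{k} _].
      by move=> [m' _] [] /esym/eqP; rewrite (negbTE ij).
    - by move=> [k m]; exact: vol_ge0.
  rewrite -(image_id [set: nat]) -fun_true esum_pred_image//; last first.
    by move=> k _; exact: esum_ge0.
  apply: eq_eseriesr => /= j _.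
  rewrite -(esum_pred_image (vol \o uncurry G) (pair j) predT)//=; last first.
    by move=> ? ? _ _; exact: (@can_inj _ _ _ snd).
  by congr esum; rewrite predeqE => -[a b]; split; move=> [i _ <-]; exists i.
apply: lee_lim.
- apply: is_cvg_nneseries => k *.
  by apply: nneseries_ge0 => m *; exact: (volG_ge0 (k, m)).
- by apply: is_cvg_nneseries => k *; apply: adde_ge0 => //; exact: leb_outer_ge0.
- by near=> k; apply: lee_sum => i _; exact: (PG i).2.
Unshelve. all: by end_near. Qed.

HB.instance Definition _ := isOuterMeasure.Build R E leb_outer
  leb_outer0 leb_outer_ge0 le_leb_outer leb_outer_sigma_subadditive.

End lebesgue_outer_measure.

(* The space with the sigma-algebra of Lebesgue (Caratheodory) measurable
   sets. *)
Definition Rn (R : realType) (n : nat) :=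
  caratheodory_type (@leb_outer R n).
HB.instance Definition _ R n := Measurable.on (Rn R n).

Definition leb {R : realType} {n : nat} : set (Rn R n) -> \bar R :=
  @leb_outer R n.
HB.instance Definition _ (R : realType) (n : nat) :=
  isMeasure.Build _ (Rn R n) R (@leb R n)
    (caratheodory_measure0 (@leb_outer R n))
    (@caratheodory_measure_ge0 _ _ (@leb_outer R n))
    (@caratheodory_measure_sigma_additive _ _ (@leb_outer R n)).

Section function_spaces.
Context {R : realType} {n : nat}.
Local Notation E := 'rV[R]_n.+1.
Local Notation mu := (@leb R n).
Local Notation normc := ComplexField.Normc.normc.
Local Notation Re := (@complex.Re R).
Local Notation Im := (@complex.Im R).
Implicit Types (f a : E -> R[i]) (g : E -> \bar R).

Definition cube (Q : set E) : Prop :=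
  exists (c : E) (l : R),
    0 < l /\ Q = [set x | forall i, c 0 i <= x 0 i <= c 0 i + l].

Definition cmeasurable f : Prop :=
  measurable_fun [set: Rn R n] (Re \o f : Rn R n -> R) /\
  measurable_fun [set: Rn R n] (Im \o f : Rn R n -> R).

Definition cintegrable f : Prop :=
  mu.-integrable [set: Rn R n] (EFin \o (Re \o f)) /\
  mu.-integrable [set: Rn R n] (EFin \o (Im \o f)).

Definition cintegral f : R[i] :=
  Rintegral mu [set: Rn R n] (Re \o f) +i*
  Rintegral mu [set: Rn R n] (Im \o f).

Definition cmod f : E -> \bar R := fun x => (normc (f x))%:E.

Definition Linfty f : Prop := cmeasurable f /\ (Lnorm mu +oo (cmod f) < +oo)%E.

(* The quasi-norms below are defined on extended-real functions [g], since
   infinite sums of nonnegative functions may take the value [+oo]; they are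
   applied to a complex function [f] through its modulus [cmod f]. *)

Definition distribution_function g (s : R) : \bar R :=
  mu [set x | (s%:E < `|g x|)%E].

Definition rearrangement g (t : R) : \bar R :=
  ereal_inf [set s%:E | s in
    [set s : R | 0 < s /\ (distribution_function g s <= t%:E)%E]].

Definition lorentz_norm (q : R) (r : \bar R) g : \bar R :=
  match r with
  | r'%:E => ((\int[@lebesgue_measure R]_(t in `]0%R, +oo[)
      (((t `^ q^-1)%:E * rearrangement g t) `^ r' * (t^-1)%:E)) `^ r'^-1)%E
  | +oo%E =>
      ereal_sup [set ((t `^ q^-1)%:E * rearrangement g t)%E | t in `]0, +oo[]
  | -oo%E => 0%E
  end.

Definition morrey_lorentz_norm (p q : R) (r : \bar R) g : \bar R :=
  ereal_sup [set (mu Q `^ (p^-1 - q^-1) *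
                  lorentz_norm q r (fun x => g x * (\1_Q x)%:E))%E
            | Q in cube].

Definition morrey_lorentz (p q : R) (r : \bar R) f : Prop :=
  cmeasurable f /\ (morrey_lorentz_norm p q r (cmod f) < +oo)%E.

Definition japanese_bracket (x : E) : R := Num.sqrt (1 + \sum_i x 0 i ^+ 2).

Definition monomial (alpha : 'I_n.+1 -> nat) (x : E) : R :=
  \prod_i x 0 i ^+ alpha i.

Definition moments_vanish (K : nat) f : Prop :=
  [/\ cmeasurable f,
      cintegrable (fun x => (japanese_bracket x ^+ K)%:C * f x) &
      forall alpha : 'I_n.+1 -> nat, (\sum_i alpha i <= K)%N ->
        cintegral (fun x => (monomial alpha x)%:C * f x) = 0].

(* [iter_partial [:: i1; ...; im] u] is the partial derivative of [u] taken
   successively in the directions im, ..., i1; for smooth [u] these are the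
   partial derivatives indexed by multi-indices of length m. *)
Definition iter_partial (s : seq 'I_n.+1) (u : E -> R) : E -> R :=
  foldr (fun i w x => 'D_(delta_mx 0 i) w x) u s.

Definition smooth (u : E -> R) : Prop :=
  forall s, continuous (iter_partial s u) /\
    forall i x, derivable (iter_partial s u) x (delta_mx 0 i).

Definition citer_partial (s : seq 'I_n.+1) (phi : E -> R[i]) (x : E) : R[i] :=
  iter_partial s (Re \o phi) x +i*
  iter_partial s (Im \o phi) x.

Definition schwartz_seminorm (N : nat) (phi : E -> R[i]) : \bar R :=
  ereal_sup [set (japanese_bracket z.2 ^+ N *
                  normc (citer_partial z.1 phi z.2))%:E
            | z in [set z : seq 'I_n.+1 * E | (size z.1 <= N)%N]].

Definition schwartz (phi : E -> R[i]) : Prop :=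
  [/\ smooth (Re \o phi), smooth (Im \o phi) &
      forall N, (schwartz_seminorm N phi < +oo)%E].

(* Only the values of [T] on Schwartz functions are meaningful. *)
Definition tempered_distribution (T : (E -> R[i]) -> R[i]) : Prop :=
  (forall (c : R[i]) (phi psi : E -> R[i]), schwartz phi -> schwartz psi ->
     T (fun x => c * phi x + psi x) = c * T phi + T psi) /\
  exists (C : R) (N : nat), forall phi, schwartz phi ->
    ((normc (T phi))%:E <= C%:E * schwartz_seminorm N phi)%E.

Definition pairing f (phi : E -> R[i]) : R[i] :=
  cintegral (fun x => f x * phi x).

(* [f] belongs to S' through the absolutely convergent pairing. *)
Definition regular_tempered f : Prop :=
  (forall phi, schwartz phi -> cintegrable (fun x => f x * phi x)) /\
  tempered_distribution (pairing f).

(* f = \sum_j lambda_j a_j in S'. *)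
Definition tempered_series (f : E -> R[i]) (lambda : nat -> R)
    (a : nat -> E -> R[i]) : Prop :=
  [/\ regular_tempered f, forall j, regular_tempered (a j) &
      forall phi, schwartz phi ->
        normc (\sum_(j < N) (lambda j)%:C * pairing (a j) phi
               - pairing f phi) @[N --> \oo] --> 0].

End function_spaces.

(* Main.v *)
Require Import Defs.
From HB Require Import structures.
From mathcomp Require Import all_boot all_order all_algebra.
From mathcomp Require Import all_classical all_reals all_analysis.
From mathcomp Require Import complex.
From mathcomp Require Import measurable_realfun ess_sup_inf.
From mathcomp Require Import zify ring lra.

Set Implicit Arguments.
Unset Strict Implicit.
Unset Printing Implicit Defensive.

Import Order.TTheory GRing.Theory Num.Theory.
Import numFieldNormedType.Exports.

Local Open Scope classical_set_scope.
Local Open Scope ring_scope.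

(* Let [M] be the dyadic maximal operator. For each integer [k] the set where
   [M|f| > 2^k] splits into maximal dyadic cells, and the averages of [|f|] over
   them are comparable to [2^k]. Let [g_k] be [f] off this set and, on each of its
   cells, the polynomial with the same moments up to order [K]; then
   [|g_k| <= C 2^k] and [f = \sum_k (g_(k+1) - g_k)]. Restricted to a maximal cell
   of level [k], [g_(k+1) - g_k] has vanishing moments, because the cells of level
   [k+1] are nested in those of level [k]; dividing by a multiple of [2^k] gives
   the atoms. At a point [x] the coefficients of the cells through [x] are the
   multiples of [2^k] with [2^k < M|f|(x)], so their l^v norm is at most
   [C_v M|f|(x)] for every [v > 0], and [M] is bounded on the Morrey-Lorentz space
   since [q > 1]. The same pointwise bound dominates the partial sums tested
   against a Schwartz function. *)

(** The atoms must be bounded at every point, not just almost everywhere. So [f] is replaced by zero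
    on the set where |f| > 2 M|f|, which changes neither averages nor pairings. That this set is
    null is a weak form of Lebesgue differentiation: such a set has density at most 1/2 in every
    box, hence measure zero.

    Maximal cells exist because averages over large cells tend to zero uniformly, by the Morrey
    condition with p finite. The cells are chosen from |f|, so real and imaginary parts are cut
    along the same cells.

    The Lorentz quasi-norm is traded for the l^r quasi-norm of the sequence 2^(m/q) f*(2^m), with m
    an integer. Every estimate then becomes a geometric combination of shifts of a sequence, and one
    inequality serves all r, below 1 and infinite alike. For the maximal operator the ratio is
    2^(1/q - 1), and this is where q > 1 enters.

    The cubes of the statement are closed while dyadic cells are half-open. They differ by a null
    set, off which a point lies in at most one stopping cube per level. *)

(** * Lebesgue outer measure: half-spaces, boxes, affine maps *)

Section leb_basics.
Context {R : realType} {n : nat}.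
Local Notation E := 'rV[R]_n.+1.
Local Notation T := (Rn R n).
Local Notation mu := (@leb R n).
Implicit Types (a b c x : E) (X : set E).

Lemma le_leb X Y : X `<=` Y -> (mu X <= mu Y)%E.
Proof. exact: le_leb_outer. Qed.

Lemma leb_bigcup_le (A : nat -> set E) :
  (mu (\bigcup_k A k) <= \sum_(k <oo) mu (A k))%E.
Proof. exact: leb_outer_sigma_subadditive. Qed.

Lemma box_volume00 : box_volume (0 : E) 0 = 0.
Proof. by rewrite /box_volume big_ord_recl subrr maxxx mul0r. Qed.

(** The cover is the box itself, completed by degenerate boxes. Exact measures of cubes are obtained
    below by scaling a unit cell. *)
Lemma leb_box a b : (mu (box a b) <= (box_volume a b)%:E)%E.
Proof.
pose B k : E * E := if k is 0%N then (a, b) else (0, 0).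
have -> : (box_volume a b)%:E = (\sum_(k <oo) (box_volume (B k).1 (B k).2)%:E)%E.
  rewrite (nneseries_split 0 1) => [|k _]; last by rewrite lee_fin box_volume_ge0.
  rewrite add0n big_nat1 eseries0 ?adde0// => k k1 _.
  by case: k k1 => // k _; rewrite /B box_volume00.
apply: ereal_inf_lbound; exists B => // x abx.
by exists 0%N.
Qed.

Lemma box_volume_split a b i (c : R) :
  let b' : E := \row_j (if j == i then Num.min (b 0 i) c else b 0 j) in
  let a' : E := \row_j (if j == i then Num.max (a 0 i) c else a 0 j) in
  box_volume a b' + box_volume a' b = box_volume a b.
Proof.
move=> b' a'; rewrite /box_volume (bigD1 i)//= [X in _ + X](bigD1 i)//= [RHS](bigD1 i)//=.
rewrite (eq_bigr (fun j => Num.max 0 (b 0 j - a 0 j))); last first.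
  by move=> j /negPf ji; rewrite mxE ji.
rewrite [X in _ + _ * X](eq_bigr (fun j => Num.max 0 (b 0 j - a 0 j))); last first.
  by move=> j /negPf ji; rewrite mxE ji.
rewrite -mulrDl; congr *%R; rewrite !mxE eqxx.
move: (a 0 i) (b 0 i) => {a' b'} u v.
case: (leP v c) => vc; case: (leP u c) => uc; do ![case: leP => ?]; lra.
Qed.

(** Caratheodory's criterion, checked on covers: cutting every box of a cover of [X] along the
    hyperplane covers both parts of [X] with the same total volume. *)
Lemma measurable_coordinate_le i (c : R) : measurable ([set x | x 0 i <= c] : set T).
Proof.
apply: le_caratheodory_measurable => X /=.
apply: le_ereal_inf_tmp => _ [B XB <-].
pose b' k : E := \row_j (if j == i then Num.min ((B k).2 0 i) c else (B k).2 0 j).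
pose a' k : E := \row_j (if j == i then Num.max ((B k).1 0 i) c else (B k).1 0 j).
have -> : (\sum_(k <oo) (box_volume (B k).1 (B k).2)%:E =
  \sum_(k <oo) (box_volume (B k).1 (b' k))%:E +
  \sum_(k <oo) (box_volume (a' k) (B k).2)%:E)%E.
  rewrite -nneseriesD => [|k _ _|k _ _]; rewrite ?lee_fin ?box_volume_ge0//.
  apply: eq_eseriesr => k _; rewrite -EFinD; congr EFin.
  by rewrite -(box_volume_split _ _ i c).
apply: leeD; apply: ereal_inf_lbound.
- exists (fun k => ((B k).1, b' k)) => // x [Xx /= xc].
  have [k _ Bkx] := XB _ Xx; exists k => // j /=; rewrite mxE.
  by case: eqP => [->|_]; rewrite ?le_min ?xc ?andbT Bkx.
- exists (fun k => (a' k, (B k).2)) => // x [Xx /= /negP]; rewrite -ltNge => /ltW xc.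
  have [k _ Bkx] := XB _ Xx; exists k => // j /=; rewrite mxE.
  by case: eqP => [->|_]; rewrite ?ge_max ?xc ?andbT Bkx.
Qed.

Lemma measurable_coordinate i : measurable_fun [set: T] (fun x : T => (x : E) 0 i).
Proof.
apply: (measurability (@RGenOInfty.G R)) => [|/= _ [_] [c] -> <-]; first exact: RGenOInfty.measurableE.
rewrite setTI -(setCK (_ @^-1` _)); apply: measurableC.
rewrite (_ : ~` _ = [set x : E | x 0 i <= c]); first exact: measurable_coordinate_le.
by apply/seteqP; split => x /=; rewrite in_itv/= andbT leNgt => /negP.
Qed.

Lemma measurable_box a b : measurable (box a b : set T).
Proof.
rewrite (_ : box a b = \bigcap_(i in [set: 'I_n.+1])
    [set x : T | a 0 i <= (x : E) 0 i <= b 0 i]); last first.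
  by apply/seteqP; split => [x H i _|x H i]; [exact: H|exact: (H i I)].
apply: fin_bigcap_measurable => // i _.
have := @measurable_coordinate i measurableT _ (measurable_itv `[a 0 i, b 0 i]).
by rewrite setTI; congr measurable; apply/seteqP; split => x /=; rewrite in_itv.
Qed.

Definition affine (s : R) c x : E := s *: x + c.

Lemma affineVK s c : s != 0 -> cancel (affine s^-1 (- s^-1 *: c)) (affine s c).
Proof.
move=> s0 x; rewrite /affine scalerDr !scalerA mulrN mulfV// scale1r scaleN1r.
by rewrite subrK.
Qed.

Lemma affine_box s c a b : 0 < s ->
  affine s c @^-1` box (affine s c a) (affine s c b) = box a b.
Proof.
move=> s0; apply/seteqP; split => x /= H i; have := H i;
  by rewrite /affine !mxE !lerD2r !ler_pM2l.
Qed.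

Lemma box_volume_affine s c a b : 0 < s ->
  box_volume (affine s c a) (affine s c b) = s ^+ n.+1 * box_volume a b.
Proof.
move=> s0; rewrite /box_volume -[X in s ^+ X](card_ord n.+1) -prodr_const.
rewrite -big_split/=; apply: eq_bigr => i _.
rewrite /affine !mxE opprD addrACA subrr addr0 -mulrBr maxr_pMr ?mulr0//.
exact: ltW.
Qed.

Lemma leb_affine_le s c X : 0 < s ->
  (mu X <= (s ^+ n.+1)%:E * mu (affine s c @^-1` X))%E.
Proof.
move=> s0; rewrite -lee_pdivrMl ?exprn_gt0//.
apply: le_ereal_inf_tmp => _ [B XB <-].
rewrite lee_pdivrMl ?exprn_gt0// -nneseriesZl; last first.
  by move=> k _; rewrite lee_fin box_volume_ge0.
apply: ereal_inf_lbound.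
exists (fun k => (affine s c (B k).1, affine s c (B k).2)); last first.
  by apply: eq_eseriesr => k _ /=; rewrite box_volume_affine.
move=> x Xx; have [] := XB (affine s^-1 (- s^-1 *: c) x).
  by rewrite /= affineVK// gt_eqF.
move=> k _ Bk; exists k => //=.
by move: Bk; rewrite -(affine_box c _ _ s0) /= affineVK// gt_eqF.
Qed.

(** The reverse inequality is [leb_affine_le] for the inverse map. *)
Lemma leb_affine s c X : 0 < s ->
  mu X = ((s ^+ n.+1)%:E * mu (affine s c @^-1` X))%E.
Proof.
move=> s0; apply/eqP; rewrite eq_le leb_affine_le//=.
have s'0 : 0 < s^-1 by rewrite invr_gt0.
have := leb_affine_le (- s^-1 *: c) (affine s c @^-1` X) s'0.
rewrite exprVn lee_pdivlMl ?exprn_gt0// -comp_preimage.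
rewrite (_ : affine s c \o _ = id)//; apply/funext => x /=.
by rewrite affineVK// gt_eqF.
Qed.

(** Scaling of the outer measure transports Caratheodory's condition along the affine map. *)
Lemma measurable_affine s c : 0 < s -> measurable_fun [set: T] (affine s c : T -> T).
Proof.
move=> s0 _ Y mY; rewrite setTI; apply: le_caratheodory_measurable => X.
have s'0 : 0 < s^-1 by rewrite invr_gt0.
have sX Z : mu Z = ((s^-1 ^+ n.+1)%:E * mu (affine s^-1 (- s^-1 *: c) @^-1` Z))%E.
  exact: leb_affine.
rewrite -/mu [X in (X + _)%E]sX [X in (_ + X)%E]sX [leRHS]sX.
rewrite -muleDr//= ?lee_pmul2l ?lte_fin ?exprn_gt0//; last first.
  by rewrite ge0_adde_def// inE.
set X' := affine s^-1 (- s^-1 *: c) @^-1` X.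
have pY : affine s^-1 (- s^-1 *: c) @^-1` (affine s c @^-1` Y) = Y.
  rewrite -comp_preimage (_ : affine s c \o _ = id)//; apply/funext => x /=.
  by rewrite affineVK// gt_eqF.
rewrite !preimage_setI -!preimage_setC pY -/X'.
by have -> : (mu X' = mu (X' `&` Y) + mu (X' `&` ~` Y))%E by exact: mY.
Qed.

(** [mu] is [s ^+ n.+1] times its pushforward by the affine map, so this is the image-measure
    formula. *)
Lemma ge0_integral_affine s c (D : set T) (h : T -> \bar R) : 0 < s ->
  measurable D -> measurable_fun D h -> (forall x, D x -> (0 <= h x)%E) ->
  (\int[mu]_(x in D) h x =
   (s ^+ n.+1)%:E * \int[mu]_(x in affine s c @^-1` D) h (affine s c x))%E.
Proof.
move=> s0 mD mh h0.
rewrite -(ge0_integral_pushforward (measurable_affine c s0) mu mD mh); last first.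
  by move=> x; rewrite inE; exact: h0.
have sn0 : 0 <= s ^+ n.+1 by rewrite exprn_ge0 ?ltW.
have := ge0_integral_mscale (pushforward mu (affine s c : T -> T)) mD (NngNum sn0) mh h0.
move=> /= <-; first exact: measurable_affine.
move=> mphi; apply: eq_measure_integral => A mA AD.
by rewrite /mscale/= /pushforward; exact: leb_affine.
Qed.

End leb_basics.

(** * Integer powers of two *)

Section powers_of_two.
Context {R : realType}.
Implicit Types (l : R) (g : int).

Lemma pow2_gt0 g : 0 < (2 : R) ^ g.
Proof. by rewrite exprz_gt0. Qed.

Lemma pow2_neq0 g : (2 : R) ^ g != 0.
Proof. by rewrite gt_eqF ?pow2_gt0. Qed.

Lemma pow2D g g' : (2 : R) ^ (g + g') = 2 ^ g * 2 ^ g'.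
Proof. by rewrite expfzDr ?pnatr_eq0. Qed.

Lemma pow2S g : (2 : R) ^ (g + 1) = 2 * 2 ^ g.
Proof. by rewrite pow2D expr1z mulrC. Qed.

Lemma le_pow2 g g' : ((2 : R) ^ g <= 2 ^ g') = (g <= g').
Proof. by rewrite ler_eXz2l// ltr1n. Qed.

Lemma lt_pow2 g g' : ((2 : R) ^ g < 2 ^ g') = (g < g').
Proof. by rewrite ltr_eXz2l// ltr1n. Qed.

Lemma pow2_above l : exists g, l < 2 ^ g.
Proof.
exists (Num.bound `|l|); apply: (le_lt_trans (ler_norm l)).
apply: (lt_trans (archi_boundP (normr_ge0 l))).
by rewrite -exprnP -natrX ltr_nat ltn_expl.
Qed.

Lemma pow2_below l : 0 < l -> exists g, 2 ^ g < l.
Proof.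
move=> l0; have [g lg] := pow2_above l^-1; exists (- g).
by rewrite -invr_expz -ltf_pV2 ?posrE ?invr_gt0 ?pow2_gt0// invrK.
Qed.

Lemma pow2_between l : 0 < l -> exists g, 2 ^ g <= l < 2 ^ (g + 1).
Proof.
move=> l0; have [a la] := pow2_below l0; have [b lb] := pow2_above l.
pose P k := (2 : R) ^ (a + k%:Z) <= l.
have P0 : exists k, P k by exists 0%N; rewrite /P addr0 ltW.
have Pb k : P k -> (k <= `|(b - a)%R|)%N.
  rewrite /P => kl; have : (2 : R) ^ (a + k%:Z) < 2 ^ b by exact: le_lt_trans lb.
  by rewrite lt_pow2 => ?; lia.
case: (ex_maxnP P0 Pb) => k Pk kmax; exists (a + k%:Z).
move: (Pk); rewrite /P => ->; rewrite /= ltNge.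
apply/negP => H; have := kmax k.+1.
rewrite /P (_ : a + k.+1%:Z = a + k%:Z + 1); last by lia.
move=> /(_ H).
by rewrite ltnn.
Qed.

End powers_of_two.

(** * Unions and integrals over countable index types *)

Section countable_families.
Context d {T : measurableType d} {I : countType}.
Implicit Types D : I -> set T.

(** Turns a family over a countable type into a sequence, the form in which sigma-additivity
    applies; padding by [set0] costs no measure. *)
Definition enum_sets D (j : nat) : set T :=
  if pickle_inv j is Some i then D i else set0.

Lemma bigcup_enum_sets D : \bigcup_j enum_sets D j = \bigcup_i D i.
Proof.
rewrite /enum_sets; apply/seteqP; split => [x [j _]|x [i _ Dx]].
  by case: pickle_inv => // i Dx; exists i.
by exists (pickle i) => //=; rewrite pickleK_inv.
Qed.

Lemma trivIset_enum_sets D : trivIset setT D -> trivIset setT (enum_sets D).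
Proof.
move=> /trivIsetP tD; apply/trivIsetP => j k _ _ jk; rewrite /enum_sets.
have := pickle_invK (T := I) j; have := pickle_invK (T := I) k.
case: (pickle_inv k) => [i'|]; last by rewrite setI0.
case: (pickle_inv j) => [i|]; last by rewrite set0I.
move=> /= ki ji; apply: tD => //; apply: contra jk => /eqP ii'.
by rewrite -ji -ki ii'.
Qed.

Lemma measurable_enum_sets D : (forall i, measurable (D i)) ->
  forall j, measurable (enum_sets D j).
Proof. by move=> mD j; rewrite /enum_sets; case: pickle_inv. Qed.

Lemma measurable_bigcup_countable D : (forall i, measurable (D i)) ->
  measurable (\bigcup_i D i).
Proof.
move=> mD; rewrite -bigcup_enum_sets; apply: bigcup_measurable => j _.
exact: measurable_enum_sets.
Qed.

Lemma measure_bigcup_countable (R : realType) (nu : {measure set T -> \bar R}) D :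
  (forall i, measurable (D i)) -> trivIset setT D ->
  nu (\bigcup_i D i) = (\sum_(j <oo) nu (enum_sets D j))%E.
Proof.
move=> mD tD; rewrite -bigcup_enum_sets measure_semi_bigcup//.
- exact: measurable_enum_sets.
- exact: trivIset_enum_sets.
- by apply: bigcup_measurable => j _; exact: measurable_enum_sets.
Qed.

Lemma ge0_integral_bigcup_countable (R : realType) (nu : {measure set T -> \bar R})
    D (h : T -> \bar R) :
  (forall i, measurable (D i)) -> trivIset setT D ->
  measurable_fun (\bigcup_i D i) h -> (forall x, (0 <= h x)%E) ->
  (\int[nu]_(x in \bigcup_i D i) h x =
   \sum_(j <oo) \int[nu]_(x in enum_sets D j) h x)%E.
Proof.
move=> mD tD; rewrite -bigcup_enum_sets => mh h0.
apply: ge0_integral_bigcup => //; first exact: measurable_enum_sets.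
exact: trivIset_enum_sets.
Qed.

End countable_families.

(** * Dyadic cells and the measure of cubes *)

Section dyadic_cells.
Context {R : realType} {n : nat}.
Local Notation E := 'rV[R]_n.+1.
Local Notation T := (Rn R n).
Local Notation mu := (@leb R n).
Local Notation ix := 'rV[int]_n.+1.
Implicit Types (x y : E) (g : int) (m : ix).

Lemma box_cubeE (c : E) l :
  box c (c + const_mx l) = [set x | forall i, c 0 i <= x 0 i <= c 0 i + l].
Proof.
by apply/seteqP; split => x H i; have := H i; rewrite ![(_ + const_mx _) 0 i]mxE [const_mx _ _ _]mxE.
Qed.

(** Larger [g] means coarser: cells of generation [g] have side [2 ^ g], with [g] of either sign. *)
Definition gen g x : ix := \row_i Num.floor (x 0 i / 2 ^ g).

Definition cell g m : set E := [set x | gen g x = m].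

Definition corner g m : E := \row_i ((m 0 i)%:~R * 2 ^ g).

Definition closed_cell g m : set E := box (corner g m) (corner g m + const_mx (2 ^ g)).

Lemma cellP g m x :
  cell g m x <-> forall i, corner g m 0 i <= x 0 i < corner g m 0 i + 2 ^ g.
Proof.
split => [<- i|H].
  rewrite !mxE -ler_pdivlMr ?pow2_gt0// -[X in _ + X]mul1r -mulrDl.
  by rewrite -ltr_pdivrMr ?pow2_gt0// -intrD1 floor_itv.
apply/rowP => i; rewrite mxE; apply/floor_def; have := H i.
by rewrite !mxE -[X in _ < _ + X]mul1r -mulrDl intrD1 ler_pdivlMr ?pow2_gt0// ltr_pdivrMr ?pow2_gt0.
Qed.

Lemma cell_gen g x : cell g (gen g x) x. Proof. by []. Qed.

Lemma trivIset_cell g : trivIset setT (cell g).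
Proof. by apply/trivIsetP => m m' _ _ /eqP mm'; apply/seteqP; split => // x [/= ma m'a]; apply: mm'; rewrite -ma. Qed.

Lemma bigcup_cell g : \bigcup_m cell g m = setT.
Proof. by apply/seteqP; split => // x _; exists (gen g x). Qed.

(** Nestedness, one generation at a time: the floor of [z / 2] depends only on the floor of [z],
    since comparing [z / 2] with an integer amounts to comparing [z] with an even integer. *)
Lemma gen_le g g' x y : g <= g' -> gen g x = gen g y -> gen g' x = gen g' y.
Proof.
move=> gg'; have -> : g' = g + `|g' - g|%N by lia.
elim: `|_|%N => {g' gg'} [|k IH]; first by rewrite addr0.
move=> /IH {IH}; rewrite (_ : g + k.+1%:Z = g + k%:Z + 1); last by lia.
move: (g + k) => {k}g /rowP xy.
apply/rowP => i; have := xy i; rewrite !mxE.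
set a := x 0 i / 2 ^ g; set b := y 0 i / 2 ^ g.
have E2 (z : R) : z / 2 ^ (g + 1) = (z / 2 ^ g) / 2.
  by rewrite pow2S invfM mulrCA mulrC.
rewrite !E2 -/a -/b => ab; apply/esym/floor_def.
have /andP[] := floor_itv (a / 2); set c := Num.floor _ => ca ac.
rewrite ler_pdivlMr// ltr_pdivrMr//.
have e1 : (c%:~R : R) * 2 = (c * 2)%:~R by rewrite intrM.
have e2 : ((c + 1)%:~R : R) * 2 = ((c + 1) * 2)%:~R by rewrite intrM.
rewrite e1 -floor_ge_int -ab floor_ge_int -e1 -ler_pdivlMr// ca/=.
rewrite e2 ltNge -floor_ge_int -ab floor_ge_int -ltNge -e2 -ltr_pdivrMr//.
Qed.

Lemma cell_subset g g' x : g <= g' -> cell g (gen g x) `<=` cell g' (gen g' x).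
Proof. by move=> gg' y /= yx; exact: gen_le gg' yx. Qed.

Lemma measurable_cell g m : measurable (cell g m : set T).
Proof.
rewrite (_ : cell g m = \bigcap_(i in [set: 'I_n.+1])
    [set x : T | corner g m 0 i <= (x : E) 0 i < corner g m 0 i + 2 ^ g]); last first.
  apply/seteqP; split => x; first by move=> /cellP H i _; exact: H.
  by move=> H; apply/cellP => i; exact: (H i I).
apply: fin_bigcap_measurable => // i _.
have := @measurable_coordinate R n i measurableT _
  (measurable_itv `[corner g m 0 i, corner g m 0 i + 2 ^ g[).
by rewrite setTI; congr measurable; apply/seteqP; split => x /=; rewrite in_itv.
Qed.

Lemma cell_sub_closed g m : cell g m `<=` closed_cell g m.
Proof.
move=> x /cellP H i; have /andP[-> /ltW] := H i.
by rewrite [X in _ -> _ <= X]mxE [const_mx _ _ _]mxE.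
Qed.

Lemma cube_closed_cell g m : cube (closed_cell g m).
Proof.
exists (corner g m), (2 ^ g); split; first exact: pow2_gt0.
by rewrite ?/closed_cell box_cubeE.
Qed.

Lemma cell_affine g m : affine (2 ^ g) (corner g m) @^-1` cell g m = cell 0 0.
Proof.
have s0 := @pow2_gt0 R g.
have key i x : (corner g m 0 i <= affine (2 ^ g) (corner g m) x 0 i <
    corner g m 0 i + 2 ^ g) = (corner 0 0 0 i <= x 0 i < corner 0 0 0 i + 2 ^ 0).
  rewrite !mxE mulr0z mul0r add0r expr0z lerDr [X in X < _]addrC ltrD2l.
  by rewrite pmulr_rge0// -[X in _ < X]mulr1 ltr_pM2l.
by apply/seteqP; split => x /= /cellP H; apply/cellP => i; have := H i; rewrite key.
Qed.

(** All cells and cubes are measured as multiples of this constant, by scaling; the value zero is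
    treated apart at the end. *)
Definition unit_volume : R := fine (mu (cell 0 0)).
Local Notation omega := unit_volume.

Lemma leb_unit_cell : mu (cell 0 0) = omega%:E.
Proof.
rewrite fineK// ge0_fin_numE//.
apply: le_lt_trans (le_leb (@cell_sub_closed 0 0)) _.
by apply: le_lt_trans (leb_box _ _) _; rewrite ltry.
Qed.

Lemma unit_volume_ge0 : 0 <= omega.
Proof. by rewrite fine_ge0. Qed.

Definition vol g : R := (2 ^ g) ^+ n.+1 * omega.

Lemma leb_cell g m : mu (cell g m) = (vol g)%:E.
Proof.
by rewrite (leb_affine (corner g m) _ (pow2_gt0 g)) cell_affine leb_unit_cell.
Qed.

Lemma box_null (a b : E) i : a 0 i = b 0 i -> mu (box a b) = 0%E.
Proof.
move=> ab; apply/eqP; rewrite eq_le measure_ge0 andbT.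
apply: le_trans (leb_box _ _) _; rewrite lee_fin /box_volume (bigD1 i)//=.
by rewrite ab subrr maxxx mul0r.
Qed.

Lemma closed_cell_boundary g m : mu (closed_cell g m `\` cell g m) = 0%E.
Proof.
(* The upper face orthogonal to direction [i]: the lower corner is raised to the top in that
   coordinate alone. *)
pose top i : set E := box (\row_j (corner g m 0 j + (j == i)%:R * 2 ^ g))
  (corner g m + const_mx (2 ^ g)).
apply/eqP; rewrite eq_le measure_ge0 andbT.
apply: (@le_trans _ _ (mu (\bigcup_k top (inord k)))).
  apply: le_leb => x [cx /cellP /existsNP[i Hi]]; exists (val i) => //.
  rewrite inord_val => j; have := cx j; rewrite !mxE => /andP[c1 ->]; rewrite andbT.
  case: eqP => [->|_]; last by rewrite mul0r addr0.
  by move: Hi => /negP; rewrite mul1r !mxE negb_and -leNgt; have := cx i; rewrite !mxE => /andP[-> _].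
apply: le_trans (leb_bigcup_le _) _.
rewrite eseries0// => k _ _; apply: (@box_null _ _ (inord k)).
by rewrite !mxE eqxx mul1r.
Qed.

Lemma leb_closed_cell g m : mu (closed_cell g m) = (vol g)%:E.
Proof.
rewrite -(setDUK (@cell_sub_closed g m)) measureU0.
- exact: leb_cell.
- exact: measurable_cell.
- by apply: measurableD; [exact: measurable_box|exact: measurable_cell].
- exact: closed_cell_boundary.
Qed.

Lemma cubeE (Q : set E) : cube Q ->
  exists c l, 0 < l /\ Q = box c (c + const_mx l).
Proof.
move=> [c [l [l0 ->]]]; exists c, l; split => //.
by rewrite ?/closed_cell box_cubeE.
Qed.

Lemma cube_box (c : E) l : 0 < l -> cube (box c (c + const_mx l)).
Proof.
move=> l0; exists c, l; split => //.
by rewrite ?/closed_cell box_cubeE.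
Qed.

Lemma leb_cube (c : E) l : 0 < l -> mu (box c (c + const_mx l)) = (l ^+ n.+1 * omega)%:E.
Proof.
move=> l0; rewrite (leb_affine c _ l0) EFinM; congr (_ * _)%E.
have := leb_closed_cell 0 0; rewrite /vol expr0z expr1n mul1r => <-; congr leb.
have c0 : affine l c 0 = c by rewrite /affine scaler0 add0r.
have cl : affine l c (const_mx 1) = c + const_mx l.
  by apply/rowP => i; rewrite !mxE mulr1 addrC.
have := affine_box c 0 (const_mx 1) l0; rewrite c0 cl => ->; rewrite /closed_cell.
have -> : corner 0 0 = 0 by apply/rowP => i; rewrite !mxE mul0r.
by rewrite expr0z add0r.
Qed.

Lemma cell_near g x y : cell g (gen g x) y -> forall i, `|y 0 i - x 0 i| <= 2 ^ g.
Proof.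
move=> /cellP Hy i; have /cellP /(_ i) := cell_gen g x; have := Hy i.
rewrite ler_norml; move: (corner _ _ 0 i) => c /andP[c1 c2] /andP[c3 c4].
by apply/andP; split; lra.
Qed.

(** Unit cells all have measure [omega], and countably many of them cover the space. *)
Lemma unit_volume_null X : omega = 0 -> mu X = 0%E.
Proof.
move=> w0; apply/eqP; rewrite eq_le measure_ge0 andbT.
apply: (@le_trans _ _ (mu (\bigcup_m cell 0 m))).
  by apply: le_leb; rewrite bigcup_cell.
rewrite measure_bigcup_countable//; last 2 first.
  exact: measurable_cell.
  exact: trivIset_cell.
rewrite eseries0// => j _ _; rewrite /enum_sets.
case: pickle_inv => [m|//].
by apply: etrans (leb_cell _ _) _; rewrite /vol w0 mulr0.
Qed.

End dyadic_cells.

(** * Dyadic averages, stopping cells and the weak-type inequality *)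

Section dyadic_averages.
Context {R : realType} {n : nat}.
Local Notation E := 'rV[R]_n.+1.
Local Notation T := (Rn R n).
Local Notation mu := (@leb R n).
Local Notation omega := (@unit_volume R n).
Local Notation vol := (@vol R n).
Local Notation ix := 'rV[int]_n.+1.
Implicit Types (x y : E) (g : int) (m : ix) (h : E -> R) (s : R).

Definition integral_cell h g m : \bar R :=
  (\int[mu]_(y in (cell g m : set T)) (h y)%:E)%E.

(** Multiplied out to avoid dividing by the volume, which is only known to be nonnegative here. *)
Definition above h s g x : Prop := ((s * vol g)%:E < integral_cell h g (gen g x))%E.

Definition above_level h s : set E := [set x | exists g, above h s g x].

(** [g] is the coarsest generation at which the average exceeds [s]; the cells so obtained are the
    maximal ones of the Calderon-Zygmund decomposition at height [s]. *)
Definition stopped h s g x : Prop :=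
  above h s g x /\ forall g', g < g' -> ~ above h s g' x.

Definition dyadic_maximal h x : \bar R :=
  ereal_sup [set (integral_cell h g (gen g x) * ((vol g)^-1)%:E)%E | g in [set: int]].

(** Stands in for global integrability: it guarantees a coarsest cell above every positive level. *)
Definition vanishing_averages h : Prop :=
  forall s, 0 < s -> exists G, forall g, G <= g -> forall x, ~ above h s g x.

Lemma vol_ge0 g : 0 <= vol g.
Proof. by rewrite mulr_ge0 ?unit_volume_ge0// exprn_ge0// ltW// pow2_gt0. Qed.

Lemma vol_gt0 g : 0 < omega -> 0 < vol g.
Proof. by move=> w0; rewrite mulr_gt0// exprn_gt0// pow2_gt0. Qed.

Lemma volD g g' : vol (g + g') = (2 ^ g) ^+ n.+1 * vol g'.
Proof. by rewrite /vol pow2D exprMn mulrA. Qed.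

Lemma volS g : vol (g + 1) = 2 ^+ n.+1 * vol g.
Proof. by rewrite addrC volD expr1z. Qed.

Lemma le_vol g g' : g <= g' -> vol g <= vol g'.
Proof.
move=> gg'; rewrite /vol ler_wpM2r ?unit_volume_ge0// lerXn2r ?nnegrE ?le_pow2//.
  by rewrite ltW// pow2_gt0.
by rewrite ltW// pow2_gt0.
Qed.

Lemma lt_dyadic_maximal h s x : 0 < omega ->
  ((s%:E < dyadic_maximal h x)%E <-> above_level h s x).
Proof.
move=> w0; split.
  move=> /ereal_sup_gt[_ [g _ <-]]; rewrite lte_pdivlMr ?vol_gt0// => H.
  by exists g; rewrite /above EFinM.
move=> [g H]; apply: lt_le_trans (ereal_sup_ubound _); last by exists g.
by rewrite lte_pdivlMr ?vol_gt0// -EFinM.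
Qed.

Lemma above_gen h s g x y : gen g x = gen g y -> above h s g x -> above h s g y.
Proof. by rewrite /above => ->. Qed.

Lemma stopped_gen h s g x y : gen g x = gen g y -> stopped h s g x -> stopped h s g y.
Proof.
move=> xy [ax sx]; split => [|g' gg' ay]; first exact: above_gen ax.
apply: (sx _ gg'); apply: above_gen ay; apply/esym.
exact: gen_le (ltW gg') xy.
Qed.

Lemma stopped_unique h s g g' x : stopped h s g x -> stopped h s g' x -> g = g'.
Proof.
move=> [a1 s1] [a2 s2]; case: (ltgtP g g') => // gg'.
  by have := s1 _ gg'.
by have := s2 _ gg'.
Qed.

Lemma stopped_exists h s g x : vanishing_averages h -> 0 < s -> above h s g x ->
  exists2 g', g <= g' & stopped h s g' x.
Proof.
move=> vh s0 ax; have [G HG] := vh _ s0.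
pose P k := `[< above h s (g + k%:Z) x >].
have P0 : exists k, P k by exists 0%N; apply/asboolP; rewrite addr0.
have Pb k : P k -> (k <= `|(G - g)%R|)%N.
  move=> /asboolP ak; rewrite leqNgt; apply/negP => kG.
  by apply: HG ak; lia.
case: (ex_maxnP P0 Pb) => k /asboolP Pk kmax; exists (g + k%:Z); first by lia.
split => // g' gg' ag'; have := kmax `|(g' - g)|%N.
have -> : P `|(g' - g)|%N.
  by apply/asboolP; rewrite (_ : g + _ = g') //; lia.
by move=> /(_ isT); lia.
Qed.

Lemma measurable_gen g (P : set ix) : measurable ([set x | P (gen g x)] : set T).
Proof.
rewrite (_ : [set _ | _] = \bigcup_m (if `[< P m >] then cell g m else set0)).
  apply: measurable_bigcup_countable => m.
  by case: ifP => // _; exact: measurable_cell.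
apply/seteqP; split => [x /= Px|x [m _]].
  by exists (gen g x) => //; rewrite asboolT.
by case: asboolP => //= Pm ->.
Qed.

Lemma measurable_above h s g : measurable (above h s g : set T).
Proof. exact: (@measurable_gen g [set m | ((s * vol g)%:E < integral_cell h g m)%E]). Qed.

Lemma measurable_above_level h s : measurable (above_level h s : set T).
Proof.
rewrite (_ : above_level h s = \bigcup_g (above h s g)).
  by apply: measurable_bigcup_countable => g; exact: measurable_above.
by apply/seteqP; split => [x [g ?]|x [g _ ?]]; exists g.
Qed.

Lemma measurable_dyadic_maximal h : 0 < omega ->
  measurable_fun [set: T] (dyadic_maximal h : T -> \bar R).
Proof.
move=> w0; apply: (measurability (@ErealGenOInfty.G R)) => [|/= _ [_ [c ->]] <-].
  exact: ErealGenOInfty.measurableE.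
rewrite setTI (_ : _ @^-1` _ = above_level h c); first exact: measurable_above_level.
apply/seteqP; split => x /=; first by rewrite in_itv/= andbT => /lt_dyadic_maximal; exact.
by move=> /lt_dyadic_maximal H; rewrite in_itv/= andbT H.
Qed.

Lemma dyadic_maximal_ge0 h x : (forall y, 0 <= h y) -> 0 < omega ->
  (0 <= dyadic_maximal h x)%E.
Proof.
move=> h0 w0; apply: le_trans (ereal_sup_ubound _); last by exists 0.
apply: mule_ge0; last by rewrite lee_fin invr_ge0 vol_ge0.
by apply: integral_ge0 => y _; rewrite lee_fin.
Qed.

(** Indexing by all pairs (generation, cell index) gives a countable family without any selection;
    each member is empty or a full cell, as [stopped_cellP] shows. *)
Definition stopped_cell h s (d : int * ix) : set E :=
  [set x | gen d.1 x = d.2 /\ stopped h s d.1 x].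

Lemma stopped_cellE h s d x : stopped_cell h s d x -> stopped_cell h s d = cell d.1 d.2.
Proof.
move=> [xd sx]; apply/seteqP; split => [y []//|y yd]; split => //.
by apply: stopped_gen sx; rewrite xd.
Qed.

Lemma stopped_cellP h s d :
  stopped_cell h s d = set0 \/ stopped_cell h s d = cell d.1 d.2.
Proof.
have [->|/set0P[x /stopped_cellE]] := eqVneq (stopped_cell h s d) set0; first by left.
by right.
Qed.

Lemma measurable_stopped_cell h s d : measurable (stopped_cell h s d : set T).
Proof. by case: (stopped_cellP h s d) => ->//; exact: measurable_cell. Qed.

Lemma trivIset_stopped_cell h s : trivIset setT (stopped_cell h s).
Proof.
apply/trivIsetP => -[g m] [g' m'] _ _ /eqP dd'; apply/seteqP; split => //.
move=> x [[/= xm sx] [xm' sx']]; apply: dd'.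
by move: xm xm' => /= <- <-; rewrite (stopped_unique sx sx').
Qed.

Lemma bigcup_stopped_cell h s : vanishing_averages h -> 0 < s ->
  \bigcup_d stopped_cell h s d = above_level h s.
Proof.
move=> vh s0; apply/seteqP; split => [x [d _ [_ [a _]]]|x [g]]; first by exists d.1.
move=> /(stopped_exists vh s0)[g' _ sx]; by exists (g', gen g' x).
Qed.

(** The stopping cells are disjoint, fill the level set, and on each of them the integral of [h]
    exceeds [s] times the measure; summation gives constant one. *)
Lemma weak_type_vanishing h s : (forall x, 0 <= h x) ->
  measurable_fun [set: T] (h : T -> R) -> vanishing_averages h -> 0 < s ->
  (s%:E * mu (above_level h s) <= \int[mu]_x (h x)%:E)%E.
Proof.
move=> h0 mh vh s0; rewrite -bigcup_stopped_cell//.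
have mhE : measurable_fun [set: T] (EFin \o h : T -> \bar R) by exact/measurable_EFinP.
apply: (@le_trans _ _ (\int[mu]_(x in \bigcup_d stopped_cell h s d) (h x)%:E)%E); last first.
  apply: ge0_subset_integral => //; last by move=> x _; rewrite lee_fin.
  by apply: measurable_bigcup_countable => d; exact: measurable_stopped_cell.
rewrite ge0_integral_bigcup_countable//; first last.
- exact: measurable_funS mhE.
- exact: trivIset_stopped_cell.
- by move=> d; exact: measurable_stopped_cell.
rewrite measure_bigcup_countable//; last 2 first.
  by move=> d; exact: measurable_stopped_cell.
  exact: trivIset_stopped_cell.
rewrite -nneseriesZl//; apply: lee_nneseries => [j _ _|j _].
  by rewrite mule_ge0// lee_fin ltW.
rewrite /enum_sets; case: pickle_inv => [d|]; last by rewrite measure0 mule0 integral_set0.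
have [->|/set0P[x sx]] := eqVneq (stopped_cell h s d) set0.
  by rewrite measure0 mule0 integral_set0.
rewrite (stopped_cellE sx); have [<- [/ltW + _]] := sx.
by rewrite EFinM -(leb_cell _ (gen d.1 x)).
Qed.

Lemma integrable_vanishing h : 0 < omega -> (forall x, 0 <= h x) ->
  measurable_fun [set: T] (h : T -> R) ->
  (\int[mu]_x (h x)%:E < +oo)%E -> vanishing_averages h.
Proof.
move=> w0 h0 mh hoo s s0.
have mhE : measurable_fun [set: T] (EFin \o h : T -> \bar R) by exact/measurable_EFinP.
have [r hr] : exists r : R, (\int[mu]_x (h x)%:E = r%:E)%E.
  exists (fine (\int[mu]_x (h x)%:E)%E); rewrite fineK// ge0_fin_numE//.
  by apply: integral_ge0 => x _; rewrite lee_fin.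
(* The bound by 1 makes [(2 ^ G) ^+ n.+1] at least [2 ^ G], so that [s * vol G] is at least the
   total integral [r]. *)
have [G rG] := pow2_above (Num.max 1 (r / (s * omega))).
move: rG; rewrite gt_max => /andP[G1 rG].
exists G => g Gg x; apply/negP; rewrite -leNgt.
apply: (@le_trans _ _ (\int[mu]_x (h x)%:E)%E).
  apply: ge0_subset_integral => //; first exact: measurable_cell.
  by move=> y _; rewrite lee_fin.
rewrite hr lee_fin; apply: (@le_trans _ _ (s * vol G)); last first.
  by apply: ler_wpM2l; [exact: ltW|exact: le_vol].
rewrite /vol mulrCA -ler_pdivrMr ?mulr_gt0//; apply: (le_trans (ltW rG)).
by rewrite ler_eXnr// ltW.
Qed.

Lemma dyadic_maximal_weak_type h s : 0 < omega -> (forall x, 0 <= h x) ->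
  measurable_fun [set: T] (h : T -> R) -> 0 < s ->
  (mu (above_level h s) <= (s^-1)%:E * \int[mu]_x (h x)%:E)%E.
Proof.
move=> w0 h0 mh s0.
have := @integral_ge0 _ _ _ mu setT (EFin \o h : T -> \bar R) (fun x _ => h0 x).
case: (ltP (\int[mu]_x (h x)%:E)%E +oo%E) => [hoo _|].
  by rewrite lee_pdivlMl//; apply: weak_type_vanishing => //; exact: integrable_vanishing.
by rewrite leye_eq => /eqP -> _; rewrite gt0_muley ?leey// lte_fin invr_gt0.
Qed.

(** * Pointwise domination by the dyadic maximal function *)

Section lebesgue_differentiation.
Variables (h : E -> R) (s : R).
Hypotheses (h0 : forall x, 0 <= h x) (mh : measurable_fun [set: T] (h : T -> R)).
Hypothesis s0 : 0 < s.

Let mhE : measurable_fun [set: T] (EFin \o h : T -> \bar R).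
Proof. exact/measurable_EFinP. Qed.

(** The exceptional set: [h] exceeds [2 * s] although all dyadic averages through the point are at
    most [s]. This forces density at most one half in every box. *)
Let X : set E := [set x | 2 * s < h x] `&` ~` above_level h s.

Let mX : measurable (X : set T).
Proof.
apply: measurableI; last exact/measurableC/measurable_above_level.
have := mh measurableT (measurable_itv `]2 * s, +oo[).
by rewrite setTI; congr measurable; apply/seteqP; split => x /=; rewrite in_itv/= andbT.
Qed.

Let dilate g (a b : E) := box (a - const_mx (2 ^ g)) (b + const_mx (2 ^ g)).

(* The cells of generation [g] that meet [X `&` box a b] cover it, lie in a
   slightly larger box, and on each of them the average of [h] is at most [s]. *)
Let dense_box_dilate g a b :
  ((2 * s)%:E * mu (X `&` box a b) <= s%:E * mu (dilate g a b))%E.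
Proof.
pose D m : set T := if `[< exists2 y, cell g m y & (X `&` box a b) y >] then cell g m else set0.
have mD m : measurable (D m) by rewrite /D; case: ifP => // _; exact: measurable_cell.
have tD : trivIset setT D.
  apply/trivIsetP => m m' _ _ mm'; rewrite /D; do 2 (case: asboolP => _; last by rewrite ?set0I ?setI0).
  by have /trivIsetP := @trivIset_cell R n g; apply.
have mXB : measurable (X `&` box a b : set T) by apply: measurableI => //; exact: measurable_box.
apply: (@le_trans _ _ (\int[mu]_(x in X `&` box a b) (h x)%:E)%E).
  rewrite -integral_cst//; apply: ge0_le_integral => //.
  - by move=> x _; rewrite lee_fin mulr_ge0// ltW.
  - exact: measurable_funS mhE.
  - by move=> x [[/ltW xs _] _]; rewrite lee_fin.
apply: (@le_trans _ _ (\int[mu]_(x in \bigcup_m D m) (h x)%:E)%E).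
  apply: ge0_subset_integral => //.
  - exact: measurable_bigcup_countable.
  - exact: measurable_funS mhE.
  - by move=> x _; rewrite lee_fin.
  - move=> x Xx; exists (gen g x) => //; rewrite /D asboolT//.
    by exists x.
apply: (@le_trans _ _ (s%:E * mu (\bigcup_m D m))%E); last first.
  rewrite lee_pmul2l ?lte_fin//; apply: le_leb => x [m _]; rewrite /D.
  case: asboolP => // -[y ym [_ yab]] xm i.
  have := @cell_near _ _ g x y; rewrite [gen g x]xm => /(_ ym i).
  by rewrite ler_norml !mxE; have := yab i => /andP[? ?] /andP[? ?]; apply/andP; split; lra.
rewrite ge0_integral_bigcup_countable//; last exact: measurable_funS mhE.
rewrite measure_bigcup_countable// -nneseriesZl//; apply: lee_nneseries => [j _ _|j _].
  by apply: integral_ge0 => x _; rewrite lee_fin.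
rewrite /enum_sets; case: pickle_inv => [m|]; last by rewrite measure0 mule0 integral_set0.
rewrite /D; case: asboolP => [[y ym [[_ ny] _]]|_]; last by rewrite measure0 mule0 integral_set0.
apply: contrapT => /negP; rewrite -ltNge => H; apply: ny; exists g.
by move: H; rewrite /above [gen g y]ym EFinM -(leb_cell g m).
Qed.

(** Limit of [dense_box_dilate] over finer and finer generations: the dilated boxes decrease to the
    closed box. *)
Let dense_box a b :
  ((2 * s)%:E * mu (X `&` box a b) <= s%:E * (box_volume a b)%:E)%E.
Proof.
pose B (j : nat) : set T := dilate (- j%:Z) a b.
have mB j : measurable (B j) by exact: measurable_box.
have capB : \bigcap_j B j = box a b.
  apply/seteqP; split => [x Bx i|x abx j _ i]; last first.
    have := abx i; rewrite !mxE => /andP[? ?]; have := @pow2_gt0 R (- j%:Z) => ?.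
    by apply/andP; split; lra.
  have Bi j : a 0 i - 2 ^ (- j%:Z) <= x 0 i <= b 0 i + 2 ^ (- j%:Z).
    by have := Bx j I i; rewrite !mxE.
  have small e : 0 < e -> exists j : nat, (2 : R) ^ (- j%:Z) < e.
    move=> /pow2_below[g ge]; exists `|g|%N; apply: le_lt_trans ge.
    by rewrite le_pow2; lia.
  apply/andP; split; apply/ler_addgt0Pr => e /small[j je]; have /andP[? ?] := Bi j; lra.
have dB : {homo B : i j / (i <= j)%N >-> (j <= i)%O}.
  move=> i j ij; apply/subsetPset => x Bx k; have := Bx k; rewrite !mxE => /andP[? ?].
  have : (2 : R) ^ (- j%:Z) <= 2 ^ (- i%:Z) by rewrite le_pow2; lia.
  by move=> ?; apply/andP; split; lra.
have := @nonincreasing_cvg_mu _ _ _ mu B _ mB; rewrite capB => /(_ _ (measurable_box _ _) dB) H.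
have {}H : mu (B j) @[j --> \oo] --> mu (box a b).
  by apply: H; apply: le_lt_trans (leb_box _ _) _; rewrite ltry.
apply: (@le_trans _ _ (s%:E * mu (box a b))%E); last first.
  by rewrite lee_pmul2l ?lte_fin//; exact: leb_box.
have {}H : (s%:E * mu (B j))%E @[j --> \oo] --> (s%:E * mu (box a b))%E by exact: cvgeZl.
rewrite -(cvg_lim _ H)//; apply: lime_ge; first by apply/cvg_ex; eexists; exact: H.
by near=> j; exact: dense_box_dilate.
Unshelve. all: by end_near. Qed.

(** Density at most one half in all boxes forces measure zero: covering a piece of finite outer
    measure [r] by boxes of total volume below [r + e] gives 2 r <= r + e for every positive [e]. *)
Let dense_null m : mu (X `&` cell 0 m) = 0%E.
Proof.
have mXm : measurable (X `&` cell 0 m : set T).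
  by apply: measurableI => //; exact: measurable_cell.
have [r Xr] : exists r : R, mu (X `&` cell 0 m) = r%:E.
  exists (fine (mu (X `&` cell 0 m))); rewrite fineK// ge0_fin_numE//.
  apply: (@le_lt_trans _ _ (mu (cell 0 m))); last by rewrite leb_cell ltry.
  by apply: le_leb => x [].
apply/eqP; rewrite eq_le measure_ge0 andbT Xr; apply/lee_addgt0Pr => e e0.
have [|_ [B XB <-]] := @lb_ereal_inf_adherent _
    [set (\sum_(k <oo) (box_volume (B k).1 (B k).2)%:E)%E | B in box_cover (X `&` cell 0 m)] _ e0.
  by rewrite [ereal_inf _]Xr.
rewrite [ereal_inf _]Xr => Be.
have le2 : ((2 * s)%:E * r%:E <= s%:E * (r%:E + e%:E))%E.
  rewrite -Xr; apply: (@le_trans _ _ (\sum_(k <oo) (2 * s)%:E * mu (X `&` box (B k).1 (B k).2))%E).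
    rewrite nneseriesZl//.
    rewrite lee_pmul2l ?lte_fin ?mulr_gt0//.
    apply: le_trans (leb_bigcup_le _); apply: le_leb => x Xx.
    by have [k _ ?] := XB x Xx; exists k => //; split => //; case: Xx.
  apply: (@le_trans _ _ (\sum_(k <oo) s%:E * (box_volume (B k).1 (B k).2)%:E)%E).
    apply: lee_nneseries => [k _ _|k _]; last exact: dense_box.
    by rewrite mule_ge0// lee_fin mulr_ge0// ltW.
  rewrite nneseriesZl; last by move=> k _; rewrite lee_fin box_volume_ge0.
  by rewrite lee_pmul2l ?lte_fin// Xr ltW.
move: le2; rewrite -EFinD -!EFinM !lee_fin add0r mulrC -subr_ge0 => le2.
have : 0 <= s * (e - r) by rewrite (le_trans le2)//; lra.
by rewrite pmulr_rge0// subr_ge0.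
Qed.

Lemma leb_above_averages : mu ([set x | 2 * s < h x] `&` ~` above_level h s) = 0%E.
Proof.
apply/eqP; rewrite eq_le measure_ge0 andbT -/X.
apply: (@le_trans _ _ (mu (\bigcup_m (X `&` cell 0 m)))).
  by apply: le_leb => x Xx; exists (gen 0 x).
rewrite measure_bigcup_countable.
- rewrite eseries0// => j _ _; rewrite /enum_sets; case: pickle_inv => [m|//].
  exact: dense_null.
- by move=> m; apply: measurableI => //; exact: measurable_cell.
- apply/trivIsetP => m m' _ _ mm'; rewrite setIACA.
  by have /trivIsetP := @trivIset_cell R n 0 => /(_ m m' I I mm') ->; rewrite setI0.
Qed.

End lebesgue_differentiation.

(** Where the inequality fails, a rational level fits strictly between the maximal function and
    [h x / 2], so the exceptional set is a countable union of null sets from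
    [leb_above_averages]. *)
Lemma ae_le_dyadic_maximal h : 0 < omega -> (forall x, 0 <= h x) ->
  measurable_fun [set: T] (h : T -> R) ->
  mu [set x | ~ ((h x)%:E <= 2%:E * dyadic_maximal h x)%E] = 0%E.
Proof.
move=> w0 h0 mh; apply/eqP; rewrite eq_le measure_ge0 andbT.
pose Y (t : rat) : set E := if 0 < t then [set x | 2 * ratr t < h x] `&` ~` above_level h (ratr t) else set0.
apply: (@le_trans _ _ (mu (\bigcup_j enum_sets (Y : rat -> set T) j))).
  apply: le_leb => x /= /negP; rewrite -ltNge bigcup_enum_sets => hx.
  have M0 := dyadic_maximal_ge0 x h0 w0.
  have [M Mx] : exists M, dyadic_maximal h x = M%:E.
    exists (fine (dyadic_maximal h x)); rewrite fineK// ge0_fin_numE//.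
    case: (dyadic_maximal h x) hx M0 => // [r _ _|]; first by rewrite ltry.
    by rewrite gt0_muley.
  move: hx M0; rewrite Mx -EFinM lte_fin lee_fin => hx M0.
  have [|t] := @rat_in_itvoo R M (h x / 2); first by rewrite ltr_pdivlMr// mulrC.
  rewrite in_itv/= => /andP[Mt th]; exists t => //.
  have t0 : 0 < t by rewrite -(@ltr0q R) (le_lt_trans M0).
  rewrite /Y t0; split => /=; first by rewrite mulrC -ltr_pdivlMr.
  by move=> /(lt_dyadic_maximal _ _ _ w0); rewrite Mx lte_fin ltNge (ltW Mt).
apply: le_trans (leb_bigcup_le _) _; rewrite eseries0// => j _ _; rewrite /enum_sets.
case: pickle_inv => [t|//]; rewrite /Y; case: ifPn => // t0.
by apply: leb_above_averages; rewrite // ltr0q.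
Qed.

End dyadic_averages.

(** * Decreasing rearrangements *)

Section rearrangement_lemmas.
Context {R : realType} {n : nat}.
Local Notation E := 'rV[R]_n.+1.
Local Notation T := (Rn R n).
Local Notation mu := (@leb R n).
Implicit Types (g h : E -> \bar R) (s t : R).
Local Open Scope ereal_scope.

Lemma rearrangement_ge0 g t : 0 <= rearrangement g t.
Proof. by apply: le_ereal_inf_tmp => _ [s [s0 _] <-]; rewrite lee_fin ltW. Qed.

Lemma rearrangement_nonincreasing g t t' : (t <= t')%R ->
  rearrangement g t' <= rearrangement g t.
Proof.
move=> tt'; apply: ereal_inf_le_tmp => _ [s [s0 gs] <-]; exists s => //; split => //.
by apply: le_trans gs _; rewrite lee_fin.
Qed.

Lemma rearrangement_le g s t : (0 < s)%R -> distribution_function g s <= t%:E ->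
  rearrangement g t <= s%:E.
Proof. by move=> s0 gs; apply: ereal_inf_lbound; exists s. Qed.

Lemma distribution_le g s t : rearrangement g t < s%:E ->
  distribution_function g s <= t%:E.
Proof.
move=> /ereal_inf_lt[_ [s' [s'0 gs'] <-]] ss'; apply: le_trans gs'.
by apply: le_leb => x /=; apply: lt_trans.
Qed.

Lemma rearrangement_cases g t :
  rearrangement g t = +oo \/ exists2 r : R, (0 <= r)%R & rearrangement g t = r%:E.
Proof.
have := rearrangement_ge0 g t; case: rearrangement => [r r0|_|//]; last by left.
by right; exists r.
Qed.

(** If a level [s] is admissible for [h], then [c * s + b] is admissible for [g]. The constant [b]
    accounts for what a truncation or localization leaves over. *)
Lemma rearrangement_affine g h (c b : R) t : (0 < c)%R -> (0 <= b)%R ->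
  mu [set x | ~ (`|g x| <= c%:E * `|h x| + b%:E)] = 0 ->
  rearrangement g t <= c%:E * rearrangement h t + b%:E.
Proof.
move=> c0 b0 gh; have [->|[r r0 rE]] := rearrangement_cases h t.
  by rewrite gt0_muley ?lte_fin// leey.
rewrite rE; apply/lee_addgt0Pr => e e0.
have ec0 : (0 < e / c)%R by rewrite divr_gt0.
have [|_ [s [s0 hs] <-]] := @lb_ereal_inf_adherent _
    [set s%:E | s in [set s : R | (0 < s)%R /\ distribution_function h s <= t%:E]] _ ec0.
  by rewrite [ereal_inf _]rE.
rewrite [ereal_inf _]rE -EFinD lte_fin => sr.
apply: (@le_trans _ _ (c * s + b)%:E); last first.
  rewrite -EFinM -!EFinD lee_fin addrAC lerD2r.
  rewrite -[e](@divfK _ c) ?gt_eqF// [(e / c * c)%R]mulrC -mulrDr ler_pM2l//.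
  exact: ltW.
apply: rearrangement_le; first by rewrite ltr_pwDl// mulr_gt0.
apply: le_trans hs.
(* Subadditivity of the outer measure holds for arbitrary sets; the level set of [h] and the
   exceptional set are put in a sequence padded by [set0]. *)
apply: (@le_trans _ _ (mu (\bigcup_k (if k is 0%N then [set x | s%:E < `|h x|] else
    if k is 1%N then [set x | ~ (`|g x| <= c%:E * `|h x| + b%:E)] else set0)))).
  apply: le_leb => x /= gx.
  have [|/negP] := boolP (`|g x| <= c%:E * `|h x| + b%:E); last by exists 1%N.
  move=> H; exists 0%N => //=; move: gx => /lt_le_trans/(_ H).
  by rewrite EFinD EFinM lteD2rE// lte_pmul2l ?lte_fin.
apply: le_trans (leb_bigcup_le _) _.
rewrite (nneseries_split 0 2) => [|k _]; last exact: measure_ge0.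
rewrite add0n big_nat_recl// big_nat1 gh adde0 eseries0 ?adde0//.
by case=> [|[|k]].
Qed.

Lemma rearrangement_support g t : mu [set x | g x != 0] <= t%:E ->
  rearrangement g t = 0.
Proof.
move=> gt; apply/eqP; rewrite eq_le rearrangement_ge0 andbT.
apply/lee_addgt0Pr => e e0; rewrite add0e; apply: rearrangement_le => //.
apply: le_trans gt; apply: le_leb => x /=; apply: contraTneq => ->.
by rewrite abse0 lte_fin -leNgt ltW.
Qed.

Lemma rearrangement_weak_type g t (I : \bar R) : (0 < t)%R -> 0 <= I ->
  (forall s, (0 < s)%R -> distribution_function g s <= (s^-1)%:E * I) ->
  rearrangement g t <= (t^-1)%:E * I.
Proof.
move=> t0 I0 H; case: I I0 H => [i|_|//]; last first.
  by rewrite gt0_muley ?leey// lte_fin invr_gt0.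
rewrite lee_fin => i0 H; apply/lee_addgt0Pr => e e0; rewrite -EFinM -EFinD.
have s0 : (0 < t^-1 * i + e)%R by rewrite ltr_wpDl// mulr_ge0// invr_ge0 ltW.
apply: rearrangement_le => //; apply: le_trans (H _ s0) _.
rewrite -EFinM lee_fin mulrC ler_pdivrMr// mulrDr mulrA mulfV ?gt_eqF// mul1r.
by rewrite lerDl mulr_ge0// ltW.
Qed.

Section measurable_function.
Variable g : E -> \bar R.
Hypothesis mg : measurable_fun [set: T] (g : T -> \bar R).

Let mabs : measurable_fun [set: T] (fun x : T => `|g x|).
Proof. exact: measurableT_comp. Qed.

Lemma measurable_gt_abs (c : \bar R) : measurable ([set x | c < `|g x|] : set T).
Proof.
by rewrite -[X in measurable X]setTI; apply: emeasurable_fun_o_infty.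
Qed.

(** Right continuity of the distribution function: the level sets at heights r + 1/(k+1) increase to
    the one at height [r]. *)
Lemma leb_gt_rearrangement t : (0 <= t)%R ->
  mu [set x | rearrangement g t < `|g x|] <= t%:E.
Proof.
move=> t0; have [->|[r r0 rE]] := rearrangement_cases g t.
  rewrite (_ : [set _ | _] = set0) ?measure0 ?lee_fin//.
  by apply/seteqP; split => // x /=; rewrite ltNge leey.
rewrite rE; pose A (k : nat) : set T := [set x | (r + k.+1%:R^-1)%:E < `|g x|].
have mA k : measurable (A k) by exact: measurable_gt_abs.
have AU : \bigcup_k A k = [set x | r%:E < `|g x|].
  apply/seteqP; split => [x [k _]|x /=].
    by apply: lt_trans; rewrite lte_fin ltrDl invr_gt0.
  case gx : `|g x| => [y| |//]; last by exists 0%N => //; rewrite /A/= gx ltry.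
  rewrite lte_fin => ry; have [k ky] := ltr_add_invr ry.
  by exists k => //; rewrite /A/= gx lte_fin.
have ndA : {homo A : i j / (i <= j)%N >-> (i <= j)%O}.
  move=> i j ij; apply/subsetPset => x; rewrite /A/=; apply: le_lt_trans.
  by rewrite lee_fin lerD2l lef_pV2 ?posrE// ler_nat.
have H : mu (A k) @[k --> \oo] --> mu (\bigcup_k A k).
  by apply: nondecreasing_cvg_mu => //; exact: bigcupT_measurable.
move: H; rewrite AU => H; rewrite -(cvg_lim _ H)//.
apply: lime_le; first by apply/cvg_ex; eexists; exact: H.
near=> k; apply: (@distribution_le g (r + k.+1%:R^-1)%R).
by rewrite rE lte_fin ltrDl invr_gt0.
Unshelve. all: by end_near. Qed.

Local Notation rho m := (rearrangement g ((2 : R) ^ m)%R).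

(* The layers [rho (m-i) < g <= rho (m-i-1)] exhaust the set where [g > rho m],
   and the [i]-th one has measure at most [2^(m-i)]. *)
Lemma integral_above_rearrangement (m : int) : (forall x, 0 <= g x) ->
  \int[mu]_(x in [set x | rho m < g x]) g x <=
  \sum_(i <oo) ((2 : R) ^ (m - i%:Z))%:E * rho (m - i%:Z - 1).
Proof.
move=> g0.
have mlev c : measurable ([set x | c < g x] : set T).
  rewrite (_ : [set _ | _] = [set x | c < `|g x|]); first exact: measurable_gt_abs.
  by apply/seteqP; split => x /=; rewrite gee0_abs.
pose L (i : nat) : set T := [set x | rho (m - i%:Z) < g x].
have Lle i : mu (L i) <= ((2 : R) ^ (m - i%:Z))%:E.
  rewrite (_ : L i = [set x | rho (m - i%:Z) < `|g x|]).
    by apply: leb_gt_rearrangement; rewrite ltW// pow2_gt0.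
  by apply/seteqP; split => x /=; rewrite /L/= gee0_abs.
have Ldec i j : (i <= j)%N -> L j `<=` L i.
  move=> ij x; rewrite /L/=; apply: le_lt_trans; apply: rearrangement_nonincreasing.
  by rewrite le_pow2; lia.
(* Index 0 collects the points lying in every [L j], a null set; the other indices are differences
   of consecutive level sets. *)
pose F (i : nat) : set T := if i is j.+1 then L j `\` L j.+1 else \bigcap_j L j.
have mL i : measurable (L i) by exact: mlev.
have mF i : measurable (F i).
  by case: i => [|j]; [exact: bigcapT_measurable|exact: measurableD].
have tF : trivIset setT F.
  have FF i j x : F i x -> F j x -> (j < i)%N -> False.
    case: i => [//|i]; case: j => [|j] /= [Li nLi].
      by move=> /(_ i.+1 I).
    by move=> [Lj nLj] ji; apply: nLj; apply: Ldec Li.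
  apply/trivIsetP => i j _ _ ij; apply/seteqP; split => // x [Fi Fj].
  by case: (ltngtP i j) ij => // ij _; [exact: FF Fj Fi ij|exact: FF Fi Fj ij].
have UF : \bigcup_i F i = [set x | rho m < g x].
  apply/seteqP; split => [x [[|i] _]|x /= mx].
  - by move=> /(_ 0%N I); rewrite /L/= subr0.
  - by move=> [/(Ldec 0%N i (leq0n i))]; rewrite /L/= subr0.
  have [H|/existsNP[j nj]] := pselect (forall j, L j x); first by exists 0%N => // j _.
  have ex : exists j, `[< ~ L j x >] by exists j; apply/asboolP.
  case: (ex_minnP ex) => -[|k] /asboolP nk kmin.
    by exfalso; apply: nk; rewrite /L/= subr0.
  exists k.+1 => //; split => //; apply: contrapT => nLk.
  by have := kmin k; rewrite asboolT// ltnn => /(_ isT).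
have F0 : mu (F 0%N) = 0.
  apply/eqP; rewrite eq_le measure_ge0 andbT; apply/lee_addgt0Pr => e e0; rewrite add0e.
  have [k ke] := pow2_below e0.
  apply: (@le_trans _ _ (mu (L `|(m - k)%R|%N))).
    by apply: le_leb => x; exact.
  apply: le_trans (Lle _) _; rewrite lee_fin (le_trans _ (ltW ke))// le_pow2; lia.
rewrite -UF ge0_integral_bigcup//; last exact: measurable_funS mg.
rewrite (nneseries_split 0 1) => [|k _]; last exact: integral_ge0.
rewrite add0n big_nat1 null_set_integral//; last exact: measurable_funS mg.
rewrite add0e -(@nneseries_addn _ _ 1) => [|i]; last exact: integral_ge0.
apply: lee_nneseries => [i _ _|i _]; first exact: integral_ge0.
rewrite addn1; apply: (@le_trans _ _ (\int[mu]_(x in F i.+1) cst (rho (m - i%:Z - 1)%R) x)).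
  apply: ge0_le_integral => //; first exact: measurable_funS mg.
  move=> x [_] /negP; rewrite -leNgt /L/=.
  by rewrite (_ : (m - i.+1%:Z = m - i%:Z - 1)%R)//; lia.
rewrite integral_cst// muleC; apply: lee_wpmul2r; first exact: rearrangement_ge0.
by apply: le_trans (Lle i); apply: le_leb => x [].
Qed.

(** The rearrangement vanishes at [2 ^ m] when the support has measure at most [2 ^ m], so
    [integral_above_rearrangement] captures the whole integral. *)
Lemma integral_le_rearrangement (m : int) : (forall x, 0 <= g x) ->
  mu [set x | g x != 0] <= ((2 : R) ^ m)%:E ->
  \int[mu]_x g x <= \sum_(i <oo) ((2 : R) ^ (m - i%:Z))%:E * rho (m - i%:Z - 1).
Proof.
move=> g0 gm; apply: le_trans (integral_above_rearrangement m g0).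
rewrite rearrangement_support// [X in X <= _]integral_mkcond/= [X in _ <= X]integral_mkcond/=.
rewrite le_eqVlt; apply/orP; left; apply/eqP; apply: eq_integral => x _; rewrite !patchE in_setT.
by case: ifPn => //; rewrite notin_setE/= => /negP; rewrite -leNgt => gx0; apply/eqP; rewrite eq_le gx0 g0.
Qed.

End measurable_function.

End rearrangement_lemmas.

(** * Sequence quasi-norms over the integers *)

Section double_sequences.
Context {R : realType}.
Local Open Scope ereal_scope.
Implicit Types (A B : int -> \bar R) (r : \bar R).

Lemma esum_exchange (S T : choiceType) (a : S -> T -> \bar R) :
  (forall i j, 0 <= a i j) ->
  \esum_(i in [set: S]) \esum_(j in [set: T]) a i j =
  \esum_(j in [set: T]) \esum_(i in [set: S]) a i j.
Proof.
move=> a0; rewrite (esum_esum (J := fun=> setT))// (esum_esum (J := fun=> setT))//.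
apply: (@reindex_esum _ _ _ _ _ (fun k => (k.2, k.1))); split.
- by move=> [i j].
- by move=> [i j] [i' j'] _ _ [-> ->].
- by move=> [i j] _; exists (j, i).
Qed.

Lemma esumZ_le (S : choiceType) (a : S -> \bar R) (c : R) : (0 <= c)%R ->
  (forall i, 0 <= a i) ->
  \esum_(i in [set: S]) (c%:E * a i) <= c%:E * \esum_(i in [set: S]) a i.
Proof.
move=> c0 a0; apply: ge_ereal_sup => _ [X XS <-].
rewrite -ge0_mule_fsumr//; apply: lee_wpmul2l; first by rewrite lee_fin.
by apply: esum_ge; exists X.
Qed.

Lemma esum_shift (a : int -> \bar R) (k : int) :
  \esum_(i in [set: int]) a (i - k)%R = \esum_(i in [set: int]) a i.
Proof.
rewrite [RHS](@reindex_esum _ _ _ [set: int] _ (fun i => (i - k)%R))//; split => //.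
- by move=> i j _ _; exact: addIr.
- by move=> i _; exists (i + k)%R => //; rewrite addrK.
Qed.

Lemma geometric_eseries (w : R) : (0 <= w < 1)%R ->
  \sum_(i <oo) (w ^+ i)%:E = ((1 - w)^-1)%:E :> \bar R.
Proof.
move=> /andP[w0 w1]; apply/cvg_lim => //.
rewrite (_ : (fun _ => _) = EFin \o series (geometric 1%R w)); last first.
  apply/funext => k; rewrite /series/= -sumEFin; apply: eq_bigr => i _.
  by rewrite /geometric/= mul1r.
apply: cvg_EFin; first by near=> k.
rewrite (_ : fine \o _ = series (geometric 1%R w)); last by apply/funext => k.
by rewrite -[X in _ --> X]mul1r; apply: cvg_geometric_series; rewrite ger0_norm.
Unshelve. all: by end_near. Qed.

Lemma esum_single (I : choiceType) (i0 : I) (y : \bar R) : (0 <= y)%E ->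
  \esum_(i in [set: I]) (if i == i0 then y else 0%E) = y.
Proof.
move=> y0; rewrite -[RHS](esum_set1 (t := i0) (a := fun=> y))// [RHS]esum_mkcond.
apply: eq_esum => i _; have -> : (i \in [set i0]) = (i == i0) by apply/idP/eqP; rewrite inE.
by [].
Qed.

Lemma nneseries_pickle (I : countType) (f : I -> \bar R) : (forall i, 0 <= f i)%E ->
  (\sum_(j <oo) oapp f 0 (pickle_inv j) = \esum_(i in [set: I]) f i)%E.
Proof.
move=> f0; have o0 j : (0 <= oapp f 0 (pickle_inv j))%E by case: pickle_inv.
rewrite nneseries_esumT//.
have -> : \esum_(i in [set: I]) f i =
    \esum_(j in pickle @` [set: I]) oapp f 0%E (pickle_inv j).
  rewrite esum_image; last by move=> i j _ _; exact: (pcan_inj pickleK_inv).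
  by apply: eq_esum => i _; rewrite pickleK_inv.
rewrite [RHS]esum_mkcond; apply: eq_esum => j _; case: ifPn => //.
rewrite notin_setE => nj; have := pickle_invK (T := I) j.
by case: pickle_inv => [i /= ij|//]; exfalso; apply: nj; exists i.
Qed.

(** The l^r quasi-norm over the integers; the value at [-oo] is a default matching
    [lorentz_norm]. *)
Definition seqnorm r A : \bar R :=
  match r with
  | r'%:E => (\esum_(m in [set: int]) (A m `^ r')) `^ r'^-1
  | +oo => ereal_sup (range A)
  | -oo => 0
  end.

Lemma seqnorm_ge0 r A : (forall m, 0 <= A m) -> 0 <= seqnorm r A.
Proof.
case: r => [r| |] A0 //=; first exact: poweR_ge0.
by apply: le_trans (A0 0%R) _; apply: ereal_sup_ubound; exists 0%R.
Qed.

Lemma le_poweR (x y : \bar R) (r : R) : (0 <= r)%R -> 0 <= x -> x <= y -> x `^ r <= y `^ r.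
Proof.
move=> r0 x0 xy; apply: gt0_ler_poweR => //; rewrite in_itv/= ?x0 ?leey//.
by rewrite (le_trans x0 xy).
Qed.

Lemma poweRK (x : \bar R) (r : R) : (0 < r)%R -> 0 <= x -> (x `^ r) `^ r^-1 = x.
Proof. by move=> r0 x0; rewrite -poweRrM mulfV ?gt_eqF// poweRe1. Qed.

Lemma poweRVK (x : \bar R) (r : R) : (0 < r)%R -> 0 <= x -> (x `^ r^-1) `^ r = x.
Proof. by move=> r0 x0; rewrite -poweRrM mulVf ?gt_eqF// poweRe1. Qed.

Lemma le_seqnorm r A B : 0 < r -> (forall m, 0 <= A m <= B m) ->
  seqnorm r A <= seqnorm r B.
Proof.
case: r => [r| |//] /=; rewrite ?lte_fin => r0 AB.
  apply: le_poweR; first by rewrite invr_ge0 ltW.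
    by apply: esum_ge0 => m _; exact: poweR_ge0.
  apply: le_esum => m _; have /andP[? ?] := AB m.
  by apply: le_poweR => //; exact: ltW.
apply: ge_ereal_sup => _ [m _ <-]; have /andP[_ H] := AB m.
by apply: le_trans H _; apply: ereal_sup_ubound; exists m.
Qed.

Lemma le_seqnorm_entry r A m : 0 < r -> (forall m, 0 <= A m) -> A m <= seqnorm r A.
Proof.
case: r => [r| |//] /=; rewrite ?lte_fin => r0 A0; last first.
  by apply: ereal_sup_ubound; exists m.
rewrite -[leLHS](poweRK r0)//; apply: le_poweR; [by rewrite invr_ge0 ltW|exact: poweR_ge0|].
by apply: esum_ge; exists [set m]; [by []|rewrite fsbig_set1].
Qed.

Lemma seqnorm_shift r A k : seqnorm r (fun m => A (m - k)%R) = seqnorm r A.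
Proof.
case: r => [r| |//] /=; first by rewrite (esum_shift (fun m => A m `^ r)).
congr ereal_sup; apply/seteqP; split => _ [m _ <-]; first by exists (m - k)%R.
by exists (m + k)%R => //; rewrite addrK.
Qed.

Lemma seqnormZ_le r A (c : R) : 0 < r -> (0 <= c)%R -> (forall m, 0 <= A m) ->
  seqnorm r (fun m => c%:E * A m) <= c%:E * seqnorm r A.
Proof.
case: r => [r| |//] /=; rewrite ?lte_fin => r0 c0 A0; last first.
  apply: ge_ereal_sup => _ [m _ <-]; apply: lee_wpmul2l; first by rewrite lee_fin.
  by apply: ereal_sup_ubound; exists m.
have S0 : 0 <= \esum_(m in [set: int]) A m `^ r.
  by apply: esum_ge0 => m _; exact: poweR_ge0.
apply: (@le_trans _ _ (((c `^ r)%:E * \esum_(m in [set: int]) A m `^ r) `^ r^-1)).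
  apply: le_poweR; first by rewrite invr_ge0 ltW.
    by apply: esum_ge0 => m _; exact: poweR_ge0.
  apply: le_trans (esumZ_le _ _); rewrite ?powR_ge0//; last by move=> m; exact: poweR_ge0.
  by apply: le_esum => m _; rewrite poweRM.
by rewrite poweRM ?lee_fin ?powR_ge0// -poweR_EFin poweRK ?lee_fin.
Qed.

Lemma le_nneseries_term (a : nat -> \bar R) i : (forall i, 0 <= a i) -> a i <= \sum_(j <oo) a j.
Proof.
move=> a0; rewrite nneseries_esumT//; apply: esum_ge; exists [set i]; first by [].
by rewrite fsbig_set1.
Qed.

Lemma geometric_eseriesZ (w : R) (y : \bar R) : (0 <= w < 1)%R -> 0 <= y ->
  \sum_(i <oo) ((w ^+ i)%:E * y) = ((1 - w)^-1)%:E * y.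
Proof.
move=> w01 y0; have /andP[w0 w1] := w01.
have wi0 i : 0 <= (w ^+ i)%:E by rewrite lee_fin exprn_ge0.
case: y y0 => [y y0|_|//].
  transitivity (\sum_(i <oo) (y%:E * (w ^+ i)%:E)).
    by apply: eq_eseriesr => i _; rewrite muleC.
  by rewrite nneseriesZl// geometric_eseries// muleC.
rewrite [RHS]gt0_muley ?lte_fin ?invr_gt0 ?subr_gt0//; apply/eqP; rewrite eq_le leey/=.
apply: le_trans (@le_nneseries_term (fun i => (w ^+ i)%:E * +oo) 0%N _); first by rewrite expr0 mul1e.
by move=> i; apply: mule_ge0.
Qed.

(* Splitting the weight as [u^i u^i] bounds [\sum_i u^(2i) x_i] by a multiple of
   the l^r norm of [u^i x_i]; this covers all [0 < r] at once. *)
Lemma seqnorm_geometric r (u : R) : 0 < r -> (0 < u < 1)%R ->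
  exists2 C : R, (0 < C)%R & forall (X : nat -> int -> \bar R) B (G : \bar R),
    (forall i m, 0 <= X i m) -> (forall m, 0 <= B m) ->
    (forall m, B m <= \sum_(i <oo) ((u ^+ 2) ^+ i)%:E * X i m) ->
    (forall i, seqnorm r (X i) <= G) ->
    seqnorm r B <= C%:E * G.
Proof.
move=> r0 /andP[u0 u1].
have ui i : (0 <= u ^+ i)%R by rewrite exprn_ge0// ltW.
have u2 : (0 <= u ^+ 2 < 1)%R by rewrite exprn_ge0 ?ltW//= expr_lt1 ?ltW.
case: r r0 => [r| |//] /=; rewrite ?lte_fin => r0; last first.
  exists (1 - u ^+ 2)^-1%R; first by rewrite invr_gt0 subr_gt0; case/andP: u2.
  move=> X B G X0 B0 BX XG; apply: ge_ereal_sup => _ [m _ <-].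
  apply: le_trans (BX m) _.
  have G0 : 0 <= G.
    apply: le_trans (XG 0%N); apply: le_trans (X0 0%N 0%R) _.
    by apply: ereal_sup_ubound; exists 0%R.
  rewrite -geometric_eseriesZ//; apply: lee_nneseries => [i _ _|i _].
    by apply: mule_ge0 => //; rewrite lee_fin -exprM.
  apply: lee_wpmul2l; first by rewrite lee_fin -exprM.
  by apply: le_trans (XG i); apply: ereal_sup_ubound; exists m.
pose v := (u `^ r)%R.
have v0 : (0 < v)%R by rewrite powR_gt0.
have v1 : (v < 1)%R.
  by have := @gt0_ltr_powR _ r r0 u 1%R; rewrite !nnegrE powR1; apply => //; exact: ltW.
have vi i : (u ^+ i)%:E `^ r = (v ^+ i)%:E.
  rewrite poweR_EFin /v; congr EFin.
  rewrite -powR_mulrn; last exact: ltW.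
  by rewrite -powRrM mulrC powRrM powR_mulrn// powR_ge0.
pose K := ((1 - u)^-1)%R.
have K0 : (0 < K)%R by rewrite invr_gt0 subr_gt0.
have K0' := ltW K0.
(* One factor [u ^+ i] sums to [K] once each entry is bounded by the l^r norm over [i]; the other,
   raised to the power [r], sums to [(1 - v)^-1] after the two sums are exchanged. *)
exists (K * ((1 - v)^-1) `^ r^-1)%R; first by rewrite mulr_gt0// powR_gt0// invr_gt0 subr_gt0.
move=> X B G X0 B0 BX XG.
have G0 : 0 <= G by apply: le_trans (XG 0%N); exact: poweR_ge0.
have rV0 : (0 <= r^-1)%R by rewrite invr_ge0 ltW.
pose S m := \sum_(i <oo) ((u ^+ i)%:E * X i m) `^ r.
have S0 m : 0 <= S m by apply: nneseries_ge0 => i _ _; exact: poweR_ge0.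
have BS m : B m <= K%:E * S m `^ r^-1.
  apply: le_trans (BX m) _.
  have Xi i : (u ^+ i)%:E * X i m <= S m `^ r^-1.
    rewrite -[leLHS](poweRK r0); last by apply: mule_ge0; rewrite ?lee_fin.
    apply: le_poweR => //; first exact: poweR_ge0.
    by apply: (@le_nneseries_term (fun i => ((u ^+ i)%:E * X i m) `^ r)) => j; exact: poweR_ge0.
  have u01 : (0 <= u < 1)%R by rewrite ltW.
  rewrite /K -geometric_eseriesZ ?poweR_ge0//; apply: lee_nneseries => [i _ _|i _].
    by apply: mule_ge0 => //; rewrite lee_fin -exprM.
  rewrite -exprM mulnC exprM expr2 EFinM -muleA.
  apply: lee_wpmul2l; first by rewrite lee_fin.
  exact: Xi.
have sumS : \esum_(m in [set: int]) S m <= ((1 - v)^-1)%:E * G `^ r.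
  rewrite /S; under eq_esum.
    move=> m _; rewrite nneseries_esumT; last by move=> i; exact: poweR_ge0.
    over.
  rewrite esum_exchange; last by move=> *; exact: poweR_ge0.
  rewrite -nneseries_esumT; last by move=> i; apply: esum_ge0 => m _; exact: poweR_ge0.
  have v01 : (0 <= v < 1)%R by rewrite ltW.
  rewrite -geometric_eseriesZ ?poweR_ge0//; apply: lee_nneseries => [i _ _|i _].
    by apply: esum_ge0 => m _; exact: poweR_ge0.
  apply: (@le_trans _ _ ((v ^+ i)%:E * \esum_(m in [set: int]) X i m `^ r)).
    apply: (@le_trans _ _ (\esum_(m in [set: int]) ((v ^+ i)%:E * X i m `^ r))).
      by apply: le_esum => m _; rewrite poweRM ?lee_fin// vi.
    by apply: esumZ_le => [|m]; [rewrite exprn_ge0// ltW|exact: poweR_ge0].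
  apply: lee_wpmul2l; first by rewrite lee_fin exprn_ge0// ltW.
  rewrite -[leLHS](poweRVK r0); last by apply: esum_ge0 => m _; exact: poweR_ge0.
  by apply: le_poweR; [exact: ltW|exact: poweR_ge0|exact: XG].
apply: (@le_trans _ _ ((((K `^ r)%:E * (((1 - v)^-1)%:E * G `^ r))) `^ r^-1)).
  apply: le_poweR => //; first by apply: esum_ge0 => m _; exact: poweR_ge0.
  apply: (@le_trans _ _ ((K `^ r)%:E * \esum_(m in [set: int]) S m)); last first.
    by apply: lee_wpmul2l => //; rewrite lee_fin powR_ge0.
  apply: (@le_trans _ _ (\esum_(m in [set: int]) ((K `^ r)%:E * S m))).
    apply: le_esum => m _.
    rewrite -poweR_EFin -[S m](poweRVK r0)// -poweRM ?poweR_ge0 ?lee_fin ?K0'//.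
    exact: le_poweR (ltW r0) (B0 m) (BS m).
  by apply: esumZ_le; rewrite ?powR_ge0.
have V0 : (0 <= (1 - v)^-1)%R by rewrite invr_ge0 subr_ge0 ltW.
rewrite poweRM ?lee_fin ?powR_ge0 ?mule_ge0 ?lee_fin ?poweR_ge0//.
rewrite poweRM ?lee_fin ?powR_ge0 ?poweR_ge0// poweRK// -poweR_EFin poweRK ?lee_fin//.
by rewrite poweR_EFin EFinM muleA.
Qed.

End double_sequences.

(** * Dyadic discretization of the Lorentz quasi-norm *)

Section discretization.
Context {R : realType}.
Local Open Scope ereal_scope.

(* Unlike [ge0_le_integral], no measurability is assumed. *)
Lemma ge0_le_integral_any d (T : measurableType d) (nu : {measure set T -> \bar R})
    (D : set T) (f g : T -> \bar R) :
  (forall x, D x -> 0 <= f x) -> (forall x, D x -> f x <= g x) ->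
  \int[nu]_(x in D) f x <= \int[nu]_(x in D) g x.
Proof.
move=> f0 fg; rewrite !ge0_integralE//; last by move=> x Dx; rewrite (le_trans (f0 x Dx)) ?fg.
apply: ge_ereal_sup => _ [h hf <-]; apply: ereal_sup_ubound; exists h => // x; apply: le_trans (hf x) _.
by rewrite !patchE; case: ifPn => //; rewrite inE => /fg.
Qed.

Lemma nneseries_enum_sets d (T : measurableType d) (I : countType) (D : I -> set T)
    (F : set T -> \bar R) : F set0 = 0 -> (forall X, 0 <= F X) ->
  \sum_(j <oo) F (enum_sets D j) = \esum_(i in [set: I]) F (D i).
Proof.
move=> F0 Fge0; rewrite -(nneseries_pickle (f := fun i => F (D i)))//.
by apply: eq_eseriesr => j _; rewrite /enum_sets; case: pickle_inv.
Qed.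

Definition dyadic_itv (m : int) : set R := `[((2 : R) ^ m)%R, ((2 : R) ^ (m + 1))%R[%classic.

Lemma dyadic_itvP m t : dyadic_itv m t <-> ((2 : R) ^ m <= t < 2 ^ (m + 1))%R.
Proof. by rewrite /dyadic_itv/= in_itv. Qed.

Lemma trivIset_dyadic_itv : trivIset setT dyadic_itv.
Proof.
apply/trivIsetP => m m' _ _ mm'; apply/seteqP; split => // t [].
move=> /dyadic_itvP/andP[a b] /dyadic_itvP/andP[c d].
have := le_lt_trans a d; have := le_lt_trans c b; rewrite !lt_pow2.
by move=> ? ?; move/eqP: mm'; apply; lia.
Qed.

Lemma bigcup_dyadic_itv : \bigcup_m dyadic_itv m = `]0%R, +oo[%classic.
Proof.
apply/seteqP; split => t /=.
  move=> [m _ /dyadic_itvP/andP[a b]]; rewrite in_itv/= andbT.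
  by apply: lt_le_trans a; exact: pow2_gt0.
rewrite in_itv/= andbT => /pow2_between[m mt]; exists m => //; exact/dyadic_itvP.
Qed.

Lemma measure_dyadic_itv m : lebesgue_measure (dyadic_itv m) = ((2 : R) ^ m)%:E.
Proof.
rewrite /dyadic_itv lebesgue_measure_itv/= lte_fin lt_pow2 ifT; last by lia.
by rewrite -EFinD pow2S; congr EFin; lra.
Qed.

(** Zero by default when [t] is not positive, a case outside every dyadic interval. *)
Definition dyadic_exponent (t : R) : int := xget 0%R [set m | dyadic_itv m t].

Lemma dyadic_exponentE m t : dyadic_itv m t -> dyadic_exponent t = m.
Proof.
move=> mt; rewrite /dyadic_exponent; case: xgetP => [m' _ m't|/(_ m)//].
apply: contrapT => /eqP mm'; have /trivIsetP/(_ m m' I I) := trivIset_dyadic_itv.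
rewrite eq_sym => /(_ mm') => /seteqP[+ _].
by move=> /(_ t); apply.
Qed.

Lemma integral_step (c : int -> \bar R) : (forall m, 0 <= c m) ->
  \int[@lebesgue_measure R]_(t in `]0%R, +oo[) c (dyadic_exponent t) =
  \esum_(m in [set: int]) (c m * ((2 : R) ^ m)%:E).
Proof.
move=> c0; rewrite -bigcup_dyadic_itv.
have mI m : measurable (dyadic_itv m) by exact: measurable_itv.
have cI m : {in dyadic_itv m, (fun t => c (dyadic_exponent t)) =1 cst (c m)}.
  by move=> t; rewrite inE => /dyadic_exponentE ->.
have mc m : measurable_fun (dyadic_itv m) (fun t => c (dyadic_exponent t)).
  apply: (eq_measurable_fun (cst (c m))) => // t tm; exact/esym/cI.
rewrite ge0_integral_bigcup_countable//; last 2 first.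
- exact: trivIset_dyadic_itv.
- rewrite -bigcup_enum_sets; apply/measurable_fun_bigcup; first exact: measurable_enum_sets.
  move=> j; rewrite /enum_sets; case: pickle_inv => [m|]; first exact: mc.
  exact: measurable_fun_set0.
rewrite (nneseries_enum_sets _ (F := fun X => \int[lebesgue_measure]_(x in X) c (dyadic_exponent x))).
- apply: eq_esum => m _; rewrite -measure_dyadic_itv -integral_cst//; last exact: mI.
  by apply: eq_integral => t tm; exact: cI.
- by rewrite /= integral_set0.
- by move=> X; exact: integral_ge0.
Qed.

Context {n : nat}.
Local Notation E := 'rV[R]_n.+1.
Implicit Types (g : E -> \bar R) (q : R) (r : \bar R).

(** Samples of t^(1/q) g*(t) at t = 2^m; the l^r quasi-norm of this sequence is equivalent to the
    Lorentz quasi-norm. *)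
Definition lorentz_seq q g (m : int) : \bar R :=
  (((2 : R) ^ m) `^ q^-1)%:E * rearrangement g ((2 : R) ^ m)%R.

Lemma lorentz_seq_ge0 q g m : 0 <= lorentz_seq q g m.
Proof. by rewrite mule_ge0 ?lee_fin ?powR_ge0// rearrangement_ge0. Qed.

Lemma lorentz_upper_entry q g t m : (0 < q)%R -> dyadic_itv m t ->
  (t `^ q^-1)%:E * rearrangement g t <= (2 `^ q^-1)%:E * lorentz_seq q g m.
Proof.
move=> q0 /dyadic_itvP/andP[a b]; have p0 := @pow2_gt0 R m.
have qV : (0 <= q^-1)%R by rewrite invr_ge0 ltW.
rewrite /lorentz_seq muleA -EFinM -powRM ?(ltW p0)//; apply: lee_pmul.
- by rewrite lee_fin powR_ge0.
- exact: rearrangement_ge0.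
- by rewrite lee_fin ge0_ler_powR ?nnegrE ?mulr_ge0 ?(ltW p0)// -?pow2S ?(ltW b)// (le_trans (ltW p0)).
- exact: rearrangement_nonincreasing.
Qed.

(** A lower bound on the interval samples its right endpoint, where the rearrangement is smaller;
    hence the shift by one, to which [seqnorm] is insensitive. *)
Lemma lorentz_lower_entry q g t m : (0 < q)%R -> dyadic_itv m t ->
  lorentz_seq q g (m + 1)%R <= (2 `^ q^-1)%:E * ((t `^ q^-1)%:E * rearrangement g t).
Proof.
move=> q0 /dyadic_itvP/andP[a b]; have p0 := @pow2_gt0 R m.
have qV : (0 <= q^-1)%R by rewrite invr_ge0 ltW.
have t0 : (0 <= t)%R by rewrite (le_trans (ltW p0)).
rewrite /lorentz_seq muleA -EFinM -powRM//; apply: lee_pmul.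
- by rewrite lee_fin powR_ge0.
- exact: rearrangement_ge0.
- by rewrite lee_fin ge0_ler_powR ?nnegrE ?mulr_ge0// pow2S ?mulr_ge0 ?(ltW p0) ?ler_pM2l.
- by apply: rearrangement_nonincreasing; exact: ltW.
Qed.

Lemma lorentz_norm_le_seq q r : (0 < q)%R -> 0 < r ->
  exists2 C : R, (0 < C)%R & forall g,
    lorentz_norm q r g <= C%:E * seqnorm r (lorentz_seq q g).
Proof.
move=> q0; case: r => [r| |//]; rewrite ?lte_fin => r0; last first.
  exists (2 `^ q^-1)%R; first by rewrite powR_gt0.
  move=> g; apply: ge_ereal_sup => _ [t + <-].
  rewrite -bigcup_dyadic_itv => -[m _ mt].
  apply: le_trans (lorentz_upper_entry _ q0 mt) _.
  by apply: lee_wpmul2l; [rewrite lee_fin powR_ge0|apply: ereal_sup_ubound; exists m].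
pose c := (2 `^ q^-1)%R; have c0 : (0 < c)%R by rewrite powR_gt0.
exists c => // g /=.
have A0 m : 0 <= c%:E * lorentz_seq q g m by rewrite mule_ge0 ?lorentz_seq_ge0// lee_fin ltW.
apply: (@le_trans _ _ (seqnorm r%:E (fun m => c%:E * lorentz_seq q g m))); last first.
  by apply: seqnormZ_le => //; [rewrite ltW|exact: lorentz_seq_ge0].
apply: le_poweR; first by rewrite invr_ge0 ltW.
  apply: integral_ge0 => t; rewrite /= in_itv/= andbT => t0; apply: mule_ge0; first exact: poweR_ge0.
  by rewrite lee_fin invr_ge0 ltW.
(* A majorant constant on each dyadic interval: [t^-1] is at most [(2 ^ m)^-1] there, and the length
   [2 ^ m] of the interval cancels this factor. *)
pose C m := (c%:E * lorentz_seq q g m) `^ r * (((2 : R) ^ m)^-1)%:E.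
apply: (@le_trans _ _ (\int[@lebesgue_measure R]_(t in `]0%R, +oo[) C (dyadic_exponent t))).
  apply: ge0_le_integral_any => t.
    rewrite /= in_itv/= andbT => t0; apply: mule_ge0; first exact: poweR_ge0.
    by rewrite lee_fin invr_ge0 ltW.
  rewrite -bigcup_dyadic_itv => -[m _ mt]; rewrite (dyadic_exponentE mt) /C.
  have /dyadic_itvP/andP[a b] := mt; have p0 := @pow2_gt0 R m.
  have t0 : (0 < t)%R by exact: lt_le_trans a.
  apply: lee_pmul; [exact: poweR_ge0|by rewrite lee_fin invr_ge0 ltW| |].
    apply: le_poweR; [exact: ltW| |exact: lorentz_upper_entry].
    by rewrite mule_ge0 ?rearrangement_ge0// lee_fin powR_ge0.
  by rewrite lee_fin lef_pV2 ?posrE.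
rewrite integral_step; last first.
  by move=> m; rewrite mule_ge0 ?poweR_ge0// lee_fin invr_ge0 ltW// pow2_gt0.
apply: le_esum => m _; rewrite /C -muleA -EFinM mulVf ?pow2_neq0// mule1.
exact: lexx.
Qed.

Lemma seq_le_lorentz_norm q r : (0 < q)%R -> 0 < r ->
  exists2 C : R, (0 < C)%R & forall g,
    seqnorm r (lorentz_seq q g) <= C%:E * lorentz_norm q r g.
Proof.
move=> q0; case: r => [r| |//]; rewrite ?lte_fin => r0; last first.
  exists 1%R => // g; rewrite mul1e; apply: ge_ereal_sup => _ [m _ <-].
  by apply: ereal_sup_ubound; exists ((2 : R) ^ m)%R => //; rewrite /= in_itv/= andbT pow2_gt0.
pose c := (2 `^ q^-1)%R; have c0 : (0 < c)%R by rewrite powR_gt0.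
have c0' := ltW c0.
(* The factor 2^(1/r) is the price of bounding [t^-1] from below by [(2 ^ (m + 1))^-1] on an
   interval of length [2 ^ m]. *)
have d0 : (0 < c * 2 `^ r^-1)%R by rewrite mulr_gt0// powR_gt0.
exists (c * 2 `^ r^-1)%R => // g.
rewrite -(seqnorm_shift _ _ (-1)) /=.
set J := \int[_]_(_ in _) _.
have J0 : 0 <= J.
  apply: integral_ge0 => t; rewrite /= in_itv/= andbT => t0; apply: mule_ge0; first exact: poweR_ge0.
  by rewrite lee_fin invr_ge0 ltW.
pose C m := (c^-1%:E * lorentz_seq q g (m + 1)%R) `^ r * (((2 : R) ^ (m + 1))^-1)%:E.
have cV0 : (0 <= c^-1)%R by rewrite invr_ge0.
have C0 m : 0 <= C m.
  by rewrite mule_ge0 ?poweR_ge0// lee_fin invr_ge0 ltW// pow2_gt0.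
have CJ : \int[@lebesgue_measure R]_(t in `]0%R, +oo[) C (dyadic_exponent t) <= J.
  apply: ge0_le_integral_any => // t.
  rewrite -bigcup_dyadic_itv => -[m _ mt]; rewrite (dyadic_exponentE mt) /C.
  have /dyadic_itvP/andP[a b] := mt; have p0 := @pow2_gt0 R m.
  have t0 : (0 < t)%R by exact: lt_le_trans a.
  apply: lee_pmul; [exact: poweR_ge0|by rewrite lee_fin invr_ge0 ltW// pow2_gt0| |].
    apply: le_poweR; [exact: ltW|by rewrite mule_ge0 ?lorentz_seq_ge0|].
    by rewrite lee_pdivrMl//; exact: lorentz_lower_entry.
  by rewrite lee_fin lef_pV2 ?posrE ?pow2_gt0// ltW.
rewrite integral_step// in CJ.
have c2r : (0 <= 2 * c `^ r)%R by rewrite mulr_ge0// powR_ge0.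
have S_le : \esum_(m in [set: int]) lorentz_seq q g (m - -1)%R `^ r <= (2 * c `^ r)%:E * J.
  apply: (@le_trans _ _ (\esum_(m in [set: int]) ((2 * c `^ r)%:E * (C m * ((2 : R) ^ m)%:E)))).
    apply: le_esum => m _; rewrite /C opprK poweRM ?lee_fin ?lorentz_seq_ge0//.
    rewrite poweR_EFin; move: (poweR_ge0 (lorentz_seq q g (m + 1)) r); set y := _ `^ r => y0.
    rewrite [_%:E * y]muleC -!muleA -!EFinM muleCA -EFinM -[leLHS]mule1.
    apply: lee_wpmul2l => //.
    rewrite lee_fin pow2S.
    have p0 := @pow2_gt0 R m.
    have cr : (c `^ r * (c^-1) `^ r = 1)%R by rewrite -powRM// mulfV ?powR1// gt_eqF.
    rewrite le_eqVlt; apply/orP; left; apply/eqP; rewrite invfM.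
    apply: (etrans (esym cr)); field; exact: pow2_neq0.
  apply: le_trans (esumZ_le c2r _) _; last by apply: lee_wpmul2l; rewrite ?lee_fin.
  by move=> m; rewrite mule_ge0// lee_fin ltW// pow2_gt0.
apply: (@le_trans _ _ (((2 * c `^ r)%:E * J) `^ r^-1)).
  apply: le_poweR => //; first by rewrite invr_ge0 ltW.
  by apply: esum_ge0 => m _; exact: poweR_ge0.
rewrite poweRM ?lee_fin// EFinM poweRM ?lee_fin ?powR_ge0// -poweR_EFin poweRK ?lee_fin//.
by rewrite poweR_EFin EFinM [X in X * _]muleC.
Qed.

End discretization.

(** * Integrals over cubes controlled by the Morrey-Lorentz quasi-norm *)

Section morrey_local.
Context {R : realType} {n : nat}.
Local Notation E := 'rV[R]_n.+1.
Local Notation T := (Rn R n).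
Local Notation mu := (@leb R n).
Local Notation omega := (@unit_volume R n).
Local Notation vol := (@vol R n).
Implicit Types (g h : E -> \bar R) (p q : R) (r : \bar R).
Local Open Scope ereal_scope.

Lemma pow2_powR (m : int) (s : R) : (((2 : R) ^ m) `^ s = 2 `^ (m%:~R * s))%R.
Proof. by rewrite -powR_intmul// -powRrM. Qed.

Lemma pow2_powRD (s t : R) : ((2 : R) `^ (s + t) = 2 `^ s * 2 `^ t)%R.
Proof. by rewrite powRD// pnatr_eq0 implybT. Qed.

Lemma lt_pow2_powR (s t : R) : (s < t)%R -> ((2 : R) `^ s < 2 `^ t)%R.
Proof.
move=> st; rewrite -(subrK s t) pow2_powRD -[X in (X < _)%R]mul1r ltr_pM2r ?powR_gt0//.
have /(gt0_ltr_powR) H : (0 < t - s)%R by rewrite subr_gt0.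
by have := H 1%R 2%R; rewrite !nnegrE powR1; apply => //; rewrite ?ltr1n.
Qed.

Lemma restrict_neq0 g (Q : set E) : [set x | g x * (\1_Q x)%:E != 0] `<=` Q.
Proof.
move=> x /=; apply: contraNP => nQ; by rewrite indicE memNset// mule0 eqxx.
Qed.

Lemma measurable_mul_indic g (Q : set E) : measurable_fun [set: T] (g : T -> \bar R) ->
  measurable (Q : set T) ->
  measurable_fun [set: T] ((fun x => g x * (\1_Q x)%:E) : T -> \bar R).
Proof.
move=> mg mQ; apply: (emeasurable_funM mg); apply/measurable_EFinP.
exact: measurable_indic.
Qed.

Lemma integral_restrict g (Q : set E) : measurable (Q : set T) ->
  \int[mu]_(x in (Q : set T)) g x = \int[mu]_x (g x * (\1_Q x)%:E).
Proof.
move=> mQ; rewrite integral_mkcond; apply: eq_integral => x _.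
by rewrite patchE indicE; case: (x \in Q); rewrite ?mule1 ?mule0.
Qed.

Lemma morrey_lorentz_ge0 p q r g : 0 <= morrey_lorentz_norm p q r g.
Proof.
apply: le_trans (ereal_sup_ubound _); last first.
  by exists (closed_cell 0 0) => //; exact: cube_closed_cell.
apply: mule_ge0; first exact: poweR_ge0.
case: r => [r| |] //=; first exact: poweR_ge0.
apply: le_trans (ereal_sup_ubound _); last by exists 1%R => //=; rewrite in_itv/= ltr01.
by rewrite mule_ge0 ?rearrangement_ge0// lee_fin powR_ge0.
Qed.

Lemma lorentz_norm_restrict p q r g (Q : set E) (V : R) : cube Q ->
  mu Q = V%:E -> (0 < V)%R ->
  lorentz_norm q r (fun x => g x * (\1_Q x)%:E) <=
  (V `^ (q^-1 - p^-1))%:E * morrey_lorentz_norm p q r g.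
Proof.
move=> cQ QV V0; rewrite -lee_pdivrMl ?powR_gt0// -powRN opprB.
by apply: ereal_sup_ubound; exists Q => //; rewrite QV poweR_EFin.
Qed.

(** A discrete Holder inequality. The integral over a cube of measure [V] is at most a sum over 2^j
    <= V of terms comparable to 2^(j(1 - 1/q)) times an entry of the Lorentz sequence, a geometric
    sum since q > 1. Its size V^(1 - 1/q) combines with the Morrey factor V^(1/q - 1/p). *)
Lemma integral_cube_morrey p q r : (1 < q)%R -> 0 < r ->
  exists2 C : R, (0 < C)%R & forall g (Q : set E) (V : R),
    measurable_fun [set: T] (g : T -> \bar R) -> (forall x, 0 <= g x) ->
    cube Q -> mu Q = V%:E -> (0 < V)%R ->
    \int[mu]_(x in (Q : set T)) g x <=
    (C * V `^ (1 - p^-1))%:E * morrey_lorentz_norm p q r g.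
Proof.
move=> q1 r0; have q0 : (0 < q)%R by exact: lt_trans q1.
have qV : (0 < 1 - q^-1)%R by rewrite subr_gt0 invf_lt1.
have [D D0 HD] := seq_le_lorentz_norm (n := n) q0 r0.
pose w := ((2 : R) `^ (q^-1 - 1))%R.
have w0 : (0 < w)%R by rewrite powR_gt0.
have w1 : (w < 1)%R by rewrite /w -[X in (_ < X)%R](powRr0 2) lt_pow2_powR// subr_lt0 invf_lt1.
have V0' : (0 < (1 - w)^-1)%R by rewrite invr_gt0 subr_gt0.
exists (2 * (1 - w)^-1 * D)%R; first by rewrite !mulr_gt0.
move=> g Q V mg g0 cQ QV V0.
have mQ : measurable (Q : set T).
  by have [c [l [_ ->]]] := cubeE cQ; exact: measurable_box.
rewrite integral_restrict//.
set h := fun x => g x * (\1_Q x)%:E.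
have h0 x : 0 <= h x by rewrite mule_ge0// lee_fin.
have mh : measurable_fun [set: T] (h : T -> \bar R) by exact: measurable_mul_indic.
have [k /andP[kV Vk]] := pow2_between V0.
have hV : mu [set x | h x != 0] <= ((2 : R) ^ (k + 1))%:E.
  apply: (@le_trans _ _ (mu Q)); first by apply: le_leb; exact: restrict_neq0.
  by rewrite QV lee_fin ltW.
apply: le_trans (integral_le_rearrangement mh h0 hV) _.
pose S := seqnorm r (lorentz_seq q h).
have S0 : 0 <= S by apply: seqnorm_ge0 => m; exact: lorentz_seq_ge0.
have term i : ((2 : R) ^ (k + 1 - i%:Z))%:E *
    rearrangement h ((2 : R) ^ (k + 1 - i%:Z - 1))%R <=
    (w ^+ i)%:E * ((2 * 2 `^ (k%:~R * (1 - q^-1)))%:E * S).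
  set j := (k + 1 - i%:Z - 1)%R.
  have -> : (k + 1 - i%:Z = j + 1)%R by rewrite /j subrK.
  have -> : ((2 : R) ^ (j + 1))%:E = (w ^+ i * (2 * 2 `^ (k%:~R * (1 - q^-1))))%:E
      * (((2 : R) ^ j) `^ q^-1)%:E.
    rewrite -EFinM; congr EFin; rewrite pow2S pow2_powR -powR_intmul// -powR_mulrn ?powR_ge0//.
    rewrite -powRrM -!mulrA [RHS]mulrCA; congr *%R; rewrite -!pow2_powRD; congr powR.
    rewrite /j; move: (q^-1)%R => a.
    have -> : ((k + 1 - i%:Z - 1)%:~R = k%:~R - i%:R :> R)%R.
      by rewrite addrAC addrK rmorphB.
    ring.
  rewrite -muleA -/(lorentz_seq q h j) EFinM -muleA.
  have wi0 : 0 <= (w ^+ i)%:E by rewrite lee_fin exprn_ge0// ltW.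
  apply: lee_wpmul2l => //; apply: lee_wpmul2l; first by rewrite lee_fin mulr_ge0// powR_ge0.
  by apply: le_seqnorm_entry => // m; exact: lorentz_seq_ge0.
apply: (@le_trans _ _ (\sum_(i <oo) ((w ^+ i)%:E * ((2 * 2 `^ (k%:~R * (1 - q^-1)))%:E * S)))).
  apply: lee_nneseries => [i _ _|i _]; last exact: term.
  by rewrite mule_ge0 ?rearrangement_ge0// lee_fin ltW// pow2_gt0.
rewrite geometric_eseriesZ; last 2 first.
  by rewrite ltW.
  by rewrite mule_ge0// lee_fin mulr_ge0// powR_ge0.
have S_le : S <= D%:E * ((V `^ (q^-1 - p^-1))%:E * morrey_lorentz_norm p q r g).
  apply: le_trans (HD h) _; apply: lee_wpmul2l; first by rewrite lee_fin ltW.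
  exact: lorentz_norm_restrict.
apply: (@le_trans _ _ (((1 - w)^-1)%:E * ((2 * V `^ (1 - q^-1))%:E *
    (D%:E * ((V `^ (q^-1 - p^-1))%:E * morrey_lorentz_norm p q r g))))).
  apply: lee_wpmul2l; first by rewrite lee_fin ltW.
  apply: lee_pmul => //.
  rewrite lee_fin ler_pM2l// -pow2_powR ge0_ler_powR ?nnegrE ?(ltW V0)// ?(ltW qV)//.
  by rewrite ltW// pow2_gt0.
rewrite !muleA -!EFinM; apply: lee_wpmul2r; first exact: morrey_lorentz_ge0.
have -> : (V `^ (1 - p^-1) = V `^ (1 - q^-1) * V `^ (q^-1 - p^-1))%R.
  by rewrite -powRD; [rewrite addrA subrK|rewrite (gt_eqF V0) implybT].
by rewrite lee_fin le_eqVlt; apply/orP; left; apply/eqP; ring.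
Qed.

End morrey_local.

(** * Sums and truncated geometric sequences *)

Section seqnorm_sums.
Context {R : realType}.
Local Open Scope ereal_scope.
Implicit Types (A B : int -> \bar R) (r : \bar R).

(** The quasi-triangle inequality for all [r] at once, as a two-term instance of [seqnorm_geometric]
    with u = 1/2; the factor 4 on [B] compensates the weight [u ^+ 2]. *)
Lemma seqnorm_add r : 0 < r -> exists2 C : R, (0 < C)%R & forall A B (G : \bar R),
  (forall m, 0 <= A m) -> (forall m, 0 <= B m) ->
  seqnorm r A <= G -> seqnorm r B <= G ->
  seqnorm r (fun m => A m + B m) <= C%:E * G.
Proof.
move=> r0; have u01 : (0 < (2^-1 : R) < 1)%R by lra.
have [C C0 HC] := seqnorm_geometric r0 u01.
exists (C * 4)%R; first by rewrite mulr_gt0.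
move=> A B G A0 B0 AG BG.
pose X i m := if i is 0%N then A m else if i is 1%N then 4%:E * B m else 0.
have X0 i m : 0 <= X i m by case: i => [//|[|//]]; rewrite /X mule_ge0.
have G0 : 0 <= G by apply: le_trans AG; exact: seqnorm_ge0.
rewrite EFinM -muleA; apply: (HC X) => //.
- by move=> m; rewrite adde_ge0.
- move=> m; rewrite (nneseries_split 0 2) => [|k _]; last first.
    by rewrite mule_ge0// lee_fin -exprM exprn_ge0.
  rewrite add0n big_nat_recl// big_nat1 expr0 mul1e -addeA leeD2l//.
  rewrite expr1 muleA -EFinM (_ : (2^-1 ^+ 2 * 4 = 1)%R); last by field.
  rewrite mul1e leeDl//; apply: nneseries_ge0 => k _ _.
  by rewrite mule_ge0// lee_fin -exprM exprn_ge0.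
- have G4 : G <= 4%:E * G by rewrite -[leLHS]mul1e; apply: lee_wpmul2r; rewrite ?lee_fin ?ler1n.
  case=> [|[|i]].
  + exact: le_trans G4.
  + rewrite /X; apply: le_trans (seqnormZ_le r0 _ B0) _ => //.
    by apply: lee_wpmul2l.
  + rewrite /X; apply: le_trans (_ : seqnorm r A <= _); last exact: le_trans G4.
    by apply: le_seqnorm => // m; rewrite lexx A0.
Qed.

Lemma seqnorm_single r k (y : \bar R) : 0 < r -> 0 <= y ->
  seqnorm r (fun m => if m == k then y else 0) <= y.
Proof.
case: r => [r| |//] /=; rewrite ?lte_fin => r0 y0; last first.
  by apply: ge_ereal_sup => _ [m _ <-]; case: ifP.
rewrite -[leRHS](poweRK r0)//; apply: le_poweR; first by rewrite invr_ge0 ltW.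
  by apply: esum_ge0 => m _; exact: poweR_ge0.
rewrite -[leRHS](esum_single k (poweR_ge0 y r)); apply: le_esum => m _.
by case: ifP => // _; rewrite poweR0r// gt_eqF.
Qed.

(* Models the decreasing rearrangement of a constant on a set of measure about [2^k]. *)
Lemma seqnorm_truncated r (s : R) : 0 < r -> (0 < s)%R ->
  exists2 C : R, (0 < C)%R & forall (k : int) (y : \bar R), 0 <= y ->
  seqnorm r (fun m => if (m <= k)%R then (2 `^ (m%:~R * s))%:E * y else 0) <=
  C%:E * ((2 `^ (k%:~R * s))%:E * y).
Proof.
(* [u ^+ 2] is 2^(-s), the ratio of consecutive entries going down from [k]; row [i] of [X] carries
   a single entry, at index k - i. *)
move=> r0 s0; pose u := ((2 : R) `^ (- s / 2))%R.
have u01 : (0 < u < 1)%R.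
  rewrite powR_gt0//= /u -[X in (_ < X)%R](powRr0 2) lt_pow2_powR//; lra.
have u2 : (u ^+ 2 = 2 `^ (- s))%R.
  by rewrite expr2 /u -pow2_powRD; congr powR; field.
have [C C0 HC] := seqnorm_geometric r0 u01; exists C => // k y y0.
have Y0 : 0 <= (2 `^ (k%:~R * s))%:E * y by rewrite mule_ge0// lee_fin powR_ge0.
pose X (i : nat) (m : int) := if m == (k - i%:Z)%R then (2 `^ (k%:~R * s))%:E * y else 0.
have X0 i m : 0 <= X i m by rewrite /X; case: ifP.
apply: (HC X) => //.
- by move=> m; case: ifP => // _; rewrite mule_ge0// lee_fin powR_ge0.
- move=> m; case: ifPn => mk; last first.
    by apply: nneseries_ge0 => i _ _; rewrite mule_ge0// lee_fin -exprM exprn_ge0 ?powR_ge0.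
  pose i := `|(k - m)%R|%N.
  apply: le_trans (@le_nneseries_term _ (fun i => ((u ^+ 2) ^+ i)%:E * X i m) i _); last first.
    by move=> j; rewrite mule_ge0// lee_fin -exprM exprn_ge0 ?powR_ge0.
  rewrite /X ifT; last by rewrite /i; lia.
  rewrite muleA -EFinM u2 -powR_mulrn ?powR_ge0// -powRrM -pow2_powRD.
  have -> : (i%:R = k%:~R - m%:~R :> R)%R.
    by rewrite -rmorphB/= pmulrn; congr intmul; rewrite /i; lia.
  by rewrite (_ : _ + _ = m%:~R * s)%R//; ring.
- by move=> i; exact: seqnorm_single.
Qed.

End seqnorm_sums.

(** * The dyadic maximal operator on Lorentz sequences *)

Section maximal_bounds.
Context {R : realType} {n : nat}.
Local Notation E := 'rV[R]_n.+1.
Local Notation T := (Rn R n).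
Local Notation mu := (@leb R n).
Local Notation omega := (@unit_volume R n).
Local Notation vol := (@vol R n).
Implicit Types (h F : E -> R) (p q : R) (r : \bar R).
Local Open Scope ereal_scope.

Local Notation rho h m := (rearrangement (EFin \o h) ((2 : R) ^ m)%R).

(** Cut [h] at the height [t] of its rearrangement at [2 ^ m]: the part above is integrable whenever
    the right-hand side is finite and obeys the weak-type bound, with its integral estimated layer
    by layer. The part below adds at most [t], itself bounded by the term of index 0, whence the
    factor 2. *)
Lemma rearrangement_dyadic_maximal h (m : int) : (0 < omega)%R ->
  (forall x, (0 <= h x)%R) -> measurable_fun [set: T] (h : T -> R) ->
  rearrangement (dyadic_maximal h) ((2 : R) ^ m)%R <=
  \sum_(i <oo) ((2^-1 : R) ^+ i)%:E * (2%:E * rho h (m - i%:Z - 1)%R).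
Proof.
move=> w0 h0 mh.
have mhE : measurable_fun [set: T] (EFin \o h : T -> \bar R) by exact/measurable_EFinP.
have tp := @pow2_gt0 R m.
have p2 i : (0 <= (2^-1 : R) ^+ i)%R by rewrite exprn_ge0.
have rho_le : rho h m <= \sum_(i <oo) ((2^-1 : R) ^+ i)%:E * rho h (m - i%:Z - 1)%R.
  apply: (@le_trans _ _ (rho h (m - 0 - 1)%R)).
    by apply: rearrangement_nonincreasing; rewrite le_pow2; lia.
  apply: le_trans (@le_nneseries_term _
    (fun i => ((2^-1 : R) ^+ i)%:E * rho h (m - i%:Z - 1)%R) 0%N _).
    by rewrite expr0 mul1e.
  by move=> i; rewrite mule_ge0 ?lee_fin// rearrangement_ge0.
have [toe|[t t0 tE]] := rearrangement_cases (EFin \o h) ((2 : R) ^ m)%R.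
  apply: (@le_trans _ _ +oo); first exact: leey.
  rewrite -toe; apply: le_trans rho_le _; apply: lee_nneseries => [i _ _|i _].
    by rewrite mule_ge0 ?lee_fin// rearrangement_ge0.
  apply: lee_wpmul2l; first by rewrite lee_fin.
  by rewrite -[leLHS]mul1e; apply: lee_wpmul2r; rewrite ?rearrangement_ge0// lee_fin ler1n.
pose h1 x : R := if (t < h x)%R then h x else 0%R.
have h10 x : (0 <= h1 x)%R by rewrite /h1; case: ifP.
have mt : measurable ([set x | (t < h x)%R] : set T).
  have := mh measurableT _ (measurable_itv `]t, +oo[).
  by rewrite setTI; congr measurable; apply/seteqP; split => x /=; rewrite in_itv/= andbT.
have h1E x : h1 x = (h x * \1_[set x | (t < h x)%R] x)%R.
  rewrite /h1 indicE; case: ifPn => [tx|ntx].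
    by rewrite mem_set ?mulr1.
  by rewrite memNset ?mulr0//=; apply/negP.
have mh1 : measurable_fun [set: T] (h1 : T -> R).
  apply: (eq_measurable_fun (fun x : T => (h x * \1_[set x | (t < h x)%R] x)%R)).
    by move=> x _; rewrite h1E.
  by apply: measurable_funM => //; exact: measurable_indic.
have int1 : \int[mu]_x (h1 x)%:E <=
    \sum_(i <oo) ((2 : R) ^ (m - i%:Z))%:E * rho h (m - i%:Z - 1)%R.
  have := integral_above_rearrangement (g := EFin \o h) mhE m.
  rewrite tE /= => /(_ h0); apply: le_trans.
  rewrite (_ : [set x : T | t%:E < (h x)%:E] = [set x | (t < h x)%R]); last first.
    by apply/seteqP; split => x; rewrite /= lte_fin.
  rewrite [leRHS]integral_restrict//.
  apply: ge0_le_integral_any => x _; first by rewrite lee_fin.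
  by rewrite h1E.
have M_le x : dyadic_maximal h x <= dyadic_maximal h1 x + t%:E.
  apply: ge_ereal_sup => _ [g _ <-].
  have v0 := vol_gt0 g w0.
  apply: (@le_trans _ _ (integral_cell h1 g (gen g x) * ((vol g)^-1)%:E + t%:E)); last first.
    by apply: leeD => //; apply: ereal_sup_ubound; exists g.
  have mc := @measurable_cell R n g (gen g x).
  have -> : t%:E = t%:E * mu (cell g (gen g x)) * ((vol g)^-1)%:E.
    by rewrite [mu _]leb_cell -!EFinM mulfK// gt_eqF.
  rewrite -(integral_cst mu mc) -ge0_muleDl; last 2 first.
    by apply: integral_ge0 => y _; rewrite lee_fin.
    by apply: integral_ge0 => y _; rewrite lee_fin.
  apply: lee_wpmul2r; first by rewrite lee_fin invr_ge0 ltW.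
  rewrite -ge0_integralD//; last 2 first.
    by move=> y _; rewrite lee_fin.
    by apply/measurable_EFinP; exact: measurable_funS mh1.
  apply: ge0_le_integral_any => y _; first by rewrite lee_fin.
  rewrite -EFinD lee_fin /h1; case: ifPn; last by rewrite -leNgt add0r.
  by move=> _; rewrite lerDl.
apply: le_trans (rearrangement_affine (h := dyadic_maximal h1) (c := 1) (b := t) _ ltr01 t0 _) _.
  rewrite (_ : [set _ | _] = set0) ?measure0//; apply/seteqP; split => // x /=; apply.
  rewrite mul1e !gee0_abs//; exact: dyadic_maximal_ge0.
rewrite mul1e.
have rho1 : rearrangement (dyadic_maximal h1) ((2 : R) ^ m)%R <=
    \sum_(i <oo) ((2^-1 : R) ^+ i)%:E * rho h (m - i%:Z - 1)%R.
  apply: le_trans (rearrangement_weak_type (I := \int[mu]_x (h1 x)%:E) tp _ _) _.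
  - by apply: integral_ge0 => x _; rewrite lee_fin.
  - move=> s s0; apply: le_trans (dyadic_maximal_weak_type w0 h10 mh1 s0).
    apply: le_leb => x /=; rewrite gee0_abs; last exact: dyadic_maximal_ge0.
    by move/(lt_dyadic_maximal _ _ _ w0).
  - apply: (@le_trans _ _ (((2 : R) ^ m)^-1%:E *
        \sum_(i <oo) ((2 : R) ^ (m - i%:Z))%:E * rho h (m - i%:Z - 1)%R)).
      by apply: lee_wpmul2l; first by rewrite lee_fin invr_ge0 ltW.
    rewrite -nneseriesZl; last first.
      by move=> i _; rewrite mule_ge0 ?rearrangement_ge0// lee_fin ltW// pow2_gt0.
    apply: lee_nneseries => [i _ _|i _].
      rewrite !mule_ge0 ?rearrangement_ge0// lee_fin; first by rewrite invr_ge0 ltW.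
      by rewrite ltW// pow2_gt0.
    rewrite muleA -EFinM pow2D mulrA mulVf ?gt_eqF// mul1r -invr_expz -exprnP exprVn.
    exact: lexx.
apply: (@le_trans _ _ (\sum_(i <oo) ((2^-1 : R) ^+ i)%:E * rho h (m - i%:Z - 1)%R +
    \sum_(i <oo) ((2^-1 : R) ^+ i)%:E * rho h (m - i%:Z - 1)%R)).
  by apply: leeD => //; rewrite -tE.
have pos i : 0 <= ((2^-1 : R) ^+ i)%:E * rho h (m - i%:Z - 1)%R.
  by rewrite mule_ge0 ?lee_fin// rearrangement_ge0.
rewrite -nneseriesD => [|i _ _|i _ _]//.
apply: lee_nneseries => [i _ _|i _]; first by rewrite adde_ge0.
by rewrite muleCA mule_natl mule2n.
Qed.

(** After multiplication by 2^(m/q), [rearrangement_dyadic_maximal] reads as a geometric combination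
    of shifts of the sequence of [h], of ratio 2^(1/q - 1) < 1. *)
Lemma lorentz_dyadic_maximal q r : (0 < omega)%R -> (1 < q)%R -> 0 < r ->
  exists2 C : R, (0 < C)%R & forall h,
    (forall x, (0 <= h x)%R) -> measurable_fun [set: T] (h : T -> R) ->
    seqnorm r (lorentz_seq q (dyadic_maximal h)) <=
    C%:E * seqnorm r (lorentz_seq q (EFin \o h)).
Proof.
move=> w0 q1 r0; have q0 : (0 < q)%R by exact: lt_trans q1.
pose u := ((2 : R) `^ ((q^-1 - 1) / 2))%R.
have u01 : (0 < u < 1)%R.
  rewrite powR_gt0//= /u -[X in (_ < X)%R](powRr0 2) lt_pow2_powR//.
  by rewrite pmulr_llt0// subr_lt0 invf_lt1.
have u2 : (u ^+ 2 = 2^-1 * 2 `^ (q^-1))%R.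
  rewrite expr2 /u -pow2_powRD (_ : (_ / _ + _ = -1 + q^-1)%R); last by field; rewrite gt_eqF.
  by rewrite pow2_powRD powR_inv1.
have [C C0 HC] := seqnorm_geometric r0 u01.
pose c := (2 * 2 `^ q^-1)%R.
have c0 : (0 <= c)%R by rewrite mulr_ge0// powR_ge0.
exists (C * c)%R; first by rewrite !mulr_gt0// powR_gt0.
move=> h h0 mh.
pose A := lorentz_seq q (EFin \o h).
have A0 m : 0 <= A m by exact: lorentz_seq_ge0.
rewrite EFinM -muleA.
apply: (HC (fun i m => c%:E * A (m - (i%:Z + 1))%R)).
- by move=> i m; rewrite mule_ge0.
- by move=> m; exact: lorentz_seq_ge0.
- move=> m; rewrite {1}/lorentz_seq.
  apply: (@le_trans _ _ ((((2 : R) ^ m) `^ q^-1)%:E *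
    \sum_(i <oo) ((2^-1 : R) ^+ i)%:E * (2%:E * rho h (m - i%:Z - 1)%R))).
    by apply: lee_wpmul2l; [rewrite lee_fin powR_ge0|exact: rearrangement_dyadic_maximal].
  have pos i : 0 <= ((2^-1 : R) ^+ i)%:E * (2%:E * rho h (m - i%:Z - 1)%R).
    by rewrite !mule_ge0 ?lee_fin ?rearrangement_ge0// exprn_ge0.
  rewrite -nneseriesZl//; apply: lee_nneseries => [i _ _|i _].
    by rewrite mule_ge0// lee_fin powR_ge0.
  rewrite /A /lorentz_seq opprD addrA !muleA -!EFinM.
  apply: lee_wpmul2r; first exact: rearrangement_ge0.
  rewrite lee_fin u2 exprMn !pow2_powR /c.
  have -> : (m%:~R * q^-1 = (m - i%:Z - 1)%:~R * q^-1 + (i%:R * q^-1 + q^-1) :> R)%R.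
    have -> : ((m - i%:Z - 1)%:~R = m%:~R - i%:R - 1 :> R)%R by rewrite !rmorphB.
    ring.
  rewrite !pow2_powRD -[(2 `^ q^-1 ^+ i)%R]powR_mulrn ?powR_ge0// -powRrM [(q^-1 * _)%R]mulrC.
  by rewrite le_eqVlt; apply/orP; left; apply/eqP; ring.
- move=> i; apply: le_trans (seqnormZ_le r0 c0 _) _; first by move=> m.
  by apply: lee_wpmul2l; rewrite ?lee_fin// (seqnorm_shift r A).
Qed.

End maximal_bounds.

(** * The dyadic maximal operator on Morrey-Lorentz spaces *)

Section maximal_morrey.
Context {R : realType} {n : nat}.
Local Notation E := 'rV[R]_n.+1.
Local Notation T := (Rn R n).
Local Notation mu := (@leb R n).
Local Notation omega := (@unit_volume R n).
Local Notation vol := (@vol R n).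
Implicit Types (F : E -> R) (p q : R) (r : \bar R).
Local Open Scope ereal_scope.

Lemma vol_unbounded (X : R) : (0 < omega)%R -> exists g : int, (X <= vol g)%R.
Proof.
move=> w0; have [g] := pow2_above (Num.max 1 (X / omega))%R.
rewrite gt_max => /andP[g1 Xg]; exists g; rewrite /vol -ler_pdivrMr//.
by apply: (le_trans (ltW Xg)); rewrite ler_eXnr// ltW.
Qed.

Lemma integral_cell_morrey p q r : (0 < omega)%R -> (1 < q)%R -> 0 < r ->
  exists2 C : R, (0 < C)%R & forall F g m,
    (forall x, (0 <= F x)%R) -> measurable_fun [set: T] (F : T -> R) ->
    integral_cell F g m <=
    (C * vol g `^ (1 - p^-1))%:E * morrey_lorentz_norm p q r (EFin \o F).
Proof.
move=> w0 q1 r0; have [C C0 HC] := integral_cube_morrey (n := n) p q1 r0.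
exists C => // F g m F0 mF; have v0 := vol_gt0 g w0.
have mFE : measurable_fun [set: T] (EFin \o F : T -> \bar R) by exact/measurable_EFinP.
apply: le_trans (HC _ (closed_cell g m) (vol g) mFE _ _ _ v0).
- apply: ge0_subset_integral => //.
  + exact: measurable_cell.
  + exact: measurable_box.
  + exact: measurable_funS mFE.
  + by move=> x _; rewrite lee_fin.
  + exact: cell_sub_closed.
- by move=> x; rewrite lee_fin.
- exact: cube_closed_cell.
- exact: leb_closed_cell.
Qed.

(** By [integral_cell_morrey] the average over a cell of volume V is at most C N V^(-1/p), which
    falls below [s] once V reaches (C N / s)^p. *)
Lemma vanishing_morrey p q r F : (0 < omega)%R -> (0 < p)%R -> (1 < q)%R -> 0 < r ->
  (forall x, (0 <= F x)%R) -> measurable_fun [set: T] (F : T -> R) ->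
  morrey_lorentz_norm p q r (EFin \o F) < +oo -> vanishing_averages F.
Proof.
move=> w0 p0 q1 r0 F0 mF Noo s s0.
have [C C0 HC] := integral_cell_morrey p w0 q1 r0.
have := HC F; move: Noo (morrey_lorentz_ge0 p q r (EFin \o F)).
case: morrey_lorentz_norm => [N _|//|//]; rewrite lee_fin => N0 {}HC.
have [G HG] := vol_unbounded ((C * N / s) `^ p) w0.
exists G => g Gg x; apply/negP; rewrite -leNgt; apply: le_trans (HC _ _ F0 mF) _.
rewrite -EFinM lee_fin.
have v0 := vol_gt0 g w0.
have -> : (vol g `^ (1 - p^-1) = vol g * vol g `^ (- p^-1))%R.
  by rewrite powRD ?powRr1// ?(gt_eqF v0) ?implybT// ltW.
rewrite powRN (_ : (C * _ * N = C * N * vol g / vol g `^ p^-1)%R); last by ring.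
rewrite ler_pdivrMr ?powR_gt0//.
have CN0 : (0 <= C * N / s)%R by rewrite mulr_ge0 ?invr_ge0 ?(ltW s0)// mulr_ge0// ltW.
have key : (C * N <= vol g `^ p^-1 * s)%R.
  rewrite -ler_pdivrMr//.
  have {1}-> : (C * N / s = ((C * N / s) `^ p) `^ p^-1)%R.
    by rewrite -powRrM mulfV ?gt_eqF// powRr1.
  rewrite ge0_ler_powR ?nnegrE ?powR_ge0 ?invr_ge0 ?(ltW p0) ?(ltW v0)//.
  by apply: le_trans HG _; exact: le_vol.
have := ler_wpM2r (ltW v0) key; lra.
Qed.

(** On a cube, averages over cells of comparable or smaller size only see [F] on an enlarged cube,
    where the Lorentz bound applies. Averages over larger cells are bounded by a constant through
    the Morrey condition, and a constant on a cube has a truncated geometric sequence. *)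
Lemma dyadic_maximal_morrey p q r : (0 < omega)%R -> (1 < q)%R -> (q <= p)%R -> 0 < r ->
  exists2 C : R, (0 < C)%R & forall F,
    (forall x, (0 <= F x)%R) -> measurable_fun [set: T] (F : T -> R) ->
    morrey_lorentz_norm p q r (dyadic_maximal F) <=
    C%:E * morrey_lorentz_norm p q r (EFin \o F).
Proof.
move=> w0 q1 qp r0; have q0 : (0 < q)%R by exact: lt_trans q1.
have p0 : (0 < p)%R by exact: lt_le_trans qp.
have qV0 : (0 < q^-1)%R by rewrite invr_gt0.
have pq0 : (0 <= q^-1 - p^-1)%R by rewrite subr_ge0 lef_pV2.
have [C1 C10 avg] := integral_cell_morrey p w0 q1 r0.
have [C2 C20 Mbound] := lorentz_dyadic_maximal (n := n) w0 q1 r0.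
have [C3 C30 upper] := lorentz_norm_le_seq (n := n) q0 r0.
have [C4 C40 lower] := seq_le_lorentz_norm (n := n) q0 r0.
have [C5 C50 add] := seqnorm_add (R := R) r0.
have [C6 C60 trunc] := seqnorm_truncated (R := R) r0 qV0.
(* The enlarged cube below has side [l + 2 * 2 ^ g], at most [5 * l]. *)
pose c5 := ((5 ^+ n.+1) `^ (q^-1 - p^-1))%R.
have c50 : (0 < c5)%R by rewrite powR_gt0// exprn_gt0.
pose C7 := Num.max (C2 * (C4 * c5))%R (C6 * C1)%R.
exists (C3 * (C5 * C7))%R; first by rewrite !mulr_gt0// lt_max !mulr_gt0.
move=> F F0 mF; have := avg F.
have C7_1 : (C2 * (C4 * c5) <= C7)%R by rewrite le_max lexx.
have C7_2 : (C6 * C1 <= C7)%R by rewrite le_max lexx orbT.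
have C70 : (0 < C7)%R by rewrite lt_max !mulr_gt0.
have := @lorentz_norm_restrict R n p q r (EFin \o F).
case NE : (morrey_lorentz_norm p q r (EFin \o F)) => [N| |]; last 2 first.
- by rewrite gt0_muley ?leey// lte_fin !mulr_gt0.
- by have := morrey_lorentz_ge0 p q r (EFin \o F); rewrite NE.
have N0 : (0 <= N)%R by rewrite -lee_fin -NE morrey_lorentz_ge0.
move=> restr {}avg; apply: ge_ereal_sup => _ [Q /cubeE[c [l [l0 QE]]] <-].
rewrite QE => {Q QE}; set Q := box c (c + const_mx l).
have cQ : cube Q by exact: cube_box.
pose V := (l ^+ n.+1 * omega)%R.
have V0 : (0 < V)%R by rewrite mulr_gt0// exprn_gt0.
have QV : mu Q = V%:E by exact: leb_cube.
rewrite QV poweR_EFin -lee_pdivlMl ?powR_gt0// -powRN opprB.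
have [g0 /andP[g0l lg0]] := pow2_between l0.
pose g := (g0 + 1)%R.
have lg : (l <= 2 ^ g)%R by exact: ltW.
have gl : ((2 : R) ^ g <= 2 * l)%R by rewrite pow2S ler_pM2l.
pose c' : E := (c - const_mx (2 ^ g))%R.
pose l' := (l + 2 * 2 ^ g)%R.
have l'0 : (0 < l')%R by rewrite addr_gt0// mulr_gt0// pow2_gt0.
pose Q' := box c' (c' + const_mx l').
pose V' := (l' ^+ n.+1 * omega)%R.
have V'0 : (0 < V')%R by rewrite mulr_gt0// exprn_gt0.
have Q'V : mu Q' = V'%:E by exact: leb_cube.
have V'V : (V' <= 5 ^+ n.+1 * V)%R.
  rewrite /V' /V mulrA ler_wpM2r ?(ltW w0)// -exprMn lerXn2r ?nnegrE ?mulr_ge0 ?(ltW l0) ?(ltW l'0)//.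
  by rewrite /l'; lra.
pose h x : R := (F x * \1_Q' x)%R.
have mQ' : measurable (Q' : set T) by exact: measurable_box.
have h0 x : (0 <= h x)%R by rewrite mulr_ge0.
have mh : measurable_fun [set: T] (h : T -> R).
  by apply: measurable_funM => //; exact: measurable_indic.
have hE : EFin \o h = (fun x => (EFin \o F) x * (\1_Q' x)%:E).
  by apply/funext => x; rewrite /h /= EFinM.
(* Bounds the averages over cells of generation above [g], whose volume is at least [V]. *)
pose b := (C1 * V `^ (- p^-1) * N)%R.
have b0 : (0 <= b)%R by rewrite !mulr_ge0 ?powR_ge0 ?(ltW C10).
have M_le x : Q x -> dyadic_maximal F x <= dyadic_maximal h x + b%:E.
  move=> Qx; apply: ge_ereal_sup => _ [j _ <-].
  have vj0 := vol_gt0 j w0.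
  have [jg|gj] := leP j g.
    apply: (@le_trans _ _ (integral_cell h j (gen j x) * ((vol j)^-1)%:E)); last first.
      apply: (@le_trans _ _ (dyadic_maximal h x)); last by rewrite leeDl ?lee_fin.
      by apply: ereal_sup_ubound; exists j.
    apply: lee_wpmul2r; first by rewrite lee_fin invr_ge0 ltW.
    apply: ge0_le_integral_any => y yx; first by rewrite lee_fin.
    rewrite /h lee_fin indicE mem_set ?mulr1// => i.
    have := cell_near yx i; rewrite ler_norml !mxE => /andP[y1 y2].
    have := Qx i; rewrite !mxE => /andP[x1 x2].
    have jg2 : ((2 : R) ^ j <= 2 ^ g)%R by rewrite le_pow2.
    by rewrite /l'; apply/andP; split; lra.
  apply: (@le_trans _ _ b%:E); last by rewrite leeDr// dyadic_maximal_ge0.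
  have Vj : (V <= vol j)%R.
    rewrite /V /vol ler_wpM2r ?(ltW w0)// lerXn2r ?nnegrE ?(ltW l0) ?(ltW (pow2_gt0 _))//.
    by apply: le_trans lg _; rewrite le_pow2 ltW.
  rewrite lee_pdivrMr//; apply: le_trans (avg _ _ F0 mF) _; rewrite -!EFinM lee_fin /b.
  have -> : (vol j `^ (1 - p^-1) = vol j * vol j `^ (- p^-1))%R.
    by rewrite powRD ?powRr1// ?(gt_eqF vj0) ?implybT// ltW.
  have vV : (vol j `^ (- p^-1) <= V `^ (- p^-1))%R.
    rewrite !powRN lef_pV2 ?posrE ?powR_gt0//.
    by rewrite ge0_ler_powR ?nnegrE ?invr_ge0 ?(ltW p0) ?(ltW V0) ?(ltW vj0).
  have : (0 <= C1 * N * vol j)%R by rewrite mulr_ge0 ?vol_ge0// mulr_ge0// ltW.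
  move=> /ler_wpM2l/(_ _ _ vV); lra.
have [k /andP[kV Vk]] := pow2_between V0.
pose MQ x : \bar R := dyadic_maximal F x * (\1_Q x)%:E.
pose A := lorentz_seq q (dyadic_maximal h).
(* [MQ] lives on [Q], of measure below [2 ^ (k + 1)], so the constant [b] counts only at indices up
   to [k]. *)
pose B m := if (m <= k)%R then (2 `^ (m%:~R * q^-1))%:E * b%:E else 0.
have A0 m : 0 <= A m by exact: lorentz_seq_ge0.
have B0 m : 0 <= B m by rewrite /B; case: ifP => // _; rewrite mule_ge0 ?lee_fin ?powR_ge0.
have seq_le m : lorentz_seq q MQ m <= A m + B m.
  rewrite /B; case: ifPn => mk.
    rewrite -pow2_powR /A /lorentz_seq -ge0_muleDr ?rearrangement_ge0 ?lee_fin//.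
    apply: lee_wpmul2l; first by rewrite lee_fin powR_ge0.
    rewrite -[X in _ <= X + _]mul1e; apply: rearrangement_affine => //.
    rewrite (_ : [set _ | _] = set0) ?measure0//; apply/seteqP; split => // x /=; apply.
    have Mh0 := dyadic_maximal_ge0 x h0 w0; have MF0 := dyadic_maximal_ge0 x F0 w0.
    rewrite mul1e [X in _ <= X + _]gee0_abs// /MQ gee0_abs; last by rewrite mule_ge0// lee_fin.
    have [Qx|nQx] := pselect (Q x); first by rewrite indicE mem_set// mule1; exact: M_le.
    by rewrite indicE memNset// mule0 adde_ge0.
  rewrite /lorentz_seq rearrangement_support ?mule0 ?adde0//.
  apply: (@le_trans _ _ (mu Q)); first by apply: le_leb; exact: restrict_neq0.
  rewrite QV lee_fin; apply: (le_trans (ltW Vk)).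
  by rewrite le_pow2 lezD1 ltNge.
have normA : seqnorm r A <= (C7 * (V `^ (q^-1 - p^-1) * N))%:E.
  apply: le_trans (Mbound _ h0 mh) _.
  apply: (@le_trans _ _ (C2%:E * (C4%:E * ((V' `^ (q^-1 - p^-1))%:E * N%:E)))).
    apply: lee_wpmul2l; first by rewrite lee_fin ltW.
    apply: le_trans (lower _) _; apply: lee_wpmul2l; first by rewrite lee_fin ltW.
    by rewrite hE; apply: restr => //; exact: cube_box.
  rewrite -!EFinM lee_fin.
  have VV : (V' `^ (q^-1 - p^-1) <= c5 * V `^ (q^-1 - p^-1))%R.
    have p5 : (0 <= 5 ^+ n.+1 :> R)%R by exact: exprn_ge0.
    rewrite /c5 -(powRM _ p5 (ltW V0)); apply: ge0_ler_powR => //; rewrite nnegrE.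
      exact: ltW.
    by apply: mulr_ge0 => //; exact: ltW.
  apply: (@le_trans _ _ (C2 * (C4 * ((c5 * V `^ (q^-1 - p^-1)) * N)))%R).
    apply: ler_wpM2l; first exact: ltW.
    by apply: ler_wpM2l; [exact: ltW|exact: ler_wpM2r].
  have : (0 <= V `^ (q^-1 - p^-1) * N)%R by rewrite mulr_ge0// powR_ge0.
  move=> /ler_wpM2r/(_ _ _ C7_1); apply: le_trans.
  by rewrite le_eqVlt; apply/orP; left; apply/eqP; ring.
have normB : seqnorm r B <= (C7 * (V `^ (q^-1 - p^-1) * N))%:E.
  apply: le_trans (trunc k b%:E _) _; first by rewrite lee_fin.
  rewrite -!EFinM lee_fin -pow2_powR.
  have kVq : ((2 ^ k) `^ q^-1 <= V `^ q^-1)%R.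
    by rewrite ge0_ler_powR ?nnegrE ?(ltW V0) ?(ltW qV0) ?(ltW (pow2_gt0 _)).
  have VV : (V `^ (q^-1 - p^-1) = V `^ q^-1 * V `^ (- p^-1))%R.
    by rewrite powRD// (gt_eqF V0) implybT.
  apply: (@le_trans _ _ (C6 * (V `^ q^-1 * b))%R).
    by rewrite ler_pM2l//; exact: ler_wpM2r.
  have : (0 <= V `^ (q^-1 - p^-1) * N)%R by rewrite mulr_ge0// powR_ge0.
  move=> /ler_wpM2r/(_ _ _ C7_2); rewrite /b VV; lra.
apply: le_trans (upper _) _.
apply: (@le_trans _ _ (C3%:E * seqnorm r (fun m => A m + B m))).
  apply: lee_wpmul2l; first by rewrite lee_fin ltW.
  by apply: le_seqnorm => // m; rewrite lorentz_seq_ge0 seq_le.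
apply: (@le_trans _ _ (C3%:E * (C5%:E * (C7 * (V `^ (q^-1 - p^-1) * N))%:E))).
  apply: lee_wpmul2l; first by rewrite lee_fin ltW.
  exact: add.
by rewrite -!EFinM lee_fin le_eqVlt; apply/orP; left; apply/eqP; ring.
Qed.

End maximal_morrey.

(** * Linear combinations and monomials: integrability and measurability *)

Section finite_linear_combinations.
Context d {T : measurableType d} {R : realType} (nu : {measure set T -> \bar R}).
Variables (D : set T) (mD : measurable D) (I : finType) (f : I -> T -> R).
Hypothesis intf : forall i, nu.-integrable D (EFin \o f i).

Lemma integrable_linear_combination (c : I -> R) :
  nu.-integrable D (EFin \o (fun x => \sum_i c i * f i x)).
Proof.
rewrite (_ : EFin \o _ = fun x => (\sum_i (c i)%:E * (EFin \o f i) x)%E); last first.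
  by apply/funext => x; rewrite /= -sumEFin.
by apply: integrable_sum => // i _; exact: integrableZl.
Qed.

Lemma Rintegral_linear_combination (c : I -> R) :
  \int[nu]_(x in D) (\sum_i c i * f i x) = \sum_i c i * \int[nu]_(x in D) f i x.
Proof.
rewrite /Rintegral (_ : (\int[nu]_(x in D) _)%E =
    (\int[nu]_(x in D) \sum_i (c i)%:E * (EFin \o f i) x)%E); last first.
  by apply: eq_integral => x _; rewrite -sumEFin.
rewrite integral_sum//; last by move=> i; exact: integrableZl.
rewrite (eq_bigr (fun i => (c i * fine (\int[nu]_(x in D) (f i x)%:E))%:E)) => [|i _].
  by rewrite sumEFin.
rewrite integralZl// EFinM fineK//.
exact: (integrable_fin_num mD (intf i)).
Qed.

End finite_linear_combinations.

Section measurable_polynomials.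
Context d {T : measurableType d} {R : realType} {I : finType}.
Implicit Types (f : I -> T -> R).

Lemma measurable_linear_combination f (c : I -> R) :
  (forall i, measurable_fun [set: T] (f i)) ->
  measurable_fun [set: T] (fun x => \sum_i c i * f i x).
Proof. by move=> mf; apply: measurable_sum => i; exact: measurable_funM. Qed.

Lemma measurable_shifted_monomial f (s : R) (t : I -> R) (k : I -> nat) :
  (forall i, measurable_fun [set: T] (f i)) ->
  measurable_fun [set: T] (fun x => \prod_i (f i x / s - t i) ^+ k i).
Proof.
move=> mf; apply: measurable_prod => i _; apply: measurable_funX.
by apply: measurable_funB => //; exact: measurable_funM.
Qed.

End measurable_polynomials.

(** * Polynomials with prescribed moments on a cell *)

Section moment_projection.
Context {R : realType} {n : nat} (K : nat).
Local Notation E := 'rV[R]_n.+1.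
Local Notation T := (Rn R n).
Local Notation mu := (@leb R n).
Local Notation ix := 'rV[int]_n.+1.
Implicit Types (x : E) (g : int) (m : ix) (u : E -> R).

(** Each exponent is bounded by [K] separately: this box of multi-indices contains all those of
    total degree at most [K], and it suits products of one-variable expansions. *)
Definition exponents := {ffun 'I_n.+1 -> 'I_K.+1}.
Implicit Types (a b : exponents).

(** Monomials in the coordinates identifying the cell with the unit cell: they take values between 0
    and 1 there, and constants do not depend on the cell. *)
Definition cell_monomial g m a x : R := \prod_i (x 0 i / 2 ^ g - (m 0 i)%:~R) ^+ a i.

Lemma cell_monomial_affine g m a x :
  cell_monomial g m a (affine (2 ^ g) (corner g m) x) = cell_monomial 0 0 a x.
Proof.
apply: eq_bigr => i _; congr (_ ^+ _); rewrite /affine !mxE expr0z divr1 mulr0z subr0.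
by rewrite mulrDl mulrAC mulfV ?pow2_neq0// mul1r mulfK ?pow2_neq0// addrK.
Qed.

Lemma cell_monomial_itv g m a x : cell g m x -> 0 <= cell_monomial g m a x <= 1.
Proof.
move=> /cellP xm; have H i : 0 <= x 0 i / 2 ^ g - (m 0 i)%:~R <= 1.
  have p0 := @pow2_gt0 R g; have := xm i; rewrite !mxE => /andP[a1 /ltW a2].
  rewrite subr_ge0 ler_pdivlMr// a1/= lerBlDr ler_pdivrMr// mulrDl mul1r addrC.
  exact: a2.
apply/andP; split.
  by apply: prodr_ge0 => i _; have /andP[? _] := H i; exact: exprn_ge0.
rewrite -[leRHS](@big1_eq _ 1 *%R _ (index_enum 'I_n.+1) xpredT).
by apply: ler_prod => i _; have /andP[h1 h2] := H i; rewrite exprn_ge0//= exprn_ile1.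
Qed.

Lemma measurable_cell_monomial g m a :
  measurable_fun [set: T] (cell_monomial g m a : T -> R).
Proof.
exact: (measurable_shifted_monomial (f := fun i (x : T) => (x : E) 0 i) _ _ _
  (@measurable_coordinate R n)).
Qed.

Lemma integrable_cell_monomial g m a u : mu.-integrable (cell g m : set T) (EFin \o u) ->
  mu.-integrable (cell g m : set T) (EFin \o (fun x => u x * cell_monomial g m a x)).
Proof.
move=> iu; have mu' := measurable_int mu iu.
apply: le_integrable iu; first exact: measurable_cell.
  apply/measurable_EFinP; apply: measurable_funM; first exact/measurable_EFinP.
  exact: measurable_funS (measurable_cell_monomial g m a).
move=> x xm; rewrite /= lee_fin normrM ler_piMr//.
by have /andP[h1 h2] := cell_monomial_itv a xm; rewrite ger0_norm.
Qed.

Lemma integrable_cst_cell g m : mu.-integrable (cell g m : set T) (EFin \o (fun=> 1)).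
Proof.
apply/integrableP; split; first exact: measurable_cst.
rewrite (eq_integral (cst 1%E)); last by move=> x _; rewrite /= normr1.
rewrite integral_cst; last exact: measurable_cell.
by rewrite mul1e [X in (X < _)%E]leb_cell ltry.
Qed.

Lemma integrable_monomials g m a :
  mu.-integrable (cell g m : set T) (EFin \o cell_monomial g m a).
Proof.
have := integrable_cell_monomial a (integrable_cst_cell g m).
by rewrite (_ : (fun x => 1 * _) = cell_monomial g m a)//; apply/funext => x; rewrite mul1r.
Qed.

Definition gram g m a b : R :=
  \int[mu]_(x in (cell g m : set T)) (cell_monomial g m a x * cell_monomial g m b x).

(** By the change of variables to the unit cell, one Gram matrix serves all cells up to the
    Jacobian. *)
Lemma gram_scale g m a b : gram g m a b = (2 ^ g) ^+ n.+1 * gram 0 0 a b.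
Proof.
have p0 := @pow2_gt0 R g.
rewrite /gram /Rintegral (ge0_integral_affine (corner g m) p0).
- rewrite cell_affine (_ : (\int[mu]_(x in (cell 0 0 : set T)) _)%E =
    (\int[mu]_(x in (cell 0 0 : set T)) (cell_monomial 0 0 a x * cell_monomial 0 0 b x)%:E)%E).
    rewrite fineM//; apply: integrable_fin_num; first exact: measurable_cell.
    exact/integrable_cell_monomial/integrable_monomials.
  by apply: eq_integral => x _; rewrite !cell_monomial_affine.
- exact: measurable_cell.
- apply/measurable_EFinP/measurable_funM; exact: measurable_funS (measurable_cell_monomial g m _).
- move=> x xm; rewrite lee_fin mulr_ge0//.
    by have /andP[] := cell_monomial_itv a xm.
  by have /andP[] := cell_monomial_itv b xm.
Qed.

Definition gram_matrix : 'M[R]_#|{: exponents}| :=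
  \matrix_(i, j) gram 0 0 (enum_val i) (enum_val j).

Definition moments g m u : 'rV[R]_#|{: exponents}| :=
  \row_j \int[mu]_(x in (cell g m : set T)) (u x * cell_monomial g m (enum_val j) x).

(** Solves the normal equations: [pinvmx] yields a solution as soon as the moments lie in the row
    space, which is [moments_sub_gram]. *)
Definition projection_coef g m u : 'rV[R]_#|{: exponents}| :=
  ((2 ^ g) ^+ n.+1)^-1 *: (moments g m u *m pinvmx gram_matrix).

Definition projection g m u x : R :=
  \sum_j projection_coef g m u 0 j * cell_monomial g m (enum_val j) x.

(* A polynomial in the kernel of the Gram form vanishes a.e. on the cell, so it is
   orthogonal to [u]; hence the moments of [u] lie in the row space. *)
Lemma moments_sub_gram g m u : mu.-integrable (cell g m : set T) (EFin \o u) ->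
  (moments g m u <= gram_matrix)%MS.
Proof.
move=> iu; rewrite submxE; apply/eqP/rowP => k; rewrite !mxE.
set c := fun j => cokermx gram_matrix j k.
have Gc i : \sum_j gram_matrix i j * c j = 0.
  by have /matrixP/(_ i k) := mulmx_coker gram_matrix; rewrite !mxE.
pose P x := \sum_j c j * cell_monomial g m (enum_val j) x.
have mc := @measurable_cell R n g m.
have mP : measurable_fun [set: T] (P : T -> R).
  apply: (measurable_linear_combination (f := fun j => cell_monomial g m (enum_val j) : T -> R)).
  by move=> j; exact: measurable_cell_monomial.
have PP : \int[mu]_(x in (cell g m : set T)) (P x * P x) = 0.
  have -> : \int[mu]_(x in (cell g m : set T)) (P x * P x) =
      \int[mu]_(x in (cell g m : set T)) (\sum_(ij : 'I_#|{: exponents}| * 'I_#|{: exponents}|)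
        (c ij.1 * c ij.2) * (cell_monomial g m (enum_val ij.1) x * cell_monomial g m (enum_val ij.2) x)).
    apply: eq_Rintegral => x _; rewrite /P mulr_suml.
    rewrite -(pair_bigA _ (fun i j => c i * c j * (cell_monomial g m (enum_val i) x *
      cell_monomial g m (enum_val j) x)))/=.
    by apply: eq_bigr => i _; rewrite mulr_sumr; apply: eq_bigr => j _; rewrite mulrACA.
  rewrite (@Rintegral_linear_combination _ _ _ mu _ mc _ (fun ij x =>
    cell_monomial g m (enum_val ij.1) x * cell_monomial g m (enum_val ij.2) x)); last first.
    by move=> ij; exact/integrable_cell_monomial/integrable_monomials.
  rewrite -(pair_bigA _ (fun i j => c i * c j * gram g m (enum_val i) (enum_val j)))/=.
  apply: big1 => i _; transitivity (c i * (2 ^ g) ^+ n.+1 * \sum_j gram_matrix i j * c j).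
    rewrite mulr_sumr; apply: eq_bigr => j _; rewrite gram_scale !mxE; ring.
  by rewrite Gc mulr0.
have P0 : ae_eq mu (cell g m : set T) (fun x => (P x * P x)%:E) (cst 0%E).
  apply/ae_eq_integral_abs => //.
    apply/measurable_EFinP/measurable_funM; exact: measurable_funS mP.
  transitivity (\int[mu]_(x in (cell g m : set T)) (P x * P x)%:E)%E.
    by apply: eq_integral => x _; rewrite gee0_abs// lee_fin -expr2 sqr_ge0.
  rewrite -[RHS](congr1 EFin PP) /Rintegral fineK//.
  apply: integrable_fin_num => //.
  rewrite (_ : (fun x => (P x * P x)%:E) = EFin \o (fun x =>
    \sum_j c j * (P x * cell_monomial g m (enum_val j) x))); last first.
    apply/funext => x /=; congr EFin; rewrite {2}/P mulr_sumr; apply: eq_bigr => j _.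
    by rewrite mulrCA.
  apply: integrable_linear_combination => // j; apply: integrable_cell_monomial.
  by apply: integrable_linear_combination => // j'; exact: integrable_monomials.
transitivity (\int[mu]_(x in (cell g m : set T)) (u x * P x)).
  have -> : \int[mu]_(x in (cell g m : set T)) (u x * P x) = \int[mu]_(x in (cell g m : set T))
      (\sum_j c j * (u x * cell_monomial g m (enum_val j) x)).
    by apply: eq_Rintegral => x _; rewrite /P mulr_sumr; apply: eq_bigr => j _; rewrite mulrCA.
  rewrite (@Rintegral_linear_combination _ _ _ mu _ mc _ (fun j x =>
    u x * cell_monomial g m (enum_val j) x)); last first.
    by move=> j; exact: integrable_cell_monomial.
  by apply: eq_bigr => j _; rewrite mxE mulrC.
rewrite /Rintegral (ae_eq_integral (cst 0%E)) ?integral0//.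
- apply/measurable_EFinP/measurable_funM; last exact: measurable_funS mP.
  by apply/measurable_EFinP; exact: measurable_int iu.
- apply: filterS P0 => x H xm; have := H xm; move=> /= [] /eqP.
  by rewrite mulf_eq0 orbb => /eqP ->; rewrite mulr0.
Qed.

Lemma integrable_projection g m u :
  mu.-integrable (cell g m : set T) (EFin \o projection g m u).
Proof.
apply: integrable_linear_combination; first exact: measurable_cell.
by move=> j; exact: integrable_monomials.
Qed.

Lemma measurable_projection g m u : measurable_fun [set: T] (projection g m u : T -> R).
Proof.
apply: (measurable_linear_combination (f := fun j => cell_monomial g m (enum_val j) : T -> R)).
by move=> j; exact: measurable_cell_monomial.
Qed.

Lemma moment_projection g m u a : mu.-integrable (cell g m : set T) (EFin \o u) ->
  \int[mu]_(x in (cell g m : set T)) (projection g m u x * cell_monomial g m a x) =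
  \int[mu]_(x in (cell g m : set T)) (u x * cell_monomial g m a x).
Proof.
move=> iu; have mc := @measurable_cell R n g m.
transitivity (\int[mu]_(x in (cell g m : set T)) (\sum_j projection_coef g m u 0 j *
    (cell_monomial g m (enum_val j) x * cell_monomial g m a x))).
  apply: eq_Rintegral => x _; rewrite /projection mulr_suml.
  by apply: eq_bigr => j _; rewrite mulrA.
rewrite (@Rintegral_linear_combination _ _ _ mu _ mc _ (fun j x =>
    cell_monomial g m (enum_val j) x * cell_monomial g m a x)); last first.
  by move=> j; exact/integrable_cell_monomial/integrable_monomials.
have p0 : ((2 : R) ^ g) ^+ n.+1 != 0 by rewrite expf_neq0// pow2_neq0.
have /rowP/(_ (enum_rank a)) := mulmxKpV (moments_sub_gram iu).
rewrite [RHS]mxE enum_rankK => <-; rewrite mxE; apply: eq_bigr => j _.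
rewrite -/(gram g m (enum_val j) a) gram_scale /projection_coef !mxE enum_rankK.
by rewrite mulrAC !mulrA mulVf// mul1r mulrC.
Qed.

(** Normalized monomials are at most 1 on the cell, so the constant is the sum of the absolute
    entries of the pseudoinverse for the unit cell; the cell itself enters only through the scaling
    factor. *)
Lemma projection_bound : exists2 C : R, 0 <= C & forall g m u x,
  mu.-integrable (cell g m : set T) (EFin \o u) -> cell g m x ->
  `|projection g m u x| <=
  C * ((2 ^ g) ^+ n.+1)^-1 * \int[mu]_(x in (cell g m : set T)) `|u x|.
Proof.
exists (\sum_j \sum_i `|pinvmx gram_matrix i j|).
  by apply: sumr_ge0 => j _; exact: sumr_ge0.
move=> g m u x iu xm; have mc := @measurable_cell R n g m.
set I := \int[mu]_(x in _) _; set V := (_ ^+ _)^-1.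
have V0 : 0 <= V by rewrite invr_ge0 exprn_ge0// ltW// pow2_gt0.
rewrite -mulrA mulr_suml; apply: le_trans (ler_norm_sum _ _ _) _.
apply: ler_sum => j _; rewrite normrM.
have /andP[e0 e1] := cell_monomial_itv (enum_val j) xm.
rewrite [X in _ * X]ger0_norm//; apply: (@le_trans _ _ `|projection_coef g m u 0 j|).
  by rewrite ler_piMr.
rewrite /projection_coef !mxE normrM ger0_norm// mulrCA.
apply: ler_wpM2l => //; rewrite mulr_suml.
apply: le_trans (ler_norm_sum _ _ _) _; apply: ler_sum => i _.
rewrite mxE normrM mulrC; apply: ler_wpM2l => //.
have iui := integrable_cell_monomial (enum_val i) iu.
apply: le_trans (le_normr_Rintegral mc iui) _.
apply: le_Rintegral => //; [exact: integrable_norm|exact: integrable_norm|].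
move=> y ym; rewrite normrM ler_piMr//.
by have /andP[h0 h1] := cell_monomial_itv (enum_val i) ym; rewrite ger0_norm.
Qed.

(** Each coordinate is an affine function of its normalized version; expanding the powers and
    distributing the product over [exponents] gives the combination. *)
Lemma monomial_cell g m (alpha : 'I_n.+1 -> nat) : (forall i, (alpha i <= K)%N) ->
  exists c : exponents -> R, forall x, monomial alpha x = \sum_a c a * cell_monomial g m a x.
Proof.
move=> aK; pose p i : {poly R} := ((2 ^ g) *: 'X + (2 ^ g * (m 0 i)%:~R)%:P) ^+ alpha i.
exists (fun a => \prod_i (p i)`_(a i)) => x.
have pE i : x 0 i ^+ alpha i =
    \sum_(j < K.+1) (p i)`_j * (x 0 i / 2 ^ g - (m 0 i)%:~R) ^+ j.
  rewrite -horner_coef_wide; last first.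
    rewrite /p; apply: leq_trans (size_poly_exp_leq _ _) _.
    have s2 : (size ((2 ^ g *: 'X + (2 ^ g * (m 0 i)%:~R)%:P)%R : {poly R}) <= 2)%N.
      apply: leq_trans (size_polyD _ _) _; rewrite geq_max.
      rewrite (leq_trans (size_scale_leq _ _)) ?size_polyX//=.
      by apply: leq_trans (size_polyC_leq1 _) _.
    rewrite ltnS; apply: leq_trans (aK i).
    by rewrite -[leqRHS]mul1n leq_mul2r; case: size s2 => [|[|[|]]]//; rewrite orbT.
  rewrite /p horner_exp hornerD hornerZ hornerX hornerC; congr (_ ^+ _).
  by rewrite mulrBr mulrCA mulfV ?pow2_neq0// mulr1 subrK.
rewrite /monomial (eq_bigr _ (fun i _ => pE i)) bigA_distr_bigA/=.
by apply: eq_bigr => a _; rewrite -big_split.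
Qed.

Lemma projection_monomial g m u (alpha : 'I_n.+1 -> nat) : (forall i, (alpha i <= K)%N) ->
  mu.-integrable (cell g m : set T) (EFin \o u) ->
  \int[mu]_(x in (cell g m : set T)) (monomial alpha x * projection g m u x) =
  \int[mu]_(x in (cell g m : set T)) (monomial alpha x * u x).
Proof.
move=> aK iu; have [c cE] := monomial_cell g m aK; have mc := @measurable_cell R n g m.
have key w : mu.-integrable (cell g m : set T) (EFin \o w) ->
    \int[mu]_(x in (cell g m : set T)) (monomial alpha x * w x) =
    \sum_a c a * \int[mu]_(x in (cell g m : set T)) (w x * cell_monomial g m a x).
  move=> iw; rewrite -(@Rintegral_linear_combination _ _ _ mu _ mc _ (fun a x =>
    w x * cell_monomial g m a x)); last by move=> a; exact: integrable_cell_monomial.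
  apply: eq_Rintegral => x _; rewrite cE mulr_suml; apply: eq_bigr => a _.
  by rewrite mulrAC mulrA.
rewrite !key//; last exact: integrable_projection.
by apply: eq_bigr => a _; rewrite moment_projection.
Qed.

End moment_projection.

(** * Calderon-Zygmund good parts and their differences *)

Section good_functions.
Context {R : realType} {n : nat} (K : nat).
Local Notation E := 'rV[R]_n.+1.
Local Notation T := (Rn R n).
Local Notation mu := (@leb R n).
Local Notation omega := (@unit_volume R n).
Local Notation vol := (@vol R n).
Local Notation ix := 'rV[int]_n.+1.
Implicit Types (F u : E -> R) (x : E) (g k : int) (m : ix).

Lemma bounded_integrable_cell g m u (C : R) : measurable_fun [set: T] (u : T -> R) ->
  (forall x, cell g m x -> `|u x| <= C) ->
  mu.-integrable (cell g m : set T) (EFin \o u).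
Proof.
move=> mu' uC; have mc := @measurable_cell R n g m.
have iC : mu.-integrable (cell g m : set T) (fun x => (C%:E * (EFin \o (fun=> 1%R)) x)%E).
  by apply: integrableZl => //; exact: integrable_cst_cell.
apply: le_integrable iC => //; first by apply/measurable_EFinP; exact: measurable_funS mu'.
move=> x xm; rewrite /= mulr1 lee_fin (le_trans (uC x xm))// ler_norm//.
Qed.

Lemma integrable_monomialM g m u (alpha : 'I_n.+1 -> nat) :
  mu.-integrable (cell g m : set T) (EFin \o u) ->
  mu.-integrable (cell g m : set T) (EFin \o (fun x => monomial alpha x * u x)).
Proof.
move=> iu; pose N := \max_i alpha i.
have [c cE] := @monomial_cell R n N g m alpha (fun i => leq_bigmax i).
rewrite (_ : EFin \o _ = EFin \o (fun x => \sum_a c a * (u x * cell_monomial g m a x))).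
  apply: integrable_linear_combination; first exact: measurable_cell.
  by move=> a; exact: integrable_cell_monomial.
apply/funext => x /=; rewrite cE mulr_suml; congr EFin.
by apply: eq_bigr => a _; rewrite mulrAC mulrA.
Qed.

Section fixed_functions.
(** [F] decides the stopping cells and [u] is a real function below it, later the real or the
    imaginary part of a complex function of modulus [F]. *)
Variables (F u : E -> R).
Hypotheses (w0 : 0 < omega) (F0 : forall x, 0 <= F x).
Hypotheses (mF : measurable_fun [set: T] (F : T -> R)) (measurable_u : measurable_fun [set: T] (u : T -> R)).
Hypotheses (vF : vanishing_averages F) (uF : forall x, `|u x| <= F x).
Hypothesis F_le : forall x, ((F x)%:E <= 2%:E * dyadic_maximal F x)%E.
Hypothesis F_loc : forall g m, (integral_cell F g m < +oo)%E.

(** Outside the level set the value is the default 0; [good] tests membership before using it. *)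
Definition stopping_gen k x : int := xget 0 [set g | stopped F (2 ^ k) g x].

Lemma stopping_genE k g x : stopped F (2 ^ k) g x -> stopping_gen k x = g.
Proof.
move=> sx; rewrite /stopping_gen; case: xgetP => [g' _ s'x|/(_ g)//].
exact: stopped_unique s'x sx.
Qed.

Lemma stopping_genP k x : above_level F (2 ^ k) x -> stopped F (2 ^ k) (stopping_gen k x) x.
Proof.
move=> [g /(stopped_exists vF (pow2_gt0 k))[g' _ sx]].
by rewrite (stopping_genE sx).
Qed.

Definition good k x : R :=
  if `[< above_level F (2 ^ k) x >]
  then projection K (stopping_gen k x) (gen (stopping_gen k x) x) u x else u x.

Lemma good_stopped k g x : stopped F (2 ^ k) g x -> good k x = projection K g (gen g x) u x.
Proof.
move=> sx; rewrite /good asboolT; last by exists g; case: sx.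
by rewrite (stopping_genE sx).
Qed.

Lemma good_off k x : ~ above_level F (2 ^ k) x -> good k x = u x.
Proof. by move=> nx; rewrite /good asboolF. Qed.

Lemma good_stopped_cell k d x : stopped_cell F (2 ^ k) d x -> good k x = projection K d.1 d.2 u x.
Proof. by move=> [<- sx]; rewrite (good_stopped sx). Qed.

Lemma measurable_good k : measurable_fun [set: T] (good k : T -> R).
Proof.
rewrite -(setUv (above_level F (2 ^ k))); apply/measurable_funU.
- exact: measurable_above_level.
- exact/measurableC/measurable_above_level.
split.
  have -> : above_level F (2 ^ k) =
      \bigcup_j enum_sets (stopped_cell F (2 ^ k) : int * ix -> set T) j.
    by rewrite bigcup_enum_sets bigcup_stopped_cell// pow2_gt0.
  apply/measurable_fun_bigcup.
    by apply: measurable_enum_sets => d; exact: measurable_stopped_cell.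
  move=> j; rewrite /enum_sets; case: pickle_inv => [d|]; last exact: measurable_fun_set0.
  apply: (eq_measurable_fun (projection K d.1 d.2 u : T -> R)).
    by move=> x; rewrite inE => /good_stopped_cell.
  by apply: measurable_funS (measurable_projection K d.1 d.2 u).
apply: (eq_measurable_fun (u : T -> R)).
  by move=> x; rewrite inE => /good_off.
exact: measurable_funS measurable_u.
Qed.

Lemma integrable_cell g m : mu.-integrable (cell g m : set T) (EFin \o u).
Proof.
have mc := @measurable_cell R n g m.
apply/integrableP; split; first by apply/measurable_EFinP; exact: measurable_funS measurable_u.
apply: le_lt_trans (F_loc g m); apply: ge0_le_integral_any => // x _.
by rewrite /= lee_fin.
Qed.

(** The 2 bounds [u] off the level set. The other entry is the constant of [projection_bound] times
    [2 ^+ n.+1], the volume growth from a stopping cell to its parent; [omega] converts powers of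
    the side into volumes. *)
Definition good_const : R := Num.max 2 (s2val (cid2 (projection_bound K (R := R) (n := n))) * (2 ^+ n.+1 * omega)).

(** The parent of a stopping cell is not above the level, which bounds the integral of [F] over the
    cell by [2 ^ k] times the volume of the parent. Off the level set the maximal function is at
    most [2 ^ k] and [F_le] applies. *)
Lemma good_bound k x : `|good k x| <= good_const * 2 ^ k.
Proof.
have p0 := @pow2_gt0 R k.
have [kx|nkx] := pselect (above_level F (2 ^ k) x); last first.
  rewrite good_off//; apply: (le_trans (uF x)).
  have Fk : F x <= 2 * 2 ^ k.
    rewrite -lee_fin; apply: le_trans (F_le x) _; rewrite EFinM.
    apply: lee_wpmul2l; first by rewrite lee_fin.
    rewrite leNgt; apply/negP => /(lt_dyadic_maximal _ _ _ w0); exact: nkx.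
  by apply: (le_trans Fk); rewrite ler_pM2r// le_max lexx.
have [P P0 HP] := projection_bound K (R := R) (n := n).
have := stopping_genP kx; set g := stopping_gen k x => sx; rewrite (good_stopped sx).
rewrite /good_const; case: cid2 => {P0 HP}P P0 HP /=.
have gx : cell g (gen g x) x by [].
have := HP _ _ _ _ (integrable_cell g (gen g x)) gx; move=> /le_trans; apply.
have q0 : 0 < ((2 : R) ^ g) ^+ n.+1 by rewrite exprn_gt0// pow2_gt0.
have Iu : \int[mu]_(y in (cell g (gen g x) : set T)) `|u y| <= 2 ^ k * (2 ^+ n.+1 * vol g).
  rewrite -volS -lee_fin /Rintegral fineK; last first.
    apply: integrable_fin_num; first exact: measurable_cell.
    exact/integrable_norm/integrable_cell.
  have [_ /(_ (g + 1))] := sx; rewrite ltrDl ltr01 => /(_ isT)/negP.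
  rewrite /above -leNgt; apply: le_trans.
  apply: (@le_trans _ _ (integral_cell F g (gen g x))).
    by apply: ge0_le_integral_any => y _; rewrite lee_fin.
  apply: ge0_subset_integral.
  - exact: measurable_cell.
  - exact: measurable_cell.
  - by apply/measurable_EFinP; exact: measurable_funS mF.
  - by move=> y _; rewrite lee_fin.
  - by apply: cell_subset; rewrite lerDl.
apply: (@le_trans _ _ (P * (((2 : R) ^ g) ^+ n.+1)^-1 * (2 ^ k * (2 ^+ n.+1 * vol g)))).
  by apply: ler_wpM2l => //; rewrite mulr_ge0// invr_ge0 ltW.
apply: (@le_trans _ _ (P * (2 ^+ n.+1 * omega) * 2 ^ k)); last first.
  by rewrite ler_pM2r// le_max lexx orbT.
rewrite le_eqVlt; apply/orP; left; apply/eqP; rewrite /vol.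
by field; rewrite gt_eqF.
Qed.

Lemma integrable_good k g m : mu.-integrable (cell g m : set T) (EFin \o good k).
Proof.
apply: bounded_integrable_cell (measurable_good k) _ => x _; exact: good_bound.
Qed.

Lemma above_level_mono k k' : k <= k' -> above_level F (2 ^ k') `<=` above_level F (2 ^ k).
Proof.
move=> kk' x [g gx]; exists g; apply: le_lt_trans gx.
by rewrite lee_fin ler_wpM2r ?vol_ge0// le_pow2.
Qed.

(** A cell above the higher level is also above the lower one, whose stopping cell is the coarsest
    such. *)
Lemma stopped_gen_le k k' g g' x : k <= k' -> stopped F (2 ^ k) g x ->
  stopped F (2 ^ k') g' x -> g' <= g.
Proof.
move=> kk' [_ sx] [ax _]; rewrite leNgt; apply/negP => gg'; apply: (sx _ gg').
by apply: le_lt_trans ax; rewrite lee_fin ler_wpM2r ?vol_ge0// le_pow2.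
Qed.

Lemma moment_good k g m (alpha : 'I_n.+1 -> nat) : (forall i, (alpha i <= K)%N) ->
  (exists2 x, cell g m x & stopped F (2 ^ k) g x) ->
  \int[mu]_(x in (cell g m : set T)) (monomial alpha x * good k x) =
  \int[mu]_(x in (cell g m : set T)) (monomial alpha x * u x).
Proof.
move=> aK [x xm sx]; rewrite -(projection_monomial aK (integrable_cell g m)).
apply: eq_Rintegral => y; rewrite inE => ym; rewrite (good_stopped_cell (d := (g, m)))//.
by split => //; apply: stopped_gen sx; rewrite xm ym.
Qed.

(* The stopping cells of level [k+1] that meet a stopping cell of level [k] lie
   inside it, and they carry the same moments of [good (k+1)] and [u]. *)
Lemma moment_good_next k g m (alpha : 'I_n.+1 -> nat) : (forall i, (alpha i <= K)%N) ->
  (exists2 x, cell g m x & stopped F (2 ^ k) g x) ->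
  \int[mu]_(x in (cell g m : set T)) (monomial alpha x * good (k + 1) x) =
  \int[mu]_(x in (cell g m : set T)) (monomial alpha x * u x).
Proof.
move=> aK [x0 x0m sx0]; have mc := @measurable_cell R n g m.
pose h x := monomial alpha x * (good (k + 1) x - u x).
have iB g' m' : mu.-integrable (cell g' m' : set T) (EFin \o (fun x => good (k + 1) x - u x)).
  have := integrableB (@measurable_cell R n g' m') (integrable_good (k + 1) g' m') (integrable_cell g' m').
  by apply: eq_integrable => //; exact: measurable_cell.
have ih g' m' : mu.-integrable (cell g' m' : set T) (EFin \o h).
  exact: integrable_monomialM.
have sub g' m' : \int[mu]_(x in (cell g' m' : set T)) h x =
    \int[mu]_(x in (cell g' m' : set T)) (monomial alpha x * good (k + 1) x) -
    \int[mu]_(x in (cell g' m' : set T)) (monomial alpha x * u x).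
  rewrite -RintegralB.
  - by apply: eq_Rintegral => x _; rewrite /h mulrBr.
  - exact: measurable_cell.
  - exact/integrable_monomialM/integrable_good.
  - exact/integrable_monomialM/integrable_cell.
apply/eqP; rewrite -subr_eq0 -sub; apply/eqP.
pose S d : set T := cell g m `&` stopped_cell F (2 ^ (k + 1)) d.
have mS d : measurable (S d) by apply: measurableI => //; exact: measurable_stopped_cell.
(* Partition of the cell: index 0 is the part where [good (k + 1)] equals [u], the others are its
   intersections with the stopping cells of the next level. *)
pose W (j : nat) : set T := if j is j'.+1 then enum_sets S j'
  else cell g m `&` ~` above_level F (2 ^ (k + 1)).
have mW j : measurable (W j).
  case: j => [|j]; last exact: measurable_enum_sets.
  by apply: measurableI => //; exact/measurableC/measurable_above_level.
have tS : trivIset setT S.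
  apply/trivIsetP => d d' _ _ dd'; rewrite /S setIACA.
  have /trivIsetP/(_ d d' I I dd') := @trivIset_stopped_cell R n F (2 ^ (k + 1)).
  by move=> ->; rewrite setI0.
have SL : \bigcup_d S d = cell g m `&` above_level F (2 ^ (k + 1)).
  by rewrite -(bigcup_stopped_cell vF (pow2_gt0 (k + 1))) setI_bigcupr.
have UW : \bigcup_j W j = cell g m.
  rewrite (_ : \bigcup_j W j = W 0%N `|` \bigcup_j enum_sets S j).
    by rewrite bigcup_enum_sets SL setUC -setIUr setUv setIT.
  apply/seteqP; split => [x [[|j] _ Wx]|x [Wx|[j _ Wx]]].
  - by left.
  - by right; exists j.
  - by exists 0%N.
  - by exists j.+1.
have tW : trivIset setT W.
  have W0 j x : W 0%N x -> W j.+1 x -> False.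
    move=> [_ nx] Wx; have : (\bigcup_d S d) x by rewrite -bigcup_enum_sets; exists j.
    by rewrite SL => -[].
  apply/trivIsetP => -[|i] [|j] _ _ // ij.
  - by apply/seteqP; split => // x [/W0 H /H].
  - by apply/seteqP; split => // x [H /W0 /(_ H)].
  - by have /trivIsetP := trivIset_enum_sets tS; apply.
have int0 : (\int[mu]_(x in (cell g m : set T)) (h x)%:E = 0)%E.
  rewrite -UW integral_bigcup//; last by rewrite UW.
  rewrite eseries0// => -[|j] _ _.
    rewrite (eq_integral (cst 0%E)) ?integral0// => x; rewrite inE => -[_ nx].
    by rewrite /h good_off// subrr mulr0.
  rewrite /W /enum_sets; case: pickle_inv => [d|]; last by rewrite integral_set0.
  have [->|/set0P[x [xm xd]]] := eqVneq (S d) set0; first by rewrite integral_set0.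
  have Sd : S d = cell d.1 d.2.
    rewrite /S (stopped_cellE xd); apply/setIidr; have [<- sx] := xd.
    rewrite -[m]xm; apply: cell_subset; apply: stopped_gen_le sx; last first.
      by apply: stopped_gen sx0; rewrite x0m xm.
    by rewrite lerDl.
  rewrite Sd -[LHS]fineK; last by apply: integrable_fin_num => //; exact: measurable_cell.
  congr EFin; have := sub d.1 d.2; rewrite /Rintegral => ->; apply/eqP; rewrite subr_eq0; apply/eqP.
  by apply: moment_good => //; exists x; case: xd.
by rewrite /Rintegral int0.
Qed.

Definition piece k (d : int * ix) x : R :=
  (good (k + 1) x - good k x) * \1_(stopped_cell F (2 ^ k) d) x.

Lemma piece_off k d x : ~ stopped_cell F (2 ^ k) d x -> piece k d x = 0.
Proof. by move=> nx; rewrite /piece indicE memNset// mulr0. Qed.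

Lemma piece_on k d x : stopped_cell F (2 ^ k) d x -> piece k d x = good (k + 1) x - good k x.
Proof. by move=> dx; rewrite /piece indicE mem_set// mulr1. Qed.

Lemma good_const_ge2 : 2 <= good_const. Proof. by rewrite le_max lexx. Qed.

Lemma good_diff_bound k x : `|good (k + 1) x - good k x| <= 3 * good_const * 2 ^ k.
Proof.
apply: (le_trans (ler_normB _ _)); have := good_bound k x; have := good_bound (k + 1) x.
rewrite pow2S; lra.
Qed.

Lemma piece_bound k d x : `|piece k d x| <= 3 * good_const * 2 ^ k.
Proof.
have [dx|ndx] := pselect (stopped_cell F (2 ^ k) d x).
  by rewrite piece_on//; exact: good_diff_bound.
rewrite piece_off// normr0 mulr_ge0 ?(ltW (pow2_gt0 k))//; have := good_const_ge2; lra.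
Qed.

Lemma measurable_piece k d : measurable_fun [set: T] (piece k d : T -> R).
Proof.
apply: measurable_funM; last exact/measurable_indic/measurable_stopped_cell.
apply: measurable_funB; exact: measurable_good.
Qed.

Lemma piece_sub_cell k d x : piece k d x != 0 -> cell d.1 d.2 x.
Proof.
move=> px; have dx : stopped_cell F (2 ^ k) d x.
  by apply: contrapT => /piece_off H; rewrite H eqxx in px.
by rewrite -(stopped_cellE dx).
Qed.

(** On a stopping cell of level [k], both [good k] and [good (k + 1)] carry the moments of [u]. *)
Lemma moment_piece k d (alpha : 'I_n.+1 -> nat) : (forall i, (alpha i <= K)%N) ->
  \int[mu]_(x in [set: T]) (monomial alpha x * piece k d x) = 0.
Proof.
move=> aK; have mc := @measurable_cell R n d.1 d.2.
have [d0|/set0P[x xd]] := eqVneq (stopped_cell F (2 ^ k) d) set0.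
  rewrite (@eq_Rintegral _ _ _ mu _ (fun=> 0)); first by rewrite /Rintegral integral0.
  by move=> x _; rewrite piece_off ?mulr0// d0.
have dE := stopped_cellE xd.
have ex : exists2 x, cell d.1 d.2 x & stopped F (2 ^ k) d.1 x by exists x; case: xd.
have -> : \int[mu]_(x in [set: T]) (monomial alpha x * piece k d x) =
  \int[mu]_(x in (cell d.1 d.2 : set T)) (monomial alpha x * good (k + 1) x - monomial alpha x * good k x).
  rewrite [RHS]Rintegral_mkcond; apply: eq_Rintegral => y _; rewrite patchE.
  case: ifPn => [|/negP]; rewrite inE -dE => yd; first by rewrite piece_on// mulrBr.
  by rewrite piece_off// mulr0.
rewrite RintegralB//; last 2 first.
  exact/integrable_monomialM/integrable_good.
  exact/integrable_monomialM/integrable_good.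
by rewrite moment_good_next// moment_good// subrr.
Qed.

End fixed_functions.

End good_functions.

(** * Sums over the stopping cells through a point *)

Section sums_over_stopping_cells.
Context {R : realType}.

Lemma sum_le_nneseries (f : nat -> R) (N : nat) (b : \bar R) : (forall j, 0 <= f j) ->
  (\sum_(j <oo) (f j)%:E <= b)%E -> ((\sum_(j < N) f j)%:E <= b)%E.
Proof.
move=> f0 fb; apply: le_trans fb; rewrite -sumEFin -(big_mkord xpredT (fun j => (f j)%:E)).
by apply: nneseries_lim_ge => j _; rewrite lee_fin.
Qed.

Context {n : nat}.
Local Notation E := 'rV[R]_n.+1.
Local Notation T := (Rn R n).
Local Notation mu := (@leb R n).
Local Notation omega := (@unit_volume R n).
Local Notation ix := 'rV[int]_n.+1.
Implicit Types (F u : E -> R) (x : E) (k : int) (d : int * ix).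

(** At each level at most one stopping cell contains [x], so the sum over cells collapses to a sum
    over levels. *)
Lemma esum_stopping_le F x (f : int * (int * ix) -> \bar R) (c : int -> \bar R) :
  vanishing_averages F -> (forall i, 0 <= f i)%E -> (forall k, 0 <= c k)%E ->
  (forall k d, f (k, d) <= if `[< stopped_cell F (2 ^ k) d x >] then c k else 0)%E ->
  (\esum_(i in [set: int * (int * ix)]) f i <=
   \esum_(k in [set: int]) (if `[< above_level F (2 ^ k) x >] then c k else 0))%E.
Proof.
move=> vF f0 c0 fc.
have -> : \esum_(i in [set: int * (int * ix)]) f i =
    \esum_(k in [set: int]) \esum_(d in [set: int * ix]) f (k, d).
  rewrite (esum_esum (J := fun=> setT) (a := fun k d => f (k, d)))//.
  rewrite (_ : _ `*`` _ = setT); first by apply: eq_esum => -[k d].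
  by apply/seteqP; split.
apply: le_esum => k _; pose g := stopping_gen F k x.
have [kx|nkx] := pselect (above_level F (2 ^ k) x); last first.
  rewrite asboolF//; apply: le_trans (_ : \esum_(d in [set: int * ix]) 0%E <= 0%E)%E.
    apply: le_esum => d _; apply: le_trans (fc k d) _; case: asboolP => // -[_ [ax _]].
    by exfalso; apply: nkx; exists d.1.
  by rewrite esum1.
rewrite asboolT// -[leRHS](esum_single (g, gen g x) (c0 k)).
apply: le_esum => d _; apply: le_trans (fc k d) _; case: asboolP => [[xd sx]|_].
  rewrite ifT//; apply/eqP; rewrite /g (stopping_genE sx) xd; by case: d {xd sx}.
by case: ifP.
Qed.

(** The levels concerned satisfy 2^k < M F(x), so the series is geometric and dominated by its top
    term: the case r = 1 of [seqnorm_truncated]. *)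
Lemma esum_above_le (v : R) : 0 < omega -> 0 < v -> exists2 C : R, 0 < C & forall F x,
  (forall y, 0 <= F y) ->
  (\esum_(k in [set: int])
     (if `[< above_level F (2 ^ k) x >] then ((2 : R) `^ (k%:~R * v))%:E else 0) <=
   C%:E * dyadic_maximal F x `^ v)%E.
Proof.
move=> w0 v0; have one0 : (0 < 1%:E :> \bar R)%E by rewrite lte_fin.
have [C C0 HC] := seqnorm_truncated one0 v0; exists C => // F x F0.
have aM k : above_level F (2 ^ k) x -> ((2 ^ k)%:E < dyadic_maximal F x)%E.
  by move=> /(lt_dyadic_maximal _ _ _ w0).
have := dyadic_maximal_ge0 x F0 w0.
case: (dyadic_maximal F x) aM => [M|_ _|//]; last first.
  by rewrite poweRyr ?gt_eqF// gt0_muley ?leey// lte_fin.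
move=> aM; rewrite lee_fin le_eqVlt => /orP[/eqP M0|M0].
  apply: (@le_trans _ _ 0%E); last by rewrite mule_ge0 ?poweR_ge0// lee_fin ltW.
  rewrite esum1// => k _; case: asboolP => // /aM; rewrite -M0 lte_fin.
  by move=> /(lt_trans (pow2_gt0 k)); rewrite ltxx.
have [k1 /andP[k1M Mk1]] := pow2_between M0.
have aK k : above_level F (2 ^ k) x -> k <= k1.
  move=> /aM; rewrite lte_fin => kM; have := lt_trans kM Mk1.
  by rewrite lt_pow2 -lezD1 lerD2r.
have := HC k1 1%:E (ltW one0); rewrite /= invr1 poweRe1; last first.
  by apply: esum_ge0 => m _; exact: poweR_ge0.
move=> H; apply: (@le_trans _ _ (C%:E * ((2 `^ (k1%:~R * v))%:E * 1%:E)))%E; last first.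
  rewrite mule1; apply: lee_wpmul2l; first by rewrite lee_fin ltW.
  rewrite lee_fin -pow2_powR; apply: ge0_ler_powR; rewrite ?nnegrE ?(ltW v0) ?(ltW M0)//.
  by rewrite ltW// pow2_gt0.
apply: le_trans H; apply: le_esum => k _; case: asboolP => [/aK -> |_].
  by rewrite mule1 poweRe1// lee_fin powR_ge0.
exact: poweR_ge0.
Qed.

(** Vanishes when the pair encodes no stopping cell; otherwise [cell_seq] would count a cell on
    which the piece is zero. *)
Definition weight F (L : R) (kd : int * (int * ix)) : R :=
  if `[< stopped_cell F (2 ^ kd.1) kd.2 !=set0 >] then L * 2 ^ kd.1 else 0.

Definition weight_seq F L (j : nat) : R := oapp (weight F L) 0 (pickle_inv j).

(** Closed cells, since [cube] asks for closed cubes; codes of no pair receive a unit cell, with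
    weight zero. *)
Definition cell_seq (j : nat) : set E :=
  oapp (fun kd : int * (int * ix) => closed_cell kd.2.1 kd.2.2) (closed_cell 0 0) (pickle_inv j).

Lemma cube_cell_seq j : cube (cell_seq j).
Proof. by rewrite /cell_seq; case: pickle_inv => [kd|]; exact: cube_closed_cell. Qed.

Lemma weight_seq_ge0 F L j : 0 <= L -> 0 <= weight_seq F L j.
Proof.
move=> L0; rewrite /weight_seq /weight; case: pickle_inv => [kd|]//=.
by case: ifP => // _; rewrite mulr_ge0// ltW// pow2_gt0.
Qed.

(** Off this null set a point of a closed cell lies in the half-open cell, so closed stopping cells
    of one level do not overlap there. *)
Definition dyadic_boundary : set E :=
  \bigcup_(d in [set: int * ix]) (closed_cell d.1 d.2 `\` cell d.1 d.2).

Lemma dyadic_boundary_null : mu dyadic_boundary = 0%E.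
Proof.
apply/eqP; rewrite eq_le measure_ge0 andbT /dyadic_boundary.
rewrite -(bigcup_enum_sets ((fun d => closed_cell d.1 d.2 `\` cell d.1 d.2) : int * ix -> set T)).
apply: le_trans (leb_bigcup_le _) _; rewrite eseries0// => j _ _; rewrite /enum_sets.
by case: pickle_inv => [d|//]; exact: closed_cell_boundary.
Qed.

Lemma weight_sum_bound (v : R) : 0 < omega -> 0 < v -> exists2 C : R, 0 < C & forall F L x,
  0 < L -> (forall y, 0 <= F y) -> vanishing_averages F -> ~ dyadic_boundary x ->
  ((\sum_(j <oo) ((weight_seq F L j * \1_(cell_seq j) x) `^ v)%:E) `^ v^-1 <=
   (C * L)%:E * dyadic_maximal F x)%E.
Proof.
move=> w0 v0; have [C C0 HC] := esum_above_le w0 v0.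
(* The sum of v-th powers is at most L^v C times the v-th power of the maximal function; the
   constant is the v-th root of [C]. *)
exists (C `^ v^-1); first exact: powR_gt0.
move=> F L x L0 F0 vF nB; have M0 := dyadic_maximal_ge0 x F0 w0.
pose f (kd : int * (int * ix)) : \bar R :=
  ((weight F L kd * \1_(closed_cell kd.2.1 kd.2.2) x) `^ v)%:E.
have -> : (\sum_(j <oo) ((weight_seq F L j * \1_(cell_seq j) x) `^ v)%:E =
    \sum_(j <oo) oapp f 0 (pickle_inv j))%E.
  apply: eq_eseriesr => j _; rewrite /weight_seq /cell_seq; case: pickle_inv => [kd|]//=.
  by rewrite mul0r powR0// gt_eqF.
have f0 i : (0 <= f i)%E by rewrite lee_fin powR_ge0.
rewrite nneseries_pickle//.
have sumf : (\esum_(i in [set: int * (int * ix)]) f i <=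
    (L `^ v * C)%:E * dyadic_maximal F x `^ v)%E.
  apply: le_trans (esum_stopping_le (x := x) (c := fun k => (L `^ v)%:E * (2 `^ (k%:~R * v))%:E)%E vF f0 _ _) _.
  - by move=> k; rewrite mule_ge0// lee_fin powR_ge0.
  - move=> k d; rewrite /f /weight /=.
    have [xd|nxd] := pselect (closed_cell d.1 d.2 x); last first.
      rewrite indicE memNset// mulr0 powR0 ?gt_eqF//.
      by case: ifP => // _; rewrite mule_ge0// lee_fin powR_ge0.
    rewrite indicE mem_set// mulr1; have xd' : cell d.1 d.2 x.
      by apply: contrapT => nx; apply: nB; exists d.
    case: asboolP => [[y /stopped_cellE dE]|_]; last first.
      by rewrite powR0 ?gt_eqF//; case: ifP => // _; rewrite mule_ge0// lee_fin powR_ge0.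
    rewrite asboolT ?dE// powRM ?(ltW L0) ?(ltW (pow2_gt0 _))// pow2_powR EFinM.
    exact: lexx.
  - rewrite EFinM -muleA; apply: (@le_trans _ _ ((L `^ v)%:E * \esum_(k in [set: int])
      (if `[< above_level F (2 ^ k) x >] then ((2 : R) `^ (k%:~R * v))%:E else 0))%E).
      apply: (@le_trans _ _ (\esum_(k in [set: int]) ((L `^ v)%:E *
        (if `[< above_level F (2 ^ k) x >] then ((2 : R) `^ (k%:~R * v))%:E else 0))%E)).
        by apply: le_esum => k _; case: ifP => // _; rewrite mule0.
      apply: esumZ_le; first exact: powR_ge0.
      by move=> k; case: ifP => // _; rewrite lee_fin powR_ge0.
    by apply: lee_wpmul2l; [rewrite lee_fin powR_ge0|exact: HC].
apply: (@le_trans _ _ (((L `^ v * C)%:E * dyadic_maximal F x `^ v) `^ v^-1)%E).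
  apply: le_poweR; [by rewrite invr_ge0 ltW|by apply: esum_ge0 => i _|exact: sumf].
rewrite poweRM ?poweR_ge0 ?lee_fin ?mulr_ge0 ?powR_ge0 ?(ltW C0)// poweRK//.
rewrite EFinM poweRM ?lee_fin ?powR_ge0 ?(ltW C0)// -poweR_EFin poweRK ?lee_fin ?(ltW L0)//.
by rewrite poweR_EFin -EFinM mulrC.
Qed.

End sums_over_stopping_cells.

(** * Convergence of the series of pieces *)

Section series_of_pieces.
Context {R : realType} {n : nat} (K : nat).
Local Notation E := 'rV[R]_n.+1.
Local Notation T := (Rn R n).
Local Notation mu := (@leb R n).
Local Notation omega := (@unit_volume R n).
Local Notation ix := 'rV[int]_n.+1.
Local Notation good_const := (@good_const R n K).
Variables (F u : E -> R).
Hypotheses (w0 : 0 < omega) (F0 : forall x, 0 <= F x).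
Hypotheses (mF : measurable_fun [set: T] (F : T -> R)) (measurable_u : measurable_fun [set: T] (u : T -> R)).
Hypotheses (vF : vanishing_averages F) (uF : forall x, `|u x| <= F x).
Hypothesis F_le : forall x, ((F x)%:E <= 2%:E * dyadic_maximal F x)%E.
Hypothesis F_loc : forall g m, (integral_cell F g m < +oo)%E.
Implicit Types (x : E) (k : int) (d : int * ix).

Let pc (kd : int * (int * ix)) x : R := piece K F u kd.1 kd.2 x.

Definition piece_seq (j : nat) x : R := oapp (fun kd => pc kd x) 0 (pickle_inv j).

Let C3 := 3 * good_const.
Let C30 : 0 < C3.
Proof. by rewrite mulr_gt0//; have := good_const_ge2 (R := R) (n := n) K; lra. Qed.

(** The exponent v = 1 of [esum_above_le], applied to absolute values so as to bound all partial
    sums at once. *)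
Lemma piece_seq_sum_bound : exists2 C : R, 0 < C & forall N x,
  ((\sum_(j < N) `|piece_seq j x|)%:E <= (C * C3)%:E * dyadic_maximal F x)%E.
Proof.
have [C C0 HC] := @esum_above_le R n 1 w0 ltr01; exists C => // N x.
have M0 := dyadic_maximal_ge0 x F0 w0.
apply: (sum_le_nneseries (f := fun j => `|piece_seq j x|)) => //.
have -> : (\sum_(j <oo) `|piece_seq j x|%:E =
    \sum_(j <oo) oapp (fun kd => `|pc kd x|%:E) 0 (pickle_inv j))%E.
  by apply: eq_eseriesr => j _; rewrite /piece_seq; case: pickle_inv => //=; rewrite normr0.
rewrite nneseries_pickle => [|i]; last by rewrite lee_fin.
apply: le_trans (esum_stopping_le (x := x) (c := fun k => C3%:E * (2 `^ (k%:~R * 1))%:E)%E vF _ _ _) _.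
- by move=> i; rewrite lee_fin.
- by move=> k; rewrite mule_ge0// lee_fin ?powR_ge0// ltW.
- move=> k d; case: asboolP => [dx|ndx]; last by rewrite /pc piece_off// normr0.
  by rewrite mulr1 powR_intmul// -EFinM lee_fin; exact: piece_bound.
- rewrite (_ : (C * C3)%:E * _ = C3%:E * (C%:E * dyadic_maximal F x))%E; last first.
    by rewrite muleA -EFinM mulrC.
  apply: (@le_trans _ _ (C3%:E * \esum_(k in [set: int])
      (if `[< above_level F (2 ^ k) x >] then ((2 : R) `^ (k%:~R * 1))%:E else 0))%E).
    apply: (@le_trans _ _ (\esum_(k in [set: int]) (C3%:E *
      (if `[< above_level F (2 ^ k) x >] then ((2 : R) `^ (k%:~R * 1))%:E else 0))%E)).
      by apply: le_esum => k _; case: ifP => // _; rewrite mule0.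
    apply: esumZ_le; first exact: ltW.
    by move=> k; case: ifP => // _; rewrite lee_fin powR_ge0.
  apply: lee_wpmul2l; first by rewrite lee_fin ltW.
  by have := HC F x F0; rewrite poweRe1.
Qed.

Let delta k x : R := good K F u (k + 1) x - good K F u k x.

Let delta_off k x : ~ above_level F (2 ^ k) x -> delta k x = 0.
Proof.
move=> nkx; rewrite /delta !good_off ?subrr// => kx; apply: nkx.
by apply: above_level_mono kx; rewrite lerDl.
Qed.

(** The code of the only pair of level [k] whose piece can be nonzero at [x]. *)
Let kappa x k : nat := pickle (k, (stopping_gen F k x, gen (stopping_gen F k x) x)).

(** Keeps the levels from [m] on, finitely many of which matter at a point where the maximal
    function is finite; the discarded ones are uniformly small. *)
Let pcm (m : int) (j : nat) x : R :=
  oapp (fun kd : int * (int * ix) => if m <= kd.1 then pc kd x else 0) 0 (pickle_inv j).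

(* Levels [m <= k < m + I] contribute finitely many terms, which telescope. *)
Let pcmE m (I : nat) j x : (forall k, m + I%:Z <= k -> ~ above_level F (2 ^ k) x) ->
  pcm m j x = \sum_(i < I) (if j == kappa x (m + i%:Z) then delta (m + i%:Z) x else 0).
Proof.
move=> above_lt; rewrite /pcm.
have kinj i : j = kappa x (m + i%:Z) -> pickle_inv j =
    Some (m + i%:Z, (stopping_gen F (m + i%:Z) x, gen (stopping_gen F (m + i%:Z) x) x)).
  by move=> ->; rewrite /kappa pickleK_inv.
have := pickle_invK (T := (int * (int * ix))%type) j.
case pj : (pickle_inv j) => [[k d]|] /= kdj; last first.
  rewrite big1// => i _; case: eqP => // /kinj; by rewrite pj.
have [[mk dx]|H] := pselect (m <= k /\ stopped_cell F (2 ^ k) d x); last first.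
  have -> : (if m <= k then pc (k, d) x else 0) = 0.
    by case: ifP => // mk; rewrite /pc piece_off// => dx; apply: H.
  rewrite big1// => i _; case: eqP => // /kinj; rewrite pj => -[kE dE]; rewrite -kE.
  apply: delta_off => ax; apply: H; split; first by rewrite kE lerDl.
  by rewrite dE -kE; split => //; exact: stopping_genP.
have kI : k < m + I%:Z.
  by rewrite ltNge; apply/negP => /above_lt; apply; exists d.1; case: dx => _ [].
have iI : (`|(k - m)%R|%N < I)%N by lia.
have kE : m + `|(k - m)%R|%N%:Z = k by lia.
have dE : d = (stopping_gen F k x, gen (stopping_gen F k x) x).
  by case: (dx) => xd sx; rewrite (stopping_genE sx) xd -surjective_pairing.
rewrite (bigD1 (Ordinal iI))//= kE mk /pc piece_on// big1 => [|i ne]; last first.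
  case: eqP => // /kinj; rewrite pj => -[kE' _]; exfalso; move/eqP: ne; apply.
  by apply: val_inj => /=; rewrite kE'; lia.
by rewrite addr0 ifT// /kappa -dE kdj.
Qed.

(** Past the largest of the finitely many relevant codes, every partial sum contains all the
    differences and telescopes; at the top level [good] is [u], since [x] is off the level set. *)
Let pcm_partial m (I : nat) x : (forall k, m + I%:Z <= k -> ~ above_level F (2 ^ k) x) ->
  exists N0 : nat, forall N, (N0 <= N)%N ->
  \sum_(j < N) pcm m j x = u x - good K F u m x.
Proof.
move=> aI; exists (\max_(i < I) (kappa x (m + i%:Z)).+1)%N => N N0N.
rewrite (eq_bigr _ (fun (j : 'I_N) _ => pcmE j aI)) exchange_big/=.
have -> : \sum_(i < I) \sum_(j < N) (if (j : nat) == kappa x (m + i%:Z) then delta (m + i%:Z) x else 0) =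
    \sum_(i < I) (good K F u (m + i.+1%:Z) x - good K F u (m + i%:Z) x).
  apply: eq_bigr => i _; have iN : (kappa x (m + i%:Z) < N)%N.
    by apply: leq_trans N0N; exact: (leq_bigmax i).
  rewrite (bigD1 (Ordinal iN))//= eqxx big1 => [|j ne]; last first.
    by case: eqP => // e; exfalso; move/eqP: ne; apply; apply: val_inj.
  by rewrite addr0 /delta (_ : m + i%:Z + 1 = m + i.+1%:Z)//; lia.
rewrite -(big_mkord xpredT (fun i => good K F u (m + i.+1%:Z) x - good K F u (m + i%:Z) x)).
rewrite telescope_sumr// addr0 good_off//.
exact: aI.
Qed.

(** Each level [k] below [m] contributes at most [C3 * 2 ^ k] at a given point; the sum is
    geometric, hence of order [2 ^ m] uniformly in [N] and [x]. *)
Let low_levels : exists2 C : R, 0 < C & forall (m : int) N x,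
  \sum_(j < N) `|piece_seq j x - pcm m j x| <= C * 2 ^ m.
Proof.
have one0 : (0 < 1%:E :> \bar R)%E by rewrite lte_fin.
have [C C0 HC] := seqnorm_truncated one0 (ltr01 : 0 < 1 :> R).
exists (C3 * C); first exact: mulr_gt0.
move=> m N x; rewrite -lee_fin.
apply: (sum_le_nneseries (f := fun j => `|piece_seq j x - pcm m j x|)) => //.
pose f (kd : int * (int * ix)) : \bar R := (if m <= kd.1 then 0 else `|pc kd x|)%:E.
have -> : (\sum_(j <oo) `|piece_seq j x - pcm m j x|%:E =
    \sum_(j <oo) oapp f 0 (pickle_inv j))%E.
  apply: eq_eseriesr => j _; rewrite /piece_seq /pcm; case: pickle_inv => [kd|]/=.
    by rewrite /f; case: ifP; rewrite ?subrr ?subr0 ?normr0.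
  by rewrite subrr normr0.
have f0 i : (0 <= f i)%E by rewrite /f lee_fin; case: ifP.
rewrite nneseries_pickle//.
pose c k : \bar R := (if (k <= m)%R then (2 `^ (k%:~R * 1))%:E * C3%:E else 0)%E.
have c0 k : (0 <= c k)%E.
  by rewrite /c; case: ifP => // _; rewrite mule_ge0// lee_fin ?powR_ge0// ltW.
apply: le_trans (esum_stopping_le (x := x) (c := c) vF f0 c0 _) _.
  move=> k d; rewrite /f /c /=; case: asboolP => [dx|ndx]; last first.
    by rewrite /pc piece_off// normr0 if_same.
  have [mk|km] := leP m k; first exact: c0.
  rewrite (ltW km) mulr1 powR_intmul// -EFinM lee_fin mulrC; exact: piece_bound.
apply: (@le_trans _ _ (\esum_(k in [set: int]) c k)).
  by apply: le_esum => k _; case: ifP.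
have := HC m C3%:E; rewrite lee_fin => /(_ (ltW C30)); rewrite /= invr1 poweRe1; last first.
  by apply: esum_ge0 => k _; exact: poweR_ge0.
rewrite mulr1 powR_intmul// -!EFinM (_ : C3 * C * 2 ^ m = C * (2 ^ m * C3)); last by ring.
apply: le_trans; apply: le_esum => k _; rewrite -/(c k) poweRe1//.
Qed.

(** For large [N] the error consists of [good m x] and the levels below [m], both of order [2 ^ m],
    and [m] can be taken as negative as desired. *)
Lemma piece_series x : (dyadic_maximal F x < +oo)%E ->
  \sum_(j < N) piece_seq j x @[N --> \oo] --> u x.
Proof.
move=> Moo; have M0 := dyadic_maximal_ge0 x F0 w0.
have [M ME] : exists M, dyadic_maximal F x = M%:E.
  by exists (fine (dyadic_maximal F x)); rewrite fineK// ge0_fin_numE.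
have [k1 Mk1] := pow2_above M.
have nabove k : k1 <= k -> ~ above_level F (2 ^ k) x.
  move=> k1k /(lt_dyadic_maximal _ _ _ w0); rewrite ME lte_fin => kM.
  by have := lt_trans kM Mk1; rewrite lt_pow2 ltNge k1k.
have [C C0 HC] := low_levels.
apply/cvgrPdist_le => e e0.
have Cg0 : 0 < C + good_const by rewrite addr_gt0//; have := good_const_ge2 (R := R) (n := n) K; lra.
have [m0 me] := pow2_below (divr_gt0 e0 Cg0).
pose m := Num.min m0 k1.
have mm0 : (2 : R) ^ m <= 2 ^ m0 by rewrite le_pow2 ge_min lexx.
have mk1 : m <= k1 by rewrite ge_min lexx orbT.
have mI : m + `|(k1 - m)%R|%N%:Z = k1 by rewrite gez0_abs ?subr_ge0// addrC subrK.
have [N0 HN0] := @pcm_partial m `|(k1 - m)%R|%N x (fun k H => nabove k (eq_rect _ (fun z => z <= k) H _ mI)).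
exists N0 => // N /= N0N.
have -> : u x - \sum_(j < N) piece_seq j x =
    good K F u m x - \sum_(j < N) (piece_seq j x - pcm m j x).
  by rewrite sumrB HN0//; ring.
apply: (le_trans (ler_normB _ _)).
apply: (@le_trans _ _ (good_const * 2 ^ m + C * 2 ^ m)).
  apply: lerD; first exact: good_bound.
  by apply: le_trans (ler_norm_sum _ _ _) _; exact: HC.
rewrite -mulrDl addrC mulrC -ler_pdivlMr//; apply: (le_trans mm0); exact: ltW.
Qed.

End series_of_pieces.

(** * The modulus of complex numbers *)

Section complex_modulus.
Context {R : realType}.
Local Notation normc := ComplexField.Normc.normc.
Local Notation Re := (@complex.Re R).
Local Notation Im := (@complex.Im R).
Implicit Types z w : R[i].

Lemma normc_sqrtE z : normc z = Num.sqrt (Re z ^+ 2 + Im z ^+ 2).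
Proof. by case: z. Qed.

Lemma normc_ge0 z : 0 <= normc z.
Proof. by rewrite normc_sqrtE sqrtr_ge0. Qed.

Lemma Re_le_normc z : `|Re z| <= normc z.
Proof. by rewrite normc_sqrtE -sqrtr_sqr ler_wsqrtr// lerDl sqr_ge0. Qed.

Lemma Im_le_normc z : `|Im z| <= normc z.
Proof. by rewrite normc_sqrtE -sqrtr_sqr ler_wsqrtr// lerDr sqr_ge0. Qed.

Lemma normc_le z : normc z <= `|Re z| + `|Im z|.
Proof.
rewrite normc_sqrtE -[leRHS]ger0_norm ?addr_ge0// -sqrtr_sqr ler_wsqrtr//.
by rewrite sqrrD !real_normK ?num_real// lerD2r lerDl mulrn_wge0// mulr_ge0.
Qed.

Lemma complex_ReM z w : Re (z * w) = Re z * Re w - Im z * Im w.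
Proof. by case: z => a b; case: w. Qed.

Lemma complex_ImM z w : Im (z * w) = Re z * Im w + Im z * Re w.
Proof. by case: z => a b; case: w. Qed.

Lemma complex_ReD z w : Re (z + w) = Re z + Re w.
Proof. by case: z => a b; case: w. Qed.

Lemma complex_ImD z w : Im (z + w) = Im z + Im w.
Proof. by case: z => a b; case: w. Qed.

End complex_modulus.

Section measurable_square_roots.
Context {R : realType} d {S : measurableType d}.

Lemma measurable_sqrt (h : S -> R) : measurable_fun [set: S] h ->
  measurable_fun [set: S] (fun x => Num.sqrt (h x)).
Proof.
have ms : measurable_fun [set: R] (@Num.sqrt R).
  by apply: nondecreasing_measurable => // a b ab; exact: ler_wsqrtr.
exact: measurableT_comp ms.
Qed.

Lemma measurable_sqrt_sum_sqr (I : finType) (f : I -> S -> R) :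
  (forall i, measurable_fun [set: S] (f i)) ->
  measurable_fun [set: S] (fun x => Num.sqrt (1 + \sum_i f i x ^+ 2)).
Proof.
move=> mf; apply: measurable_sqrt; apply: measurable_funD; first exact: measurable_cst.
by apply: measurable_sum => i; exact: measurable_funX.
Qed.

End measurable_square_roots.

(** * Measurability of continuous functions; integrability against a decaying weight *)

Section measurability_on_Rn.
Context {R : realType} {n : nat}.
Local Notation E := 'rV[R]_n.+1.
Local Notation T := (Rn R n).
Local Notation mu := (@leb R n).
Local Notation omega := (@unit_volume R n).
Local Notation normc := ComplexField.Normc.normc.
Local Notation ix := 'rV[int]_n.+1.
Implicit Types (x y : E).

(** Balls of row vectors are those of the maximum norm, so small cells through a point of [U] fit
    inside [U]; countably many cells therefore fill it. *)
Lemma measurable_open (U : set E) : open U -> measurable (U : set T).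
Proof.
move=> oU.
pose D (d : int * ix) : set T := if `[< cell d.1 d.2 `<=` U >] then cell d.1 d.2 else set0.
have -> : U = \bigcup_d D d.
  apply/seteqP; split => [x Ux|x [d _]]; last by rewrite /D; case: asboolP => // H /H.
  have /nbhs_ballP[e /= e0 xeU] := open_nbhs_nbhs (conj oU Ux).
  have [g ge] := pow2_below e0; exists (g, gen g x) => //; rewrite /D asboolT//= => y yx.
  apply: xeU; split => // i j; rewrite (ord1 i) /ball/= distrC.
  exact: le_lt_trans (cell_near yx j) ge.
apply: measurable_bigcup_countable => d; rewrite /D; case: ifP => // _; exact: measurable_cell.
Qed.

Lemma continuous_measurable_Rn (h : E -> R) : continuous h ->
  measurable_fun [set: T] (h : T -> R).
Proof.
move=> ch; apply: (measurability (@RGenOInfty.G R)) => [|/= _ [_] [c] -> <-].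
  exact: RGenOInfty.measurableE.
rewrite setTI; apply: measurable_open; apply: open_comp; first by move=> x _; exact: ch.
rewrite (_ : [set` _] = [set y | c < y]); first exact: open_gt.
by apply/seteqP; split => y /=; rewrite in_itv/= andbT.
Qed.

Lemma bracket_ge1 x : 1 <= japanese_bracket x.
Proof.
rewrite /japanese_bracket -[X in X <= _]sqrtr1 ler_wsqrtr// lerDl.
by apply: sumr_ge0 => i _; exact: sqr_ge0.
Qed.

Lemma bracket_gt0 x : 0 < japanese_bracket x.
Proof. exact: lt_le_trans (bracket_ge1 x). Qed.

Lemma bracket_ge_coord x i : `|x 0 i| <= japanese_bracket x.
Proof.
rewrite /japanese_bracket -sqrtr_sqr ler_wsqrtr// (bigD1 i)//= addrCA lerDl addr_ge0//.
by apply: sumr_ge0 => j _; exact: sqr_ge0.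
Qed.

Lemma measurable_bracket : measurable_fun [set: T] (japanese_bracket : T -> R).
Proof.
have H := measurable_sqrt_sum_sqr (f := fun i (x : T) => (x : E) 0 i) (@measurable_coordinate R n).
exact H.
Qed.

Lemma bracket_bounded_cell g m : exists B : R, forall x, cell g m x -> japanese_bracket x <= B.
Proof.
pose b i := `|@corner R n g m 0 i| + 2 ^ g.
exists (Num.sqrt (1 + \sum_i b i ^+ 2)) => x /cellP xm.
rewrite /japanese_bracket ler_wsqrtr// lerD2l; apply: ler_sum => i _.
rewrite -[X in X <= _]real_normK ?num_real// lerXn2r ?nnegrE//.
  by rewrite addr_ge0// ltW// pow2_gt0.
have /andP[a1 /ltW a2] := xm i; rewrite /b; have p0 := @pow2_gt0 R g.
have : - `|@corner R n g m 0 i| <= @corner R n g m 0 i <= `|@corner R n g m 0 i| by rewrite -ler_norml.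
by move=> /andP[? ?]; rewrite ler_norml; apply/andP; split; lra.
Qed.

Definition bracket_weight (N : nat) x : R := (japanese_bracket x ^+ N)^-1.

Lemma bracket_weight_gt0 N x : 0 < bracket_weight N x.
Proof. by rewrite invr_gt0 exprn_gt0// bracket_gt0. Qed.

Lemma bracket_weight_le1 N x : bracket_weight N x <= 1.
Proof. by rewrite invf_le1 ?exprn_gt0 ?bracket_gt0// exprn_ege1// bracket_ge1. Qed.

Lemma measurable_bracket_weight N : measurable_fun [set: T] (bracket_weight N : T -> R).
Proof.
rewrite (_ : bracket_weight N = fun x => ((japanese_bracket x) `^ (- N%:R))).
  exact/(measurableT_comp (measurable_powR _))/measurable_bracket.
by apply/funext => x; rewrite powRN powR_mulrn// ltW// bracket_gt0.
Qed.

Let Qj (j : nat) : set E := box (const_mx (- 2 ^ j%:Z)) (const_mx (- 2 ^ j%:Z) + const_mx (2 ^ (j%:Z + 1))).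

Let QjP j x : (forall i, `|x 0 i| <= 2 ^ j%:Z) -> Qj j x.
Proof.
move=> H i; rewrite !mxE pow2S; have := H i; rewrite ler_norml => /andP[? ?].
by apply/andP; split; lra.
Qed.

(** One more than the dimension: the margin that makes the final series geometric of ratio 1/2. *)
Local Notation N0 := n.+2.

(* With [Q_j] the cube of side [2^(j+1)] centred at 0, the weight is at most
   [\sum_j 2^(N0(1-j)) 1_(Q_j)]; the integral over [Q_j] grows like [2^(j(n+1))]. *)
Let weight_le x : exists j : nat, Qj j x /\ bracket_weight N0 x <= 2 ^+ N0 * (2^-1 ^+ j) ^+ N0.
Proof.
have [j0 Hj0] : exists j0 : nat, forall i, `|x 0 i| <= 2 ^ j0%:Z.
  have [g Hg] := pow2_above (japanese_bracket x); exists `|g|%N => i.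
  apply: (le_trans (bracket_ge_coord x i)); apply: (le_trans (ltW Hg)).
  by rewrite le_pow2; lia.
have ex : exists j, `[< forall i, `|x 0 i| <= 2 ^ j%:Z >] by exists j0; apply/asboolP.
case: (ex_minnP ex) => -[|j] /asboolP Hj jmin.
  exists 0%N; split; first exact: QjP.
  rewrite expr0 expr1n mulr1; apply: (le_trans (bracket_weight_le1 _ _)).
  by rewrite exprn_ege1// ler1n.
exists j.+1; split; first exact: QjP.
have [i Hi] : exists i, 2 ^ j%:Z < `|x 0 i|.
  apply: contrapT => H; suff : (j.+1 <= j)%N by rewrite ltnn.
  apply: jmin; apply/asboolP => i; rewrite leNgt; apply/negP => Hi; apply: H; by exists i.
have jx : 2 ^ j%:Z <= japanese_bracket x.
  by apply: (le_trans (ltW Hi)); exact: bracket_ge_coord.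
have p0 := @pow2_gt0 R j%:Z.
apply: (@le_trans _ _ (((2 ^ j%:Z) ^+ N0)^-1)).
  by rewrite lef_pV2 ?posrE ?exprn_gt0 ?bracket_gt0// lerXn2r ?nnegrE ?(ltW p0)// ltW// bracket_gt0.
by rewrite -exprMn [2^-1 ^+ j.+1]exprS mulrA mulfV// mul1r -exprnP -!exprVn.
Qed.

Lemma integral_morrey_bracket p q (r : \bar R) (g : E -> \bar R) :
  0 < omega -> 1 < q -> q <= p -> (0 < r)%E ->
  measurable_fun [set: T] (g : T -> \bar R) -> (forall x, 0 <= g x)%E ->
  (morrey_lorentz_norm p q r g < +oo)%E ->
  (\int[mu]_x (g x * (bracket_weight N0 x)%:E) < +oo)%E.
Proof.
move=> w0 q1 qp r0 mg g0 Moo.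
have [C C0 HC] := integral_cube_morrey (n := n) p q1 r0.
have [M ME] : exists M, morrey_lorentz_norm p q r g = M%:E.
  by exists (fine (morrey_lorentz_norm p q r g)); rewrite fineK// ge0_fin_numE// morrey_lorentz_ge0.
have M0 : 0 <= M by rewrite -lee_fin -ME morrey_lorentz_ge0.
pose V j := (2 ^ (j%:Z + 1)) ^+ n.+1 * omega.
have V0 j : 0 < V j by rewrite mulr_gt0// exprn_gt0// pow2_gt0.
have QV j : mu (Qj j) = (V j)%:E by exact/leb_cube/pow2_gt0.
have mQ j : measurable (Qj j : set T) by exact: measurable_box.
have p1 : p^-1 <= 1 by rewrite invf_le1 ?(le_trans (ltW q1) qp)// (lt_le_trans _ qp)// (lt_trans _ q1).
have p0 : 0 < p by rewrite (lt_le_trans _ qp)// (lt_trans _ q1).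
(* V^(1 - 1/p) is at most 1 + V because the exponent lies between 0 and 1; [D] absorbs the 1, as
   [2 ^ j] is at least 1. *)
pose D := 1 + 2 ^+ n.+1 * omega.
have D0 : 0 <= D by rewrite addr_ge0// mulr_ge0 ?exprn_ge0// ltW.
have intQ j : (\int[mu]_(x in (Qj j : set T)) g x <= (C * D * M * (2 ^ j%:Z) ^+ n.+1)%:E)%E.
  have := HC g (Qj j) (V j) mg g0 (cube_box _ (pow2_gt0 _)) (QV j) (V0 j).
  rewrite ME => /le_trans; apply; rewrite -EFinM lee_fin.
  have VD : V j `^ (1 - p^-1) <= D * (2 ^ j%:Z) ^+ n.+1.
    have pj1 : 1 <= (2 ^ j%:Z) ^+ n.+1 :> R by rewrite exprn_ege1// -exprnP exprn_ege1// ler1n.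
    apply: (@le_trans _ _ (1 + V j)); last first.
      rewrite /V pow2S exprMn /D mulrDl mul1r [X in _ <= _ + X]mulrAC; apply: lerD => //.
    have s0 : 0 <= 1 - p^-1 by rewrite subr_ge0.
    have s1 : 1 - p^-1 <= 1 by rewrite gerDl oppr_le0 invr_ge0 ltW.
    have [V1|/ltW V1] := leP 1 (V j).
      apply: (@le_trans _ _ (V j)); last by rewrite lerDr.
      by rewrite -[leRHS]powRr1 ?(ltW (V0 j))// ler_powR.
    apply: (@le_trans _ _ 1); last by rewrite lerDl ltW.
    apply: (@le_trans _ _ (1 `^ (1 - p^-1))); last by rewrite powR1.
    by apply: ge0_ler_powR; rewrite ?nnegrE// ltW.
  apply: (@le_trans _ _ (C * (D * (2 ^ j%:Z) ^+ n.+1) * M)).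
    by apply: ler_wpM2r => //; apply: ler_wpM2l => //; exact: ltW.
  by rewrite le_eqVlt; apply/orP; left; apply/eqP; ring.
pose c j : R := 2 ^+ N0 * (2^-1 ^+ j) ^+ N0.
have c0 j : 0 <= c j by rewrite mulr_ge0// !exprn_ge0.
pose h j x : \bar R := ((c j)%:E * (g x * (\1_(Qj j) x)%:E))%E.
have h0 j x : (0 <= h j x)%E by rewrite !mule_ge0// lee_fin.
have mh j : measurable_fun [set: T] (h j : T -> \bar R).
  have H := measurable_mul_indic mg (mQ j).
  exact: (measurable_funeM (c j)%:E H).
apply: (@le_lt_trans _ _ (\int[mu]_x (\sum_(j <oo) h j x))%E).
  apply: ge0_le_integral_any => x _; first by rewrite mule_ge0// lee_fin ltW// bracket_weight_gt0.
  have [j [Qx jx]] := weight_le x.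
  apply: le_trans (le_nneseries_term (a := h^~ x) j (h0^~ x)).
  rewrite /h indicE mem_set// mule1 muleC; apply: lee_wpmul2r => //; by rewrite lee_fin.
rewrite integral_nneseries//.
apply: (@le_lt_trans _ _ (\sum_(j <oo) ((2^-1 : R) ^+ j)%:E * (2 ^+ N0 * (C * D * M))%:E)%E).
  apply: lee_nneseries => [j _ _|j _]; first by apply: integral_ge0 => x _.
  have gQ0 x : [set: T] x -> (0 <= g x * (\1_(Qj j) x)%:E)%E by move=> _; rewrite mule_ge0// lee_fin.
  rewrite (ge0_integralZl_EFin mu measurableT gQ0 (measurable_mul_indic mg (mQ j)) (c0 j)).
  rewrite -integral_restrict//; apply: le_trans (lee_wpmul2l _ (intQ j)) _; first by rewrite lee_fin.
  rewrite -!EFinM lee_fin /c le_eqVlt; apply/orP; left; apply/eqP.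
  rewrite -exprnP [(_ ^+ j) ^+ N0]exprS.
  have e1 : (2^-1 ^+ j) ^+ n.+1 * (2 ^+ j) ^+ n.+1 = 1 :> R.
    by rewrite -exprMn -exprMn mulVf// !expr1n.
  have -> : 2 ^+ N0 * (2^-1 ^+ j * (2^-1 ^+ j) ^+ n.+1) * (C * D * M * (2 ^+ j) ^+ n.+1) =
    2 ^+ N0 * 2^-1 ^+ j * (C * D * M) * ((2^-1 ^+ j) ^+ n.+1 * (2 ^+ j) ^+ n.+1) :> R by ring.
  by rewrite e1; ring.
have K0 : 0 <= 2 ^+ N0 * (C * D * M).
  apply: mulr_ge0; first exact: exprn_ge0.
  by apply: mulr_ge0 => //; apply: mulr_ge0 => //; exact: ltW.
rewrite geometric_eseriesZ; [by rewrite -EFinM ltry|lra|].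
exact: K0.
Qed.

End measurability_on_Rn.

(** * Functions as tempered distributions *)

Section tempered_functions.
Context {R : realType} {n : nat}.
Local Notation E := 'rV[R]_n.+1.
Local Notation T := (Rn R n).
Local Notation mu := (@leb R n).
Local Notation normc := ComplexField.Normc.normc.
Local Notation Re := (@complex.Re R).
Local Notation Im := (@complex.Im R).
Implicit Types (f h phi psi : E -> R[i]) (x : E) (G : E -> \bar R).

Lemma integrable_le G (u : E -> R) : measurable_fun [set: T] (u : T -> R) ->
  (forall x, (`|u x|%:E <= G x)%E) -> (\int[mu]_x G x < +oo)%E ->
  mu.-integrable [set: T] (EFin \o u).
Proof.
move=> mu' uG Goo; apply/integrableP; split; first exact/measurable_EFinP.
by apply: le_lt_trans Goo; apply: ge0_le_integral_any => x _; rewrite ?lee_fin//=.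
Qed.

Lemma cmeasurable_mul f h : cmeasurable f -> cmeasurable h -> cmeasurable (fun x => f x * h x).
Proof.
move=> [f1 f2] [h1 h2]; split.
  apply: (eq_measurable_fun ((fun x : T => Re (f x) * Re (h x) - Im (f x) * Im (h x)) : T -> R)).
    by move=> x _; rewrite /= complex_ReM.
  exact: (measurable_funB (measurable_funM f1 h1) (measurable_funM f2 h2)).
apply: (eq_measurable_fun ((fun x : T => Re (f x) * Im (h x) + Im (f x) * Re (h x)) : T -> R)).
  by move=> x _; rewrite /= complex_ImM.
exact: (measurable_funD (measurable_funM f1 h2) (measurable_funM f2 h1)).
Qed.

Lemma measurable_normc f : cmeasurable f -> measurable_fun [set: T] (fun x : T => normc (f x)).
Proof.
move=> [f1 f2].
apply: (eq_measurable_fun (fun x : T => Num.sqrt (Re (f x) ^+ 2 + Im (f x) ^+ 2))).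
  by move=> x _; rewrite normc_sqrtE.
exact: (measurable_sqrt (measurable_funD (measurable_funX 2 f1) (measurable_funX 2 f2))).
Qed.

Lemma cintegrable_le G h : cmeasurable h -> (forall x, ((normc (h x))%:E <= G x)%E) ->
  (\int[mu]_x G x < +oo)%E -> cintegrable h.
Proof.
move=> [h1 h2] hG Goo; split; apply: integrable_le Goo => // x; apply: le_trans (hG x);
  by rewrite lee_fin /= ?Re_le_normc ?Im_le_normc.
Qed.

Lemma cintegrable_linear (c : R[i]) h1 h2 : cintegrable h1 -> cintegrable h2 ->
  cintegrable (fun x => c * h1 x + h2 x).
Proof.
have lin (u v w : E -> R) (a b : R) : mu.-integrable [set: T] (EFin \o u) ->
    mu.-integrable [set: T] (EFin \o v) -> mu.-integrable [set: T] (EFin \o w) ->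
    mu.-integrable [set: T] (EFin \o (fun x => a * u x + b * v x + w x)).
  move=> iu iv iw.
  rewrite (_ : EFin \o _ = fun x => (a%:E * (EFin \o u) x + b%:E * (EFin \o v) x + (EFin \o w) x)%E)//.
  by apply: integrableD => //; apply: integrableD => //; exact: integrableZl.
move=> [r1 i1] [r2 i2]; split.
  rewrite (_ : Re \o _ = fun x => Re c * Re (h1 x) + (- Im c) * Im (h1 x) + Re (h2 x)).
    exact: lin.
  by apply/funext => x /=; rewrite complex_ReD complex_ReM mulNr.
rewrite (_ : Im \o _ = fun x => Re c * Im (h1 x) + Im c * Re (h1 x) + Im (h2 x)).
  exact: lin.
by apply/funext => x /=; rewrite complex_ImD complex_ImM.
Qed.

Lemma cintegral_linear (c : R[i]) h1 h2 : cintegrable h1 -> cintegrable h2 ->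
  cintegral (fun x => c * h1 x + h2 x) = c * cintegral h1 + cintegral h2.
Proof.
have lin (u v w : E -> R) (a b : R) : mu.-integrable [set: T] (EFin \o u) ->
    mu.-integrable [set: T] (EFin \o v) -> mu.-integrable [set: T] (EFin \o w) ->
    \int[mu]_(x in [set: T]) (a * u x + b * v x + w x) =
    a * \int[mu]_(x in [set: T]) u x + b * \int[mu]_(x in [set: T]) v x + \int[mu]_(x in [set: T]) w x.
  move=> iu iv iw.
  have iau : mu.-integrable [set: T] (EFin \o (fun x => a * u x)) by exact: (integrableZl measurableT a iu).
  have ibv : mu.-integrable [set: T] (EFin \o (fun x => b * v x)) by exact: (integrableZl measurableT b iv).
  have iab : mu.-integrable [set: T] (EFin \o (fun x => a * u x + b * v x)) by exact: (integrableD measurableT iau ibv).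
  by rewrite RintegralD// RintegralD// !RintegralZl.
move=> [r1 i1] [r2 i2]; rewrite /cintegral; apply/eqP; rewrite eq_complex.
apply/andP; split; apply/eqP.
  rewrite complex_ReD complex_ReM /= -mulNr -lin//; apply: eq_Rintegral => x _.
  by rewrite /= complex_ReD complex_ReM mulNr.
rewrite complex_ImD complex_ImM /= -lin//; apply: eq_Rintegral => x _.
by rewrite /= complex_ImD complex_ImM.
Qed.

(** The factor 2 comes from bounding real and imaginary parts separately. *)
Lemma normc_cintegral_le G h : cintegrable h -> (forall x, ((normc (h x))%:E <= G x)%E) ->
  ((normc (cintegral h))%:E <= 2%:E * \int[mu]_x G x)%E.
Proof.
move=> [rh ih] hG; have part (u : E -> R) : mu.-integrable [set: T] (EFin \o u) ->
    (forall x, `|u x| <= normc (h x)) -> (`|\int[mu]_(x in [set: T]) u x|%:E <= \int[mu]_x G x)%E.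
  move=> iu uh; apply: le_trans (_ : ((\int[mu]_(x in [set: T]) `|u x|)%:E <= _)%E).
    by rewrite lee_fin; exact: le_normr_Rintegral.
  rewrite /Rintegral fineK; last by apply: integrable_fin_num => //; exact: integrable_norm.
  apply: ge0_le_integral_any => x _; first by rewrite lee_fin.
  by apply: le_trans (hG x); rewrite lee_fin.
apply: (@le_trans _ _ (`|Re (cintegral h)| + `|Im (cintegral h)|)%:E).
  by rewrite lee_fin; exact: normc_le.
rewrite EFinD (_ : 2%:E * _ = \int[mu]_x G x + \int[mu]_x G x)%E; last by rewrite mule_natl mule2n.
apply: leeD; apply: part => // x; [exact: Re_le_normc|exact: Im_le_normc].
Qed.

Lemma schwartz_cmeasurable phi : schwartz phi -> cmeasurable phi.
Proof.
move=> [sr si _]; split; apply: continuous_measurable_Rn; [exact: (sr [::]).1|exact: (si [::]).1].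
Qed.

Lemma schwartz_bound phi N : schwartz phi -> exists S : R,
  [/\ 0 <= S, schwartz_seminorm N phi = S%:E &
      forall x, normc (phi x) <= S * bracket_weight N x].
Proof.
move=> [_ _ /(_ N) Soo].
have le_S x : ((japanese_bracket x ^+ N * normc (phi x))%:E <= schwartz_seminorm N phi)%E.
  (* The empty list of directions selects [phi] itself. *)
  apply: ereal_sup_ubound; exists ([::], x) => //=; rewrite /citer_partial /=.
  by case: (phi x).
have S0 : (0 <= schwartz_seminorm N phi)%E.
  apply: le_trans (le_S 0); rewrite lee_fin mulr_ge0 ?normc_ge0// exprn_ge0// ltW//.
  exact: bracket_gt0.
have SE : schwartz_seminorm N phi = (fine (schwartz_seminorm N phi))%:E.
  by rewrite fineK// ge0_fin_numE.
exists (fine (schwartz_seminorm N phi)); split => // [|x]; first exact: fine_ge0.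
by rewrite ler_pdivlMr ?exprn_gt0 ?bracket_gt0// mulrC -lee_fin -SE.
Qed.

Lemma pairing_cintegrable f phi N : cmeasurable f ->
  (\int[mu]_x (normc (f x) * bracket_weight N x)%:E < +oo)%E -> schwartz phi ->
  cintegrable (fun x => f x * phi x).
Proof.
move=> mf foo sphi; have [S [S0 _ phiS]] := schwartz_bound N sphi.
have pos x : (0 <= (normc (f x) * bracket_weight N x)%:E)%E.
  by rewrite lee_fin mulr_ge0 ?normc_ge0// ltW// bracket_weight_gt0.
apply: (@cintegrable_le (fun x => S%:E * (normc (f x) * bracket_weight N x)%:E)%E).
- exact/cmeasurable_mul/schwartz_cmeasurable.
- move=> x; rewrite ComplexField.Normc.normcM -EFinM lee_fin mulrCA.
  by apply: ler_wpM2l; [exact: normc_ge0|exact: phiS].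
- rewrite ge0_integralZl_EFin//; last first.
    apply/measurable_EFinP/measurable_funM; [exact: measurable_normc|exact: measurable_bracket_weight].
  by rewrite lte_mul_pinfty ?lee_fin.
Qed.

(** A Schwartz function is at most its [N]-th seminorm times the weight, which yields both the
    convergence of the pairing and its continuity. *)
Lemma regular_tempered_bracket f N : cmeasurable f ->
  (\int[mu]_x (normc (f x) * bracket_weight N x)%:E < +oo)%E -> regular_tempered f.
Proof.
move=> mf foo; have int phi := @pairing_cintegrable f phi N mf foo; split; first exact: int.
split.
  move=> c phi psi sphi spsi; rewrite /pairing -cintegral_linear; [|exact: int|exact: int].
  by congr cintegral; apply/funext => x; rewrite mulrDr mulrCA.
have pos x : (0 <= (normc (f x) * bracket_weight N x)%:E)%E.
  by rewrite lee_fin mulr_ge0 ?normc_ge0// ltW// bracket_weight_gt0.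
have mfw : measurable_fun [set: T] (fun x : T => (normc (f x) * bracket_weight N x)%:E).
  apply/measurable_EFinP/measurable_funM; [exact: measurable_normc|exact: measurable_bracket_weight].
have [I IE] : exists I, (\int[mu]_x (normc (f x) * bracket_weight N x)%:E = I%:E)%E.
  exists (fine (\int[mu]_x (normc (f x) * bracket_weight N x)%:E)%E).
  by rewrite fineK// ge0_fin_numE// integral_ge0.
exists (2 * I), N => phi sphi; have [S [S0 -> phiS]] := schwartz_bound N sphi.
have le1 x : ((normc (f x * phi x))%:E <= S%:E * (normc (f x) * bracket_weight N x)%:E)%E.
  rewrite ComplexField.Normc.normcM -EFinM lee_fin mulrCA.
  by apply: ler_wpM2l; [exact: normc_ge0|exact: phiS].
apply: (le_trans (normc_cintegral_le (int phi sphi) le1)).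
by rewrite ge0_integralZl_EFin// IE -!EFinM mulrA mulrAC.
Qed.

Lemma normc_cvg0 (z : nat -> R[i]) : (fun N => Re (z N)) @ \oo --> (0 : R) ->
  (fun N => Im (z N)) @ \oo --> (0 : R) -> (fun N => normc (z N)) @ \oo --> (0 : R).
Proof.
move=> rz iz; apply: (@squeeze_cvgr _ _ _ _ (fun=> 0) (fun N => `|Re (z N)| + `|Im (z N)|)).
- by near=> N; rewrite normc_ge0 normc_le.
- exact: cvg_cst.
- by rewrite -[X in _ --> X]addr0 -{1}(normr0 R) -{2}(normr0 R); apply: cvgD; exact: cvg_norm.
Unshelve. all: by end_near. Qed.

Lemma cintegrable0 : cintegrable ((fun=> 0) : E -> R[i]).
Proof. by split; rewrite (_ : EFin \o _ = cst 0%E)//; exact: integrable0. Qed.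

Lemma cintegral0 : cintegral ((fun=> 0) : E -> R[i]) = 0.
Proof.
have H (P : R[i] -> R) : P 0 = 0 -> \int[mu]_(x in [set: T]) (P \o (fun=> 0)) x = 0.
  by move=> P0; rewrite (@eq_Rintegral _ _ _ mu _ (fun=> 0)) /Rintegral ?integral0.
rewrite /cintegral; apply/eqP; rewrite eq_complex /=.
by apply/andP; split; apply/eqP; [exact: (H Re erefl)|exact: (H Im erefl)].
Qed.

Lemma pairing_sum (lambda : nat -> R) (a : nat -> E -> R[i]) phi N :
  (forall j, regular_tempered (a j)) -> schwartz phi ->
  cintegrable (fun x => (\sum_(j < N) (lambda j)%:C%C * a j x) * phi x) /\
  \sum_(j < N) (lambda j)%:C%C * pairing (a j) phi =
  pairing (fun x => \sum_(j < N) (lambda j)%:C%C * a j x) phi.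
Proof.
move=> ra sphi; elim: N => [|N [IHi IHe]].
  have z : (fun x => (\sum_(j < 0) (lambda j)%:C%C * a j x) * phi x) = fun=> 0.
    by apply/funext => x; rewrite big_ord0 mul0r.
  by rewrite /pairing big_ord0 z cintegral0; split => //; exact: cintegrable0.
have e : (fun x => (\sum_(j < N.+1) (lambda j)%:C%C * a j x) * phi x) =
    fun x => (lambda N)%:C%C * (a N x * phi x) + (\sum_(j < N) (lambda j)%:C%C * a j x) * phi x.
  by apply/funext => x; rewrite big_ord_recr/= mulrDl addrC mulrA.
have iN := (ra N).1 _ sphi.
rewrite /pairing e; split; first exact: cintegrable_linear.
rewrite cintegral_linear// big_ord_recr/= addrC; congr (_ + _); exact: IHe.
Qed.

(** Dominated convergence for real and imaginary parts; the majorant is [G] times the weight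
    bounding [phi]. *)
Lemma pairing_series f (lambda : nat -> R) (a : nat -> E -> R[i]) G N :
  cmeasurable f -> (forall j, cmeasurable (a j)) -> (forall j, regular_tempered (a j)) ->
  measurable_fun [set: T] (G : T -> \bar R) -> (forall x, 0 <= G x)%E ->
  (\int[mu]_x (G x * (bracket_weight N x)%:E) < +oo)%E ->
  (forall k x, ((normc (\sum_(j < k) (lambda j)%:C%C * a j x))%:E <= G x)%E) ->
  {ae mu, forall x : T, (fun k => Re (\sum_(j < k) (lambda j)%:C%C * a j x)) @ \oo --> Re (f x) /\
                    (fun k => Im (\sum_(j < k) (lambda j)%:C%C * a j x)) @ \oo --> Im (f x)} ->
  forall phi, schwartz phi ->
  normc (\sum_(j < k) (lambda j)%:C%C * pairing (a j) phi - pairing f phi) @[k --> \oo] --> (0 : R).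
Proof.
move=> mf ma ra mG G0 Goo sG cvf phi sphi.
have [S [S0 _ phiS]] := schwartz_bound N sphi.
pose s k x := \sum_(j < k) (lambda j)%:C%C * a j x.
have sphiE k := pairing_sum lambda k ra sphi.
pose H x : \bar R := (S%:E * (G x * (bracket_weight N x)%:E))%E.
have H0 x : (0 <= H x)%E by rewrite !mule_ge0// lee_fin// ltW// bracket_weight_gt0.
have mw : measurable_fun [set: T] (fun x : T => (bracket_weight N x)%:E).
  exact/measurable_EFinP/measurable_bracket_weight.
have mGw : measurable_fun [set: T] (fun x : T => (G x * (bracket_weight N x)%:E)%E).
  exact: (emeasurable_funM mG mw).
have mH : measurable_fun [set: T] (H : T -> \bar R) by exact: measurable_funeM.
have Hoo : (\int[mu]_x H x < +oo)%E.
  rewrite ge0_integralZl_EFin//.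
    by rewrite lte_mul_pinfty ?lee_fin.
  by move=> x _; rewrite mule_ge0// lee_fin ltW// bracket_weight_gt0.
have iH : mu.-integrable [set: T] H.
  apply/integrableP; split => //; apply: le_lt_trans Hoo.
  by apply: ge0_le_integral_any => // x _; rewrite gee0_abs.
have sH k x : ((normc (s k x * phi x))%:E <= H x)%E.
  rewrite ComplexField.Normc.normcM /H EFinM muleCA; apply: lee_pmul.
  - by rewrite lee_fin normc_ge0.
  - by rewrite lee_fin normc_ge0.
  - exact: sG.
  - by rewrite -EFinM lee_fin.
have mfphi : cmeasurable (fun x => f x * phi x).
  exact/cmeasurable_mul/schwartz_cmeasurable.
have dct (P : R[i] -> R) : (forall z, `|P z| <= normc z) ->
    (forall k, mu.-integrable [set: T] (EFin \o (fun x => P (s k x * phi x)))) ->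
    measurable_fun [set: T] (fun x : T => P (f x * phi x)) ->
    {ae mu, forall x : T, (fun k => P (s k x * phi x)) @ \oo --> P (f x * phi x)} ->
    (fun k => \int[mu]_(x in [set: T]) P (s k x * phi x)) @ \oo -->
      (\int[mu]_(x in [set: T]) P (f x * phi x) : R).
  move=> Pn iP mP cP.
  have := @dominated_convergence _ _ _ mu setT measurableT
    (fun k x => (P (s k x * phi x))%:E) (fun x => (P (f x * phi x))%:E) H.
  case.
  - by move=> k; exact: measurable_int (iP k).
  - exact/measurable_EFinP.
  - by apply: filterS cP => x cx _; apply: cvg_EFin; [near=> k|exact: cx].
  - exact: iH.
  - apply: aeW => x k _; apply: le_trans (sH k x); rewrite lee_fin; exact: Pn.
  move=> iF _ cv; apply: fine_cvg; rewrite fineK; first exact: cv.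
  exact: integrable_fin_num.
have ri k := (sphiE k).1.

have limR := dct Re (@Re_le_normc R) (fun k => (ri k).1) mfphi.1.
have limI := dct Im (@Im_le_normc R) (fun k => (ri k).2) mfphi.2.

apply: normc_cvg0.
- rewrite (_ : (fun k => _) = fun k => \int[mu]_(x in [set: T]) Re (s k x * phi x) -
    \int[mu]_(x in [set: T]) Re (f x * phi x)); last first.
    by apply/funext => k; rewrite (sphiE k).2 complex_ReD /=.
  rewrite -[X in _ --> X](subrr (\int[mu]_(x in [set: T]) Re (f x * phi x))).
  apply: cvgB; last exact: cvg_cst.
  apply: limR; apply: filterS cvf => x [cr ci].
  rewrite complex_ReM (_ : (fun k => _) = fun k => Re (s k x) * Re (phi x) - Im (s k x) * Im (phi x)).
    by apply: cvgB; apply: cvgMl.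
  by apply/funext => k; rewrite complex_ReM.
- rewrite (_ : (fun k => _) = fun k => \int[mu]_(x in [set: T]) Im (s k x * phi x) -
    \int[mu]_(x in [set: T]) Im (f x * phi x)); last first.
    by apply/funext => k; rewrite (sphiE k).2 complex_ImD /=.
  rewrite -[X in _ --> X](subrr (\int[mu]_(x in [set: T]) Im (f x * phi x))).
  apply: cvgB; last exact: cvg_cst.
  apply: limI; apply: filterS cvf => x [cr ci].
  rewrite complex_ImM (_ : (fun k => _) = fun k => Re (s k x) * Im (phi x) + Im (s k x) * Re (phi x)).
    by apply: cvgD; apply: cvgMl.
  by apply/funext => k; rewrite complex_ImM.
Unshelve. all: by end_near. Qed.

End tempered_functions.

(** * Domination almost everywhere, bounded supports and null sets *)

Section morrey_monotonicity.
Context {R : realType} {n : nat}.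
Local Notation E := 'rV[R]_n.+1.
Local Notation T := (Rn R n).
Local Notation mu := (@leb R n).
Local Notation normc := ComplexField.Normc.normc.
Local Notation Re := (@complex.Re R).
Local Notation Im := (@complex.Im R).
Implicit Types (g h : E -> \bar R) (x : E).

(** Domination passes to rearrangements; comparing through the discrete quasi-norm treats all [r]
    alike and costs the two equivalence constants. *)
Lemma morrey_lorentz_ae_le (p q : R) (r : \bar R) : 0 < q -> (0 < r)%E ->
  exists2 C : R, 0 < C & forall g h (c : R), 0 < c ->
    mu [set x | ~ (`|g x| <= c%:E * `|h x|)%E] = 0%E ->
    (morrey_lorentz_norm p q r g <= (C * c)%:E * morrey_lorentz_norm p q r h)%E.
Proof.
move=> q0 r0; have [C1 C10 H1] := lorentz_norm_le_seq (n := n) q0 r0.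
have [C2 C20 H2] := seq_le_lorentz_norm (n := n) q0 r0.
exists (C1 * C2); first exact: mulr_gt0.
move=> g h c c0 gh; apply: ge_ereal_sup => _ [Q cQ <-].
set g' := fun x => (g x * (\1_Q x)%:E)%E; set h' := fun x => (h x * (\1_Q x)%:E)%E.
have gh' : mu [set x | ~ (`|g' x| <= c%:E * `|h' x| + 0%:E)%E] = 0%E.
  apply/eqP; rewrite eq_le measure_ge0 andbT -gh; apply: le_leb => x /= H H'; apply: H.
  by rewrite adde0 /g' /h' !abseM muleA; apply: lee_wpmul2r.
have lor : (lorentz_norm q r g' <= (C1 * C2 * c)%:E * lorentz_norm q r h')%E.
  apply: le_trans (H1 g') _; rewrite -mulrA EFinM -muleA; apply: lee_wpmul2l.
    by rewrite lee_fin ltW.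
  apply: (@le_trans _ _ (seqnorm r (fun m => (c%:E * lorentz_seq q h' m)%E))).
    apply: le_seqnorm => // m; rewrite lorentz_seq_ge0 /lorentz_seq muleCA.
    apply: lee_wpmul2l; first by rewrite lee_fin powR_ge0.
    by have := @rearrangement_affine R n g' h' c 0 (2 ^ m) c0 (lexx _) gh'; rewrite adde0.
  apply: le_trans (seqnormZ_le r0 (ltW c0) _) _; first by move=> m; exact: lorentz_seq_ge0.
  rewrite mulrC EFinM -muleA; apply: lee_wpmul2l; first by rewrite lee_fin ltW.
  exact: H2.
apply: (@le_trans _ _ ((C1 * C2 * c)%:E * (mu Q `^ (p^-1 - q^-1) * lorentz_norm q r h'))%E).
  by rewrite muleCA; apply: lee_wpmul2l; [exact: poweR_ge0|exact: lor].
apply: lee_wpmul2l; first by rewrite lee_fin !mulr_ge0// ltW.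
by apply: ereal_sup_ubound; exists Q.
Qed.

Lemma normc_0 : normc (0 : R[i]) = 0.
Proof. exact: ComplexField.Normc.normc0. Qed.

Lemma Linfty_le (a : E -> R[i]) (b : R) : cmeasurable a -> (forall x, normc (a x) <= b) -> Linfty a.
Proof.
move=> ma ab; split => //; rewrite unlock; case: ifP => _; last by rewrite ltry.
apply: (@le_lt_trans _ _ b%:E); last by rewrite ltry.
apply/ess_supP; apply: aeW => x; by rewrite /= lee_fin ger0_norm ?normc_ge0// ab.
Qed.

Lemma integrable_supported (g : int) (m : 'rV[int]_n.+1) (w : E -> R) (B : R) : measurable_fun [set: T] (w : T -> R) ->
  (forall x, w x != 0 -> cell g m x) -> (forall x, `|w x| <= B) ->
  mu.-integrable [set: T] (EFin \o w).
Proof.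
move=> mw wcell wB; have mc := @measurable_cell R n g m.
have iw : mu.-integrable (cell g m : set T) (EFin \o w).
  by apply: bounded_integrable_cell mw _ => x _; exact: wB.
have : mu.-integrable [set: T] ((EFin \o w : T -> \bar R) \_ (cell g m)).
  exact/(integrable_mkcond _ mc).
apply: eq_integrable => // x _; rewrite patchE /=; case: ifPn => //.
rewrite notin_setE => nx; have [->//|/wcell] := eqVneq (w x) 0.
by move=> xm; exfalso; apply: nx.
Qed.

(** A set of outer measure zero satisfies Caratheodory's condition, hence is measurable. *)
Lemma leb_null_ae (P : E -> Prop) : mu [set x | ~ P x] = 0%E -> {ae mu, forall x : T, P x}.
Proof.
move=> P0; exists [set x | ~ P x]; split => //.
by apply: le_caratheodory_measurable => X /=; 
  apply: (@le_trans _ _ (mu [set x | ~ P x] + mu X)%E);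
  [apply: leeD; apply: le_leb => x []|rewrite P0 add0e].
Qed.

End morrey_monotonicity.

(** * The atoms *)

Section atoms.
Context {R : realType} {n : nat} (K : nat).
Local Notation E := 'rV[R]_n.+1.
Local Notation T := (Rn R n).
Local Notation mu := (@leb R n).
Local Notation omega := (@unit_volume R n).
Local Notation ix := 'rV[int]_n.+1.
Local Notation normc := ComplexField.Normc.normc.
Local Notation Re := (@complex.Re R).
Local Notation Im := (@complex.Im R).
Variables (F : E -> R) (f : E -> R[i]).
Hypotheses (w0 : 0 < omega) (FE : forall x, F x = normc (f x)) (mf : cmeasurable f).
Hypothesis vF : vanishing_averages F.
Hypothesis F_le : forall x, ((F x)%:E <= 2%:E * dyadic_maximal F x)%E.
Hypothesis F_loc : forall g m, (integral_cell F g m < +oo)%E.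
Implicit Types (x : E).

Let mF : measurable_fun [set: T] (F : T -> R).
Proof. by rewrite (_ : F = fun x => normc (f x)); [exact: measurable_normc|apply/funext]. Qed.

Let F0 x : 0 <= F x. Proof. by rewrite FE normc_ge0. Qed.

Definition u_re x : R := Re (f x).
Definition u_im x : R := Im (f x).

Let mre : measurable_fun [set: T] (u_re : T -> R). Proof. exact: mf.1. Qed.
Let mim : measurable_fun [set: T] (u_im : T -> R). Proof. exact: mf.2. Qed.
Let reF x : `|u_re x| <= F x. Proof. by rewrite FE Re_le_normc. Qed.
Let imF x : `|u_im x| <= F x. Proof. by rewrite FE Im_le_normc. Qed.

(** Pieces are at most [3 * good_const * 2 ^ k]; the extra factor 2 brings real and imaginary parts
    down to 1/2 each, so that the modulus is at most 1. *)
Definition atom_scale : R := 6 * @good_const R n K.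

Lemma atom_scale_gt0 : 0 < atom_scale.
Proof. by rewrite mulr_gt0//; have := good_const_ge2 (R := R) (n := n) K; lra. Qed.

Definition atom_at (kd : int * (int * ix)) x : R[i] :=
  (((atom_scale * 2 ^ kd.1)^-1 * piece K F u_re kd.1 kd.2 x) +i*
  ((atom_scale * 2 ^ kd.1)^-1 * piece K F u_im kd.1 kd.2 x))%C.

Definition atom (j : nat) x : R[i] := oapp (atom_at^~ x) 0 (pickle_inv j).

Let scale_gt0 (k : int) : 0 < atom_scale * 2 ^ k.
Proof. by rewrite mulr_gt0 ?atom_scale_gt0// pow2_gt0. Qed.

(** The scale cancels; for a pair encoding no stopping cell both the weight and the pieces
    vanish. *)
Lemma atom_sum_terms j x : (weight_seq F atom_scale j)%:C%C * atom j x =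
  (piece_seq K F u_re j x +i* piece_seq K F u_im j x)%C.
Proof.
rewrite /weight_seq /atom /piece_seq; case: pickle_inv => [kd|] /=; last by rewrite mulr0.
rewrite /weight /atom_at; case: asboolP => [_|ne].
  apply/eqP; rewrite eq_complex /= !mul0r subr0 addr0 !mulrA mulfV ?mul1r ?eqxx//.
  by rewrite gt_eqF.
rewrite mul0r !piece_off//; by move=> H; apply: ne; exists x.
Qed.

Lemma measurable_atom j : cmeasurable (atom j).
Proof.
rewrite /atom; case: pickle_inv => [kd|] /=; last by split; exact: measurable_cst.
split; apply: measurable_funM; [exact: measurable_cst| |exact: measurable_cst|].
  exact: (measurable_piece K mre vF).
exact: (measurable_piece K mim vF).
Qed.

Lemma atom_part_bound kd x :
  `|(atom_scale * 2 ^ kd.1)^-1 * piece K F u_re kd.1 kd.2 x| <= 2^-1 /\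
  `|(atom_scale * 2 ^ kd.1)^-1 * piece K F u_im kd.1 kd.2 x| <= 2^-1.
Proof.
have half (u : E -> R) : measurable_fun [set: T] (u : T -> R) -> (forall y, `|u y| <= F y) ->
    `|(atom_scale * 2 ^ kd.1)^-1 * piece K F u kd.1 kd.2 x| <= 2^-1.
  move=> mu' uF; rewrite normrM ger0_norm; last by rewrite invr_ge0 ltW.
  rewrite ler_pdivrMl//; apply: (le_trans (piece_bound K w0 F0 mF mu' vF uF F_le F_loc _ _ _)).
  by rewrite /atom_scale; lra.
by split; apply: half.
Qed.

Lemma atom_supported j x : atom j x != 0 -> exists2 d, cell d.1 d.2 x & @cell_seq R n j = closed_cell d.1 d.2.
Proof.
rewrite /atom /cell_seq; case: pickle_inv => [kd|] /=; last by rewrite eqxx.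
move=> ax; exists kd.2 => //; rewrite -(@stopped_cellE _ _ F (2 ^ kd.1) kd.2 x).
  by apply: contrapT => /= nx; move: ax; rewrite /atom_at !piece_off// mulr0 eqxx.
by apply: contrapT => /= nx; move: ax; rewrite /atom_at !piece_off// mulr0 eqxx.
Qed.

Lemma atom_le1 j x : normc (atom j x) <= 1.
Proof.
rewrite /atom; case: pickle_inv => [kd|]; last first.
  by apply: le_trans ler01; rewrite le_eqVlt; apply/orP; left; apply/eqP; exact: normc_0.
apply: (le_trans (normc_le _)); have [h1 h2] := atom_part_bound kd x.
rewrite /atom_at /=; lra.
Qed.

Lemma atom_le_indic j x : normc (atom j x) <= \1_(@cell_seq R n j) x.
Proof.
have [->|ax] := eqVneq (atom j x) 0; first by rewrite normc_0.
have [d xd cE] := atom_supported ax.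
by rewrite indicE mem_set ?atom_le1// cE; exact: cell_sub_closed.
Qed.

(** An atom is bounded and supported in one cell, where [b] is bounded; this serves for powers of
    the bracket. *)
Lemma atom_integrable j (b : E -> R) : measurable_fun [set: T] (b : T -> R) ->
  (forall g m, exists B, forall x, cell g m x -> `|b x| <= B) ->
  cintegrable (fun x => (b x)%:C%C * atom j x).
Proof.
move=> mb bB; have ma := measurable_atom j.
rewrite /atom in ma *; case: pickle_inv ma => [[k [g m]]|] /= ma; last first.
  rewrite (_ : (fun x => _) = fun=> 0); first exact: cintegrable0.
  by apply/funext => x; rewrite mulr0.
have [B HB] := bB g m.
have B0 : 0 <= Num.max B 0 by rewrite le_max lexx orbT.
have supp (u : E -> R) x : (atom_scale * 2 ^ k)^-1 * piece K F u k (g, m) x != 0 -> cell g m x.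
  rewrite mulf_eq0 negb_or => /andP[_ px]; apply: contrapT => nx; move/eqP: px; apply.
  apply: piece_off => dx; apply: nx; by rewrite -(stopped_cellE dx).
have main (c : E -> R) : measurable_fun [set: T] (c : T -> R) -> (forall x, c x != 0 -> cell g m x) ->
    (forall x, `|c x| <= 2^-1) -> mu.-integrable [set: T] (EFin \o (fun x => b x * c x)).
  move=> mc cs cb; apply: (@integrable_supported R n g m _ (Num.max B 0)).
  - exact: measurable_funM.
  - by move=> x; rewrite mulf_eq0 negb_or => /andP[_ /cs].
  - move=> x; have [->|/cs xm] := eqVneq (c x) 0; first by rewrite mulr0 normr0.
    rewrite normrM; apply: (@le_trans _ _ (Num.max B 0 * 1)); last by rewrite mulr1.
    apply: ler_pM => //; first by apply: (le_trans (HB _ xm)); rewrite le_max lexx.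
    by apply: (le_trans (cb x)); lra.
split.
- rewrite (_ : EFin \o _ = EFin \o (fun x => b x * ((atom_scale * 2 ^ k)^-1 * piece K F u_re k (g, m) x))).
    apply: main; [exact: ma.1|exact: supp|by move=> x; have [] := atom_part_bound (k, (g, m)) x].
  by apply/funext => x; rewrite /= mul0r subr0.
- rewrite (_ : EFin \o _ = EFin \o (fun x => b x * ((atom_scale * 2 ^ k)^-1 * piece K F u_im k (g, m) x))).
    apply: main; [exact: ma.2|exact: supp|by move=> x; have [] := atom_part_bound (k, (g, m)) x].
  by apply/funext => x; rewrite /= mul0r addr0.
Qed.

Lemma measurable_monomial (alpha : 'I_n.+1 -> nat) :
  measurable_fun [set: T] (monomial alpha : T -> R).
Proof.
have H := measurable_shifted_monomial (f := fun i (x : T) => (x : E) 0 i) 1 (fun=> 0) alpha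
  (@measurable_coordinate R n).
apply: (eq_measurable_fun (fun x : T => \prod_i ((x : E) 0 i / 1 - 0) ^+ alpha i)); last exact: H.
by move=> x _; apply: eq_bigr => i _; rewrite divr1 subr0.
Qed.

Lemma monomial_bounded_cell (alpha : 'I_n.+1 -> nat) g m :
  exists B : R, forall x, cell g m x -> `|monomial alpha x| <= B.
Proof.
pose N := \max_i alpha i.
have [c cE] := @monomial_cell R n N g m alpha (fun i => leq_bigmax i).
exists (\sum_a `|c a|) => x xm; rewrite cE; apply: le_trans (ler_norm_sum _ _ _) _.
apply: ler_sum => a _; have /andP[h1 h2] := cell_monomial_itv a xm.
by rewrite normrM [X in _ * X]ger0_norm// ler_piMr.
Qed.

Lemma moments_vanish_atom j : moments_vanish K (atom j).
Proof.
split; first exact: measurable_atom.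
- apply: (atom_integrable j (b := fun x => japanese_bracket x ^+ K)).
    by apply: measurable_funX; exact: measurable_bracket.
  move=> g m; have [B HB] := @bracket_bounded_cell R n g m; exists (B ^+ K) => x xm.
  have b0 : 0 <= japanese_bracket x by rewrite ltW// bracket_gt0.
  rewrite ger0_norm ?exprn_ge0// lerXn2r ?nnegrE ?(le_trans b0) ?HB//.
- move=> alpha aK.
  (* Total degree at most [K] bounds every exponent by [K], the range covered by [moment_piece]. *)
  have aiK i : (alpha i <= K)%N.
    by apply: leq_trans aK; rewrite (bigD1 i)//= leq_addr.
  rewrite /atom; case: pickle_inv => [[k d]|] /=; last first.
    rewrite (_ : (fun x => _) = fun=> 0); first exact: cintegral0.
    by apply/funext => x; rewrite mulr0.
  have part (u : E -> R) : measurable_fun [set: T] (u : T -> R) -> (forall y, `|u y| <= F y) ->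
      \int[mu]_(x in [set: T]) (monomial alpha x * ((atom_scale * 2 ^ k)^-1 * piece K F u k d x)) = 0.
    move=> mu' uF; rewrite (@eq_Rintegral _ _ _ mu _ (fun x => (atom_scale * 2 ^ k)^-1 * (monomial alpha x * piece K F u k d x))); last first.
      by move=> x _; rewrite mulrCA.
    rewrite RintegralZl//.
      by rewrite (moment_piece w0 F0 mF mu' vF uF F_le F_loc)// mulr0.
    have [B HB] := monomial_bounded_cell alpha d.1 d.2.
    apply: (@integrable_supported R n d.1 d.2 _ (Num.max B 0 * (3 * good_const K * 2 ^ k))).
    - apply: measurable_funM; [exact: measurable_monomial|exact: measurable_piece].
    - by move=> x; rewrite mulf_eq0 negb_or => /andP[_]; exact: piece_sub_cell.
    - move=> x; rewrite normrM; have pb := piece_bound K w0 F0 mF mu' vF uF F_le F_loc k d x.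
      have [->|/piece_sub_cell xd] := eqVneq (piece K F u k d x) 0.
        rewrite normr0 mulr0 mulr_ge0//; first by rewrite le_max lexx orbT.
        exact: le_trans pb.
      by apply: ler_pM => //; apply: (le_trans (HB x xd)); rewrite le_max lexx.
  rewrite /cintegral; apply/eqP; rewrite eq_complex; apply/andP; split; apply/eqP.
    rewrite /= -[RHS](part u_re)//; apply: eq_Rintegral => x _.
    by rewrite /= mul0r subr0.
  rewrite /= -[RHS](part u_im)//; apply: eq_Rintegral => x _.
  by rewrite /= mul0r addr0.
Qed.

End atoms.

(** * Truncation on a null set and assembly of the decomposition *)

Section atomic_decomposition.
Context {R : realType} {n : nat}.
Local Notation E := 'rV[R]_n.+1.
Local Notation T := (Rn R n).
Local Notation mu := (@leb R n).
Local Notation omega := (@unit_volume R n).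
Local Notation normc := ComplexField.Normc.normc.
Local Notation Re := (@complex.Re R).
Local Notation Im := (@complex.Im R).
Implicit Types (f : E -> R[i]) (x : E) (v : R).

(** The conclusion of the theorem for one [f], shared by the cases of zero and positive
    [unit_volume]. *)
Definition decomposes (p q : R) (r : \bar R) (K : nat) (C : R -> R) f : Prop :=
  exists (lambda : nat -> R) (Q : nat -> set E) (a : nat -> E -> R[i]),
      [/\ forall j, 0 <= lambda j,
          forall j, cube (Q j) &
          forall j, Linfty (a j) /\ moments_vanish K (a j)] /\
      [/\ tempered_series f lambda a,
          forall j x, normc (a j x) <= \1_(Q j) x &
          forall v : R, 0 < v ->
            (morrey_lorentz_norm p q r
               (fun x => (\sum_(j <oo) ((lambda j * \1_(Q j) x) `^ v)%:E)
                           `^ v^-1)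
             <= (C v)%:E * morrey_lorentz_norm p q r (cmod f))%E].

(* Positivity of the measure of the unit cell need not be known: were the cell
   null, every set would be. *)
Lemma decomposes_null (p q : R) (r : \bar R) K : 0 < q -> (0 < r)%E -> omega = 0 ->
  exists2 C : R, 0 < C & forall f, cmeasurable f -> decomposes p q r K (fun=> C) f.
Proof.
move=> q0 r0 w0; have [C C0 HC] := morrey_lorentz_ae_le (n := n) p q0 r0.
exists C => // f mf; exists (fun=> 0), (fun=> closed_cell 0 0), (fun _ _ => 0).
have null (h : T -> \bar R) : measurable_fun [set: T] h -> (\int[mu]_x h x = 0)%E.
  by move=> mh; apply: null_set_integral => //; exact: unit_volume_null.
have m0 : @cmeasurable R n (fun=> 0) by split; exact: measurable_cst.
have reg h : @cmeasurable R n h -> regular_tempered h.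
  move=> mh; apply: (@regular_tempered_bracket R n h 0) => //; rewrite null//.
  apply/measurable_EFinP/measurable_funM; [exact: measurable_normc|exact: measurable_bracket_weight].
split; split.
- by [].
- by move=> j; exact: cube_closed_cell.
- move=> j; split; first by apply: (@Linfty_le R n _ 0) => // x; rewrite normc_0.
  have z (b : E -> R) : (fun x => (b x)%:C%C * 0 : R[i]) = fun=> 0.
    by apply/funext => x; rewrite mulr0.
  by split => // [|alpha _]; rewrite z; [exact: cintegrable0|exact: cintegral0].
- split; [exact: reg|by move=> j; exact: reg|].
  move=> phi sphi; rewrite (_ : (fun N => _) = fun=> 0); first exact: cvg_cst.
  apply/funext => N; rewrite big1 => [|j _]; last by rewrite mul0r.
  have pz : pairing f phi = 0.
    have [i1 i2] := cmeasurable_mul mf (schwartz_cmeasurable sphi).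
    have n1 := null _ ((measurable_EFinP _ _).2 i1).
    have n2 := null _ ((measurable_EFinP _ _).2 i2).
    by apply/eqP; rewrite eq_complex; apply/andP; split; apply/eqP;
      [exact: (congr1 fine n1)|exact: (congr1 fine n2)].
  by rewrite pz subr0 normc_0.
- by move=> j x; rewrite normc_0.
- move=> v v0; rewrite -[C]mulr1; apply: HC => //.
  rewrite (_ : [set _ | _] = set0) ?measure0//; apply/seteqP; split => // x /=; apply.
  rewrite eseries0 => [|j _ _]; last by rewrite mul0r powR0// gt_eqF.
  by rewrite poweR0r ?gt_eqF ?invr_gt0// abse0 mul1e.
Qed.

Section truncation.
Variable f : E -> R[i].
Hypotheses (w0 : 0 < omega) (mf : cmeasurable f).

Let F x : R := normc (f x).

Definition modulus_controlled : set E := [set x | ((F x)%:E <= 2%:E * dyadic_maximal F x)%E].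

(** Makes the bound by twice the maximal function hold at every point, as the pointwise bound on the
    atoms requires, while leaving all dyadic averages unchanged. *)
Definition truncation x : R[i] := if `[< modulus_controlled x >] then f x else 0.

Let F0 x : 0 <= F x. Proof. exact: normc_ge0. Qed.

Let mF : measurable_fun [set: T] (F : T -> R). Proof. exact: measurable_normc. Qed.

Lemma measurable_modulus_controlled : measurable (modulus_controlled : set T).
Proof.
have := measurable_lee measurableT (f := (EFin \o F : T -> \bar R))
  (g := fun x : T => (2%:E * dyadic_maximal F x)%E); rewrite setTI; apply.
  exact/measurable_EFinP.
exact/measurable_funeM/measurable_dyadic_maximal.
Qed.

Lemma modulus_controlled_null : mu (~` modulus_controlled) = 0%E.
Proof. exact: ae_le_dyadic_maximal. Qed.

Lemma cmeasurable_truncation : cmeasurable truncation.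
Proof.
have part (P : R[i] -> R) : P 0 = 0 -> measurable_fun [set: T] (fun x : T => P (f x)) ->
    measurable_fun [set: T] (fun x : T => P (truncation x)).
  move=> P0 mP; apply: (eq_measurable_fun (fun x : T => P (f x) * \1_modulus_controlled x)).
    move=> x _; rewrite /truncation indicE; case: asboolP => [cx|ncx].
      by rewrite mem_set ?mulr1.
    by rewrite memNset ?mulr0.
  by apply: measurable_funM => //; exact/measurable_indic/measurable_modulus_controlled.
by split; [exact: (part Re erefl mf.1)|exact: (part Im erefl mf.2)].
Qed.

Lemma normc_truncation_le x : normc (truncation x) <= F x.
Proof. by rewrite /truncation; case: asboolP => // _; rewrite normc_0. Qed.

Lemma integral_cell_truncation g m :
  integral_cell (fun x => normc (truncation x)) g m = integral_cell F g m.
Proof.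
have mc := @measurable_cell R n g m.
apply: ge0_ae_eq_integral => //.
- by apply/measurable_EFinP; apply: measurable_funS (measurable_normc cmeasurable_truncation).
- by apply/measurable_EFinP; apply: measurable_funS mF.
- by move=> x _; rewrite lee_fin normc_ge0.
- by move=> x _; rewrite lee_fin.
- apply: (@filterS _ _ _ (fun x : T => modulus_controlled x)); last exact/leb_null_ae/modulus_controlled_null.
  by move=> x cx _; rewrite /truncation asboolT.
Qed.

Lemma dyadic_maximal_truncation x :
  dyadic_maximal (fun y => normc (truncation y)) x = dyadic_maximal F x.
Proof.
rewrite /dyadic_maximal; congr ereal_sup; apply/seteqP.
by split => _ [g _ <-]; exists g => //; rewrite integral_cell_truncation.
Qed.

Lemma truncation_le_maximal x : ((normc (truncation x))%:E <=
  2%:E * dyadic_maximal (fun y => normc (truncation y)) x)%E.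
Proof.
rewrite dyadic_maximal_truncation /truncation; case: asboolP => // _.
by rewrite normc_0 mule_ge0// dyadic_maximal_ge0.
Qed.

End truncation.

Lemma decomposes_positive (p q : R) (r : \bar R) K : 0 < omega -> 1 < q -> q <= p -> (0 < r)%E ->
  exists C : R -> R, (forall v, 0 < v -> 0 < C v) /\
    forall f, morrey_lorentz p q r f -> decomposes p q r K C f.
Proof.
move=> w0 q1 qp r0; have q0 : 0 < q by exact: lt_trans q1.
have p0 : 0 < p by exact: lt_le_trans qp.
have [C1 C10 mono] := morrey_lorentz_ae_le (n := n) p q0 r0.
have [C2 C20 maxi] := dyadic_maximal_morrey (n := n) w0 q1 qp r0.
have [C3 C30 cellb] := integral_cell_morrey (n := n) p w0 q1 r0.
have L0 := atom_scale_gt0 (R := R) (n := n) K; set L := atom_scale K in L0.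
(* The constants are chosen as a function of [v] before any [F]; for nonpositive [v] the value is a
   dummy. *)
have /choice[D HD] : forall v, exists D : R, 0 < v -> 0 < D /\ forall F x,
    (forall y, 0 <= F y) -> vanishing_averages F -> ~ dyadic_boundary x ->
    ((\sum_(j <oo) ((weight_seq F L j * \1_(@cell_seq R n j) x) `^ v)%:E) `^ v^-1 <=
      (D * L)%:E * dyadic_maximal F x)%E.
  move=> v; have [v0|nv0] := pselect (0 < v); last by exists 0.
  have [D D0 HD] := weight_sum_bound (n := n) w0 v0; exists D => _; split => // F x.
  exact: HD.
(* [C1 * (D v * L)] passes from the l^v sum to the maximal function, [C2] is the bound of the
   maximal operator, and the last [C1] compares the truncation with [f]. *)
exists (fun v => C1 * (D v * L) * (C2 * C1)); split.
  move=> v /HD[D0 _]; apply: mulr_gt0; last exact: mulr_gt0.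
  by apply: mulr_gt0 => //; exact: mulr_gt0.
move=> f [mf foo]; pose f' := truncation f; pose F x := normc (f' x).
have mf' : cmeasurable f' by exact: cmeasurable_truncation.
have F0 x : 0 <= F x by exact: normc_ge0.
have mF : measurable_fun [set: T] (F : T -> R) by exact: measurable_normc.
have FleM : (morrey_lorentz_norm p q r (EFin \o F) <= C1%:E * morrey_lorentz_norm p q r (cmod f))%E.
  rewrite -[C1]mulr1; apply: mono => //.
  rewrite (_ : [set _ | _] = set0) ?measure0//; apply/seteqP; split => // x /=; apply.
  rewrite mul1e /cmod lee_fin !ger0_norm ?normc_ge0//; exact: normc_truncation_le.
have Foo : (morrey_lorentz_norm p q r (EFin \o F) < +oo)%E.
  by apply: le_lt_trans FleM _; rewrite lte_mul_pinfty// lee_fin ltW.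
have vF : vanishing_averages F by exact: (vanishing_morrey w0 p0 q1 r0 F0 mF Foo).
have F_le x : ((F x)%:E <= 2%:E * dyadic_maximal F x)%E by exact: truncation_le_maximal.
have F_loc g m : (integral_cell F g m < +oo)%E.
  apply: le_lt_trans (cellb F g m F0 mF) _; rewrite lte_mul_pinfty//.
  by rewrite lee_fin mulr_ge0 ?powR_ge0// ltW.
have MF0 x := dyadic_maximal_ge0 x F0 w0.
have mMF := measurable_dyadic_maximal F w0.
have MFM := maxi F F0 mF.
have MFoo : (morrey_lorentz_norm p q r (dyadic_maximal F) < +oo)%E.
  by apply: le_lt_trans MFM _; rewrite lte_mul_pinfty// ?morrey_lorentz_ge0// lee_fin ltW.
have MFw := integral_morrey_bracket w0 q1 qp r0 mMF MF0 MFoo.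
have mMFw : measurable_fun [set: T] (fun x : T => (dyadic_maximal F x * (bracket_weight n.+2 x)%:E)%E).
  have mw : measurable_fun [set: T] (EFin \o bracket_weight n.+2 : T -> \bar R).
    exact/measurable_EFinP/measurable_bracket_weight.
  exact: (emeasurable_funM mMF mw).
have FE x : F x = normc (f' x) by [].
pose a := @atom R n K F f'.
have ma j : cmeasurable (a j) by exact: measurable_atom.
(* The maximal function has a finite integral against a positive weight. *)
have fin_ae : {ae mu, forall x : T, (dyadic_maximal F x < +oo)%E}.
  have iM : mu.-integrable [set: T] (fun x : T => (dyadic_maximal F x * (bracket_weight n.+2 x)%:E)%E).
    apply/integrableP; split; first exact: mMFw.
    apply: le_lt_trans MFw.
    apply: ge0_le_integral_any => // x _; rewrite gee0_abs//.
    by rewrite mule_ge0// lee_fin ltW// bracket_weight_gt0.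
  apply: filterS (integrable_ae measurableT iM) => x /(_ I).
  case: (dyadic_maximal F x) (MF0 x) => [y _ _|_|//]; first by rewrite ltry.
  by rewrite gt0_mulye// lte_fin bracket_weight_gt0.
have tr_ae : {ae mu, forall x : T, f' x = f x}.
  apply: (@filterS _ _ _ (fun x : T => modulus_controlled f x)); last first.
    exact/leb_null_ae/modulus_controlled_null.
  by move=> x cx; rewrite /f' /truncation asboolT.
have aw j : (\int[mu]_x (normc (a j x) * bracket_weight n.+2 x)%:E < +oo)%E.
  have [c [l [l0 cE]]] := cubeE (cube_cell_seq (R := R) (n := n) j).
  apply: (@le_lt_trans _ _ (\int[mu]_x (\1_(@cell_seq R n j) x)%:E)%E).
    apply: ge0_le_integral_any => x _.
      by rewrite lee_fin mulr_ge0 ?normc_ge0// ltW// bracket_weight_gt0.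
    rewrite lee_fin -[leRHS]mulr1; apply: ler_pM.
    - exact: normc_ge0.
    - by rewrite ltW// bracket_weight_gt0.
    - exact: atom_le_indic.
    - exact: bracket_weight_le1.
  rewrite integral_indic//; last by rewrite cE; exact: measurable_box.
  by rewrite setIT cE [X in (X < _)%E]leb_cube// ltry.
have reg j : regular_tempered (a j) by exact: regular_tempered_bracket (aw j).
exists (weight_seq F L), (@cell_seq R n), a; split; split.
- by move=> j; apply: weight_seq_ge0; exact: ltW.
- exact: cube_cell_seq.
- move=> j; split; last exact: moments_vanish_atom.
  by apply: (@Linfty_le R n _ 1) => // x; exact: atom_le1.
- split => //.
    apply: (@regular_tempered_bracket R n f n.+2) => //.
    have mcf : measurable_fun [set: T] (cmod f : T -> \bar R).
      by apply/measurable_EFinP; exact: measurable_normc.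
    have cf0 x : (0 <= cmod f x)%E by rewrite lee_fin normc_ge0.
    exact: (integral_morrey_bracket w0 q1 qp r0 mcf cf0 foo).
  have reF x : `|u_re f' x| <= F x by exact: Re_le_normc.
  have imF x : `|u_im f' x| <= F x by exact: Im_le_normc.
  have [B1 B10 HB1] := piece_seq_sum_bound K w0 F0 mF mf'.1 vF reF F_le F_loc.
  have [B2 B20 HB2] := piece_seq_sum_bound K w0 F0 mF mf'.2 vF imF F_le F_loc.
  pose gc := 3 * @good_const R n K.
  have gc0 : 0 < gc by rewrite mulr_gt0//; have := good_const_ge2 (R := R) (n := n) K; lra.
  have sumE k x : \sum_(j < k) (weight_seq F L j)%:C%C * a j x =
      ((\sum_(j < k) piece_seq K F (u_re f') j x) +i* (\sum_(j < k) piece_seq K F (u_im f') j x))%C.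
    elim: k => [|k IH]; first by rewrite !big_ord0.
    by rewrite !big_ord_recr/= IH atom_sum_terms.
  pose G x := (((B1 + B2) * gc)%:E * dyadic_maximal F x)%E.
  have BG0 : 0 <= (B1 + B2) * gc by rewrite mulr_ge0 ?addr_ge0// ltW.
  have G0 x : (0 <= G x)%E by rewrite mule_ge0.
  have mG : measurable_fun [set: T] (G : T -> \bar R) by exact: measurable_funeM.
  have Mw0 x : [set: T] x -> (0 <= dyadic_maximal F x * (bracket_weight n.+2 x)%:E)%E.
    by move=> _; rewrite mule_ge0// lee_fin ltW// bracket_weight_gt0.
  have Gw : (\int[mu]_x (G x * (bracket_weight n.+2 x)%:E) < +oo)%E.
    rewrite (eq_integral (fun x : T => ((B1 + B2) * gc)%:E * (dyadic_maximal F x * (bracket_weight n.+2 x)%:E))%E).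
      by rewrite (ge0_integralZl_EFin mu measurableT Mw0 mMFw BG0) lte_mul_pinfty.
    by move=> x _; rewrite muleA.
  have sG k x : ((normc (\sum_(j < k) (weight_seq F L j)%:C%C * a j x))%:E <= G x)%E.
    rewrite sumE; apply: (@le_trans _ _ ((\sum_(j < k) `|piece_seq K F (u_re f') j x|) +
        (\sum_(j < k) `|piece_seq K F (u_im f') j x|))%:E).
      rewrite lee_fin; apply: le_trans (normc_le _) _; apply: lerD; exact: ler_norm_sum.
    rewrite EFinD /G mulrDl EFinD ge0_muleDl; last 2 first.
      by rewrite lee_fin mulr_ge0// ltW.
      by rewrite lee_fin mulr_ge0// ltW.
    by apply: leeD; [exact: HB1|exact: HB2].
  apply: (pairing_series mf ma reg mG G0 Gw sG).
  (* The pieces sum to the truncation, which equals [f] almost everywhere. *)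
  apply: filterS2 fin_ae tr_ae => x Mx fx; rewrite -fx; split.
    rewrite (_ : (fun k => _) = fun k => \sum_(j < k) piece_seq K F (u_re f') j x).
      exact: (piece_series K w0 F0 mF mf'.1 vF reF F_le F_loc Mx).
    by apply/funext => k; rewrite sumE.
  rewrite (_ : (fun k => _) = fun k => \sum_(j < k) piece_seq K F (u_im f') j x).
    exact: (piece_series K w0 F0 mF mf'.2 vF imF F_le F_loc Mx).
  by apply/funext => k; rewrite sumE.
- by move=> j x; exact: atom_le_indic.
- move=> v v0; have [D0 {}HD] := HD v v0.
  have DL0 : 0 < D v * L by exact: mulr_gt0.
  apply: le_trans (mono _ (dyadic_maximal F) (D v * L) DL0 _) _.
    apply/eqP; rewrite eq_le measure_ge0 andbT -[leRHS](dyadic_boundary_null (R := R) (n := n)).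
    apply: le_leb => x /= H; apply: contrapT => nx; apply: H.
    rewrite !gee0_abs ?poweR_ge0//; exact: HD.
  rewrite [X in (_ <= X * _)%E]EFinM -[leRHS]muleA; apply: lee_wpmul2l.
    by rewrite lee_fin ltW// mulr_gt0.
  apply: le_trans MFM _; rewrite EFinM -muleA; apply: lee_wpmul2l => //.
  by rewrite lee_fin ltW.
Qed.

End atomic_decomposition.

Theorem theorem1p4 (R : realType) (n : nat) (p q : R) (r : \bar R) (K : nat)
    (q_gt1 : 1 < q) (q_le_p : q <= p) (r_gt0 : (0 < r)%E) :
  exists C : R -> R,
    (forall v : R, 0 < v -> 0 < C v) /\
    forall f : 'rV[R]_n.+1 -> R[i], morrey_lorentz p q r f ->
    exists (lambda : nat -> R) (Q : nat -> set 'rV[R]_n.+1)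
           (a : nat -> 'rV[R]_n.+1 -> R[i]),
      [/\ forall j, 0 <= lambda j,
          forall j, cube (Q j) &
          forall j, Linfty (a j) /\ moments_vanish K (a j)] /\
      [/\ tempered_series f lambda a,
          forall j x, ComplexField.Normc.normc (a j x) <= \1_(Q j) x &
          forall v : R, 0 < v ->
            (morrey_lorentz_norm p q r
               (fun x => (\sum_(j <oo) ((lambda j * \1_(Q j) x) `^ v)%:E)
                           `^ v^-1)
             <= (C v)%:E * morrey_lorentz_norm p q r (cmod f))%E].
Proof.
have q0 : 0 < q by exact: lt_trans q_gt1.
have := @unit_volume_ge0 R n; rewrite le_eqVlt => /orP[/eqP/esym w0|w0].
  have [C C0 HC] := decomposes_null p K q0 r_gt0 w0.
  by exists (fun=> C); split => // f [mf _]; exact: HC.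
exact: decomposes_positive.
Qed.
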